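(* Let $\Omega=(a,b)$, $\alpha\in\Omega$, $\beta^\pm>0$, let $\gamma,c$ be constants, and let $p\ge2$. Let $\mathcal T_h=\{\tau_i\}_{i=1}^N$ be a partition of $\Omega$ with mesh size $h$ such that the interface $\alpha\in\tau_k$. Let $u\in\tilde W^{p+2,\infty}_\beta(\Omega)$ be the exact solution of $$-(\beta u')'+\gamma u'+cu=f\ \text{ in }\Omega^-\cup\Omega^+,\qquad u(a)=u(b)=0,\qquad [\![u(\alpha)]\!]=0,\quad[\![\beta u'(\alpha)]\!]=0,$$ and let $u_h\in S_p(\mathcal T_h)$ be the immersed finite element solution, i.e. $(\beta u_h',v_h')+(\gamma u_h',v_h)+(cu_h,v_h)=(f,v_h)$ for all $v_h\in S_p(\mathcal T_h)$. Then: (i) There exists a constant $C$, depending on $p$, $\rho$, $\gamma$, $c$, such that on every noninterface element $\tau_i$, $i\neq k$, $$|(u-u_h)(l_{im})|\le Ch^{p+2}\|u\|_{p+2,\infty},\qquad |(u'-u_h')(g_{in})|\le Ch^{p+1}\|u\|_{p+2,\infty},$$ where $l_{im}$, $m=0,1,\dots,p$, are the roots of the Lobatto polynomial $\psi_{i,p+1}$, including the mesh points, and $g_{in}$, $n=1,\dots,p$, are the roots of the Legendre polynomial $P_{i,p}$. (ii) There exists a constant $C$, depending on $p$, $\rho$, $\gamma$, $c$, such that on the interface element $\tau_k$, $$|(u-u_h)(l_{km})|\le Ch^{p+2}\|u\|_{p+2,\infty},\qquad |(\beta u'-\beta u_h')(g_{kn})|\le Ch^{p+1}\|u\|_{p+2,\infty},$$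 where $l_{km}$, $m=0,1,\dots,p$, are the roots of the generalized Lobatto polynomial $\phi_{k,p+1}$, including the mesh points, and $g_{kn}$, $n=1,\dots,p$, are the roots of the generalized Legendre polynomial $L_{k,p}$. Here $\rho=\max\{\beta^+,\beta^-\}/\min\{\beta^+,\beta^-\}$.
   Context: Setting: $\Omega^-=(a,\alpha)$, $\Omega^+=(\alpha,b)$; $\beta=\beta^-$ on $\Omega^-$, $\beta=\beta^+$ on $\Omega^+$. $[\![v(\alpha)]\!]=v(\alpha^+)-v(\alpha^-)$. $(\cdot,\cdot)$ is the $L^2(a,b)$ inner product. Spaces: $\tilde W^{m,q}_\beta(\Omega)$ is the set of $v\in C(\Omega)$ with $v|_{\Omega^\pm}\in W^{m,q}(\Omega^\pm)$, $v|_{\partial\Omega}=0$, and $[\![\beta v^{(j)}(\alpha)]\!]=0$ for $j=1,2,\dots,m$. Norms are piecewise: $\|v\|_{m,\infty}=\max\{\|v\|_{m,\infty,\Omega^-},\|v\|_{m,\infty,\Omega^+}\}$. Mesh: $a=x_0<x_1<\dots<x_{k-1}\le\alpha\le x_k<\dots<x_N=b$, $\tau_i=(x_{i-1},x_i)$, $h_i=x_i-x_{i-1}$, $h=\max_i h_i$. $\tau_k$ is the interface element, the others are noninterface elements. Standard polynomials on $[-1,1]$: $P_n$ is the Legendre polynomial of degree $n$; Lobatto polynomials $\psi_0=\frac{1-\xi}2$, $\psi_1=\frac{1+\xi}2$, $\psi_n(\xi)=\int_{-1}^\xi P_{n-1}(t)\,dt$ for $n\ge2$. Generalized polynomials on $[-1,1]$: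 let $\hat\alpha$ be the image of $\alpha$ under the affine map $\tau_k\to[-1,1]$, $\hat\beta=\beta^-$ on $(-1,\hat\alpha)$, $\hat\beta=\beta^+$ on $(\hat\alpha,1)$, $w=1/\hat\beta$. The generalized Legendre polynomials $\{L_n\}_{n\ge 0}$ are the monic polynomials, $\deg L_n=n$, orthogonal for $\int_{-1}^1 w\,fg\,d\xi$. The generalized Lobatto polynomials are: $\phi_0,\phi_1$, the unique continuous functions that are affine on each of $(-1,\hat\alpha)$ and $(\hat\alpha,1)$, satisfy $[\![\hat\beta\phi'(\hat\alpha)]\!]=0$, and $\phi_0(-1)=1,\phi_0(1)=0$, $\phi_1(-1)=0,\phi_1(1)=1$; and $\phi_n(\xi)=\int_{-1}^\xi w(t)L_{n-1}(t)\,dt$ for $n\ge2$. The roots of $\phi_{p+1}$ are $\pm1$ and the $p-1$ points of $(-1,1)$ where it crosses the axis. Physical elements: with $\xi=(2x-x_{i-1}-x_i)/h_i$, put $\psi_{i,n}(x)=\psi_n(\xi)$, $P_{i,n}(x)=P_n(\xi)$ on $\tau_i$, and $\phi_{k,n}(x)=\phi_n(\xi)$, $L_{k,n}(x)=L_n(\xi)$ on $\tau_k$ (with $i=k$). Discrete space: $\mathbb P_p(\tau_i)$ is the space of polynomials of degree $\le p$ on $\tau_i$; $\tilde{\mathbb P}_p(\tau_k)=\mathrm{span}\{\phi_{k,n}:0\le n\le p\}$; $S_p(\mathcal T_h)=\{v\in H^1_0(\Omega): v|_{\tau_i}\in\mathbb P_p(\tau_i)\ (i\ne k),\ v|_{\tau_k}\in\tilde{\mathbb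 P}_p(\tau_k)\}$.
   Formalization: The constant C may also depend on Ω and min{β⁺,β⁻}; for c<0 the bilinear form is assumed inf-sup stable on S_p with constant κ, on which C may depend (the literal claim fails under scaling of β and at discrete eigenvalues). *)

(* Defs.v *)
From HB Require Import structures.
From mathcomp Require Import all_boot all_order all_algebra.
From mathcomp Require Import all_classical all_reals all_analysis.

Set Implicit Arguments.
Unset Strict Implicit.
Unset Printing Implicit Defensive.

Import Order.TTheory GRing.Theory Num.Theory.
Import numFieldNormedType.Exports.

Local Open Scope ring_scope.
Local Open Scope classical_set_scope.

Section Sobolev.
Context {R : realType}.
Implicit Types (I : set R) (f g v : R -> R).

Local Notation mu := (@lebesgue_measure R).

Definition C1c I (eta : R -> R) : Prop :=
  [/\ forall x, derivable eta x 1,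
      continuous (derive1 eta) &
      exists K : set R, [/\ compact K, K `<=` I &
                            forall x, ~ K x -> eta x = 0]].

(* As usual in one dimension, weak derivatives are tested against C^1
   functions with compact support and higher orders are obtained by
   iteration. *)
Definition is_weak_deriv I f g : Prop :=
  [/\ locally_integrable I f, locally_integrable I g &
      forall eta, C1c I eta ->
        \int[mu]_(x in I) (f x * derive1 eta x) =
        - \int[mu]_(x in I) (g x * eta x)].

(* A weak derivative is unique up to a null set, so the choice made by [xget]
   matters neither for membership in L^q nor for norms. *)
Definition weak_deriv I f : R -> R := xget (cst 0) (is_weak_deriv I f).

Definition weak_derivn I (n : nat) f : R -> R := iter n (weak_deriv I) f.

Definition Lq I (q : \bar R) f : Prop :=
  measurable_fun I f /\ finite_norm mu q (f \_ I).

Definition sobolev I (m : nat) (q : \bar R) v : Prop :=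
  (forall j, (j < m)%N ->
     is_weak_deriv I (weak_derivn I j v) (weak_derivn I j.+1 v)) /\
  (forall j, (j <= m)%N -> Lq I q (weak_derivn I j v)).

Definition sobolev_norm_infty I (m : nat) v : \bar R :=
  (\big[maxe/0]_(j < m.+1) Lnorm mu +oo (EFin \o (weak_derivn I j v \_ I)))%E.

Definition H10 (a b : R) v : Prop :=
  [/\ {within `[a, b], continuous v},
      sobolev `]a, b[ 1 2%:E v, v a = 0 & v b = 0].

End Sobolev.

Section Interface.
Context {R : realType}.
Implicit Types (a b alpha betam betap x : R) (f u v : R -> R).

Local Notation mu := (@lebesgue_measure R).

(* The value at the interface itself is irrelevant: it is only used under
   integrals, in one-sided limits, or away from alpha. *)
Definition pwcst alpha betam betap : R -> R :=
  fun x => if x < alpha then betam else betap.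

Definition jump v alpha : R :=
  lim (v y @[y --> alpha^'+]) - lim (v y @[y --> alpha^'-]).

(* v is the representative that is continuous on [a, b].  For v in W^{m,q} on
   either side, the classical derivatives of order j < m exist there and have
   one-sided limits at alpha; v^(m) is only in L^q and has no trace, so the
   jump conditions are those of the orders that have one. *)
Definition sobolev_interface a b alpha betam betap (m : nat) (q : \bar R) v :
    Prop :=
  [/\ {within `[a, b], continuous v},
      sobolev `]a, alpha[ m q v,
      sobolev `]alpha, b[ m q v,
      v a = 0 /\ v b = 0 &
      forall j, (0 < j < m)%N ->
        jump (fun y => pwcst alpha betam betap y * derive1n j v y) alpha = 0].

Definition interface_norm_infty a b alpha (m : nat) v : \bar R :=
  maxe (sobolev_norm_infty `]a, alpha[ m v)
       (sobolev_norm_infty `]alpha, b[ m v).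

Definition exact_solution a b alpha betam betap (gamma c : R) f u : Prop :=
  [/\ forall x, a < x < alpha \/ alpha < x < b ->
        - derive1 (fun y => pwcst alpha betam betap y * derive1 u y) x
          + gamma * derive1 u x + c * u x = f x,
      u a = 0, u b = 0, jump u alpha = 0 &
      jump (fun y => pwcst alpha betam betap y * derive1 u y) alpha = 0].

(* beta v' extended by continuity, which gives it a value at alpha. *)
Definition flux alpha betam betap v x : R :=
  lim (pwcst alpha betam betap y * derive1 v y @[y --> x^']).

Definition ip a b f v : R := \int[mu]_(x in `]a, b[) (f x * v x).

Definition bilin a b alpha betam betap (gamma c : R) u v : R :=
  ip a b (fun x => pwcst alpha betam betap x * derive1 u x) (derive1 v)
  + ip a b (fun x => gamma * derive1 u x) v
  + ip a b (fun x => c * u x) v.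

End Interface.

Section Polynomials.
Context {R : realType}.
Implicit Types (ah betam betap xi : R).

Local Notation mu := (@lebesgue_measure R).

(* Rodrigues' formula. *)
Definition legendre (n : nat) : {poly R} :=
  (2 ^+ n * n`!%:R)^-1 *: derivn n (('X^2 - 1) ^+ n).

Definition lobatto (n : nat) xi : R :=
  match n with
  | 0 => (1 - xi) / 2
  | 1 => (1 + xi) / 2
  | m.+2 => \int[mu]_(t in `[-1, xi]) (legendre m.+1).[t]
  end.

Definition weight ah betam betap xi : R := (pwcst ah betam betap xi)^-1.

Definition gen_legendre ah betam betap (L : nat -> {poly R}) : Prop :=
  (forall n, L n \is monic /\ size (L n) = n.+1) /\
  (forall m n, m != n ->
     \int[mu]_(t in `]-1, 1[)
        (weight ah betam betap t * ((L m).[t] * (L n).[t])) = 0).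

Definition affine_on (I : set R) (g : R -> R) : Prop :=
  exists s t : R, forall x, I x -> g x = s * x + t.

Definition interface_affine ah betam betap (vl vr : R) (g : R -> R) : Prop :=
  [/\ {within `[-1, 1], continuous g},
      affine_on `]-1, ah[ g /\ affine_on `]ah, 1[ g,
      jump (fun t => pwcst ah betam betap t * derive1 g t) ah = 0,
      g (-1) = vl & g 1 = vr].

Definition gen_lobatto ah betam betap (L : nat -> {poly R})
    (phi : nat -> R -> R) : Prop :=
  [/\ interface_affine ah betam betap 1 0 (phi 0%N),
      interface_affine ah betam betap 0 1 (phi 1%N) &
      forall n xi, (2 <= n)%N -> -1 <= xi <= 1 ->
        phi n xi = \int[mu]_(t in `[-1, xi])
                     (weight ah betam betap t * (L n.-1).[t])].

End Polynomials.

(* A mesh is given by nodes x 0, ..., x N; its i-th element, 1 <= i <= N, is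
   ]x i.-1, x i[. *)
Section FiniteElements.
Context {R : realType}.
Implicit Types (a b alpha betam betap : R) (N k i p : nat) (x : nat -> R).

Definition is_mesh a b N x : Prop :=
  [/\ x 0%N = a, x N = b & forall i, (i < N)%N -> x i < x i.+1].

Definition mesh_size N x : R := \big[Num.max/0]_(i < N) (x i.+1 - x i).

Definition ref_coord x i (y : R) : R :=
  (2 * y - x i.-1 - x i) / (x i - x i.-1).

Definition ife_space a b N k p x (phi : nat -> R -> R) (v : R -> R) : Prop :=
  [/\ H10 a b v,
      forall i, (0 < i <= N)%N -> i != k ->
        exists2 q : {poly R}, (size q <= p.+1)%N &
          forall y, x i.-1 < y < x i -> v y = q.[y] &
      exists d : nat -> R, forall y, x k.-1 < y < x k ->
        v y = \sum_(n < p.+1) d n * phi n (ref_coord x k y)].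

(* For v in the discrete space, the classical derivative used in [bilin] exists
   off the finite set of nodes and alpha, and is the weak one. *)
Definition ife_solution a b alpha betam betap (gamma c : R) N k p x
    (phi : nat -> R -> R) (f uh : R -> R) : Prop :=
  ife_space a b N k p x phi uh /\
  forall vh, ife_space a b N k p x phi vh ->
    bilin a b alpha betam betap gamma c uh vh = ip a b f vh.

Definition h1_seminorm a b (v : R -> R) : R :=
  Num.sqrt (ip a b (derive1 v) (derive1 v)).

(* Inf-sup stability, with constant kappa, of the bilinear form on the discrete
   space; the supremum is attained as the space is finite-dimensional. *)
Definition ife_stable a b alpha betam betap (gamma c kappa : R) N k p x
    (phi : nat -> R -> R) : Prop :=
  forall w, ife_space a b N k p x phi w ->
    exists v, [/\ ife_space a b N k p x phi v, 0 < h1_seminorm a b v &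
      kappa * h1_seminorm a b w * h1_seminorm a b v
        <= bilin a b alpha betam betap gamma c w v].

End FiniteElements.

(* Main.v *)
Require Import Defs.
From HB Require Import structures.
From mathcomp Require Import all_boot all_order all_algebra.
From mathcomp Require Import all_classical all_reals all_analysis.
From mathcomp Require Import measurable_realfun ring lra.

Set Implicit Arguments.
Unset Strict Implicit.
Unset Printing Implicit Defensive.

Import Order.TTheory GRing.Theory Num.Theory.
Import numFieldNormedType.Exports.

Local Open Scope ring_scope.
Local Open Scope classical_set_scope.

(* Work with the flux sigma = beta u', which is smooth across the interface, and
   with the weight w = 1/beta.  A member of the discrete space is a primitive of
   w s, where s is a discontinuous piecewise polynomial of degree < p.  Put
   V f = int_a w f.  Two integrations by parts turn the Galerkin equations for
   r = sigma - s_h, whose V r is u - u_h, into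
     int w (r - gamma V r - c int_a V r) q = 0
   for all piecewise polynomials q of degree < p with int w q = 0.

   Let pi be the w-weighted projection of sigma on each element.  There
   sigma - pi = k Lam + O(h^(p+1)), where Lam is the (generalized) Legendre
   polynomial of degree p, and E = V (sigma - pi) vanishes at the nodes, is
   O(h^(p+1)) and has mean zero on each element because p >= 2, so that its
   primitive is O(h^(p+2)).  The remainder pi - s_h solves the same equations
   with right-hand side gamma E + c int_a E.  Subtract the projection of gamma E;
   its V is O(h^(p+2)) since w is constant off the interface element.  What is
   left has data O(h^(p+2)), so that by stability pi - s_h is O(h^(p+1)) and
   V (pi - s_h) is O(h^(p+2)).  Finally k Lam drops out at the roots of Lam, and
   its integral at the roots of the (generalized) Lobatto polynomial. *)

(** * Bounded integrands and their primitives *)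

(** Element sizes may vary arbitrarily and h need not be small, so pointwise bounds have to be
    local. They come from the elementwise w-weighted projection, which is bounded in the sup norm
    with a constant depending only on p and the bounds of w. Stability is used once, in the form:
    data bounded by eps force int |w t| <= Cs eps. This bounds V t in the sup norm; the equations
    then exhibit t, up to a constant, as the projection of bounded functions, which upgrades the
    integral bound to a pointwise one.

    The term gamma E forces the correction: being only O(h^(p+1)), it is one order too large to
    count as data. Tests of mean zero leave a constant undetermined, whence the constants [kap] in
    the proof. On the interface element w is not constant and w E need not have mean zero, but a
    single element costs a further factor h. *)

Section OpenIntervalIntegral.
Context {R : realType}.
Implicit Types (s t r x y : R) (f g : R -> R).

Local Notation mu := (@lebesgue_measure R).

Definition integ s t f : R := \int[mu]_(x in `]s, t[) f x.

(** Boundedness gives integrability and, unlike integrability, is stable under products. Only the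
    open interval counts, so values at nodes are free. *)
Definition bmeas s t f : Prop :=
  measurable_fun `]s, t[ f /\ exists M : R, forall x, s < x < t -> `|f x| <= M.

Lemma oo_itvP s t x : `]s, t[%classic x <-> s < x < t.
Proof. by rewrite /= in_itv. Qed.

Lemma bmeas_integrable s t f : bmeas s t f -> mu.-integrable `]s, t[ (EFin \o f).
Proof.
move=> [mf [M fM]]; apply: measurable_bounded_integrable => //.
- rewrite /= lebesgue_measure_itv /=; case: ifP => _; last by rewrite ltry.
  by rewrite -EFinD ltry.
- exists (Num.max M 0); split; first exact: num_real.
  by move=> y My x /oo_itvP /fM /le_trans; apply; apply: ltW;
    apply: le_lt_trans My; rewrite le_max lexx.
Qed.

Lemma bmeas_cst s t (k : R) : bmeas s t (cst k).
Proof. by split=> //; exists `|k|. Qed.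

Lemma bmeas_ext s t f g : (forall x, s < x < t -> f x = g x) ->
  bmeas s t f -> bmeas s t g.
Proof.
move=> fg [mf [M fM]]; split; last by exists M => x sxt; rewrite -fg ?fM.
by apply: eq_measurable_fun mf => x; rewrite inE => /oo_itvP /fg.
Qed.

Lemma bmeasD s t f g : bmeas s t f -> bmeas s t g -> bmeas s t (fun x => f x + g x).
Proof.
move=> [mf [M fM]] [mg [M' gM]]; split; first exact: measurable_funD.
exists (M + M') => x sxt; apply: le_trans (ler_normD _ _) _.
by rewrite lerD ?fM ?gM.
Qed.

Lemma bmeasM s t f g : bmeas s t f -> bmeas s t g -> bmeas s t (fun x => f x * g x).
Proof.
move=> [mf [M fM]] [mg [M' gM]]; split; first exact: measurable_funM.
by exists (M * M') => x sxt; rewrite normrM ler_pM ?fM ?gM.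
Qed.

Lemma bmeasZ s t (k : R) f : bmeas s t f -> bmeas s t (fun x => k * f x).
Proof. by move=> bf; apply: bmeasM => //; exact: bmeas_cst. Qed.

Lemma bmeasN s t f : bmeas s t f -> bmeas s t (fun x => - f x).
Proof.
move=> /(bmeasZ (-1)); apply: bmeas_ext => x _; by rewrite mulN1r.
Qed.

Lemma bmeas_norm s t f : bmeas s t f -> bmeas s t (fun x => `|f x|).
Proof.
move=> [mf [M fM]]; split; last by exists M => x /fM; rewrite normr_id.
by apply: measurableT_comp.
Qed.

Lemma bmeas_sub s t s' t' f : s <= s' -> t' <= t -> bmeas s t f -> bmeas s' t' f.
Proof.
move=> ss' t't [mf [M fM]]; split.
  apply: measurable_funS mf => // x /oo_itvP/andP[sx xt]; apply/oo_itvP.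
  by rewrite (le_lt_trans ss') // (lt_le_trans xt).
exists M => x /andP[sx xt]; apply: fM.
by rewrite (le_lt_trans ss') // (lt_le_trans xt).
Qed.

Lemma bmeas_cat s r t f : bmeas s r f -> bmeas r t f -> bmeas s t f.
Proof.
move=> [mf [M fM]] [mg [M' gM]]; split; last first.
  exists (Num.max (Num.max M M') `|f r|) => x /andP[sx xt]; rewrite !le_max.
  have [xr|rx|->] := ltgtP x r.
  - by rewrite fM ?sx.
  - by rewrite gM ?rx ?orbT.
  - by rewrite lexx orbT.
(* The junction r lies in neither open piece and is added as a measurable singleton. *)
have : measurable_fun (`]s, r[ `|` ([set r] `|` `]r, t[)) f.
  apply/measurable_funU => //; first exact: measurableU.
  split => //; apply/measurable_funU => //; split => //.
  exact: measurable_fun_set1.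
apply: measurable_funS.
  by apply: measurableU => //; exact: measurableU.
move=> x /oo_itvP/andP[sx xt]; have [xr|rx|->] := ltgtP x r.
- by left; apply/oo_itvP; rewrite sx.
- by right; right; apply/oo_itvP; rewrite rx.
- by right; left.
Qed.

Lemma within_continuous_sub s t s' t' f : s <= s' -> t' <= t ->
  {within `[s, t], continuous f} -> {within `[s', t'], continuous f}.
Proof.
move=> ss t't; apply: continuous_subspaceW => y /=; rewrite !in_itv /= => /andP[h1 h2].
by rewrite (le_trans ss) // (le_trans h2).
Qed.

Lemma bmeas_continuous s t f : {within `[s, t], continuous f} -> bmeas s t f.
Proof.
have [st cf|ts _] := leP s t; last first.
  have e x : s < x < t -> False by case/andP => a b; have := lt_trans a b; rewrite ltNge ltW.
  split; last by exists 0 => x /e.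
  rewrite (_ : `]s, t[ = set0); first exact: measurable_fun_set0.
  by apply/seteqP; split => x // /oo_itvP /e.
split.
  have := subspace_continuous_measurable_fun (measurable_itv _) cf.
  by apply: measurable_funS => //; apply: subset_itv_oo_cc.
have [] := @compact_bounded _ R^o (f @` `[s, t]).
  by apply: continuous_compact => //; exact: segment_compact.
move=> M [_ fM]; exists (M + 1) => x /andP[sx xt].
apply: (fM (M + 1)); first by rewrite ltrDl.
by exists x => //=; rewrite in_itv /= !ltW.
Qed.

Lemma integ_ext s t f g : (forall x, s < x < t -> f x = g x) -> integ s t f = integ s t g.
Proof. by move=> fg; apply: eq_Rintegral => x; rewrite inE => /oo_itvP /fg. Qed.

(** The exceptional points are treated one at a time: cutting the interval at such a point hides the
    change from both open halves. *)
Lemma bmeas_off s t f g (l : seq R) : bmeas s t f ->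
  (forall x, s < x < t -> x \notin l -> f x = g x) -> bmeas s t g.
Proof.
elim: l f => [|y l IH] f bf fg; first by apply: bmeas_ext bf => x /fg; apply.
apply: (IH (fun x => if x == y then g x else f x)); last first.
  by move=> x sxt xl; case: eqVneq => // xy; apply: fg => //; rewrite inE negb_or xy.
have [/andP[sy yt]|nsyt] := boolP (s < y < t); last first.
  by apply: bmeas_ext bf => x sxt; case: eqVneq => // xy; move: nsyt; rewrite -xy sxt.
apply: (@bmeas_cat _ y).
  apply: (bmeas_ext _ (bmeas_sub (lexx _) (ltW yt) bf)) => x /andP[_ xy].
  by rewrite lt_eqF.
apply: (bmeas_ext _ (bmeas_sub (ltW sy) (lexx _) bf)) => x /andP[yx _].
by rewrite gt_eqF.
Qed.

(** This replaces classical derivatives under the integral by the expressions that they equal off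
    the nodes and the interface. *)
Lemma integ_off s t f g (l : seq R) : bmeas s t f ->
  (forall x, s < x < t -> x \notin l -> f x = g x) -> integ s t f = integ s t g.
Proof.
move=> bf fg; have [mg _] := bmeas_off bf fg; have [mf _] := bf; congr fine; apply: ae_eq_integral => //.
- exact/measurable_EFinP.
- exact/measurable_EFinP.
exists [set x | x \in l]; split.
- apply: countable_measurable; [exact: measurable_set1|]; apply: finite_set_countable; exact: finite_seq.
- by apply: countable_lebesgue_measure0; apply: finite_set_countable; exact: finite_seq.
move=> x /= nfg; apply: contrapT => /negP xl; apply: nfg => /oo_itvP sxt.
by rewrite /= fg.
Qed.

Lemma integD s t f g : bmeas s t f -> bmeas s t g ->
  integ s t (fun x => f x + g x) = integ s t f + integ s t g.
Proof. by move=> bf bg; apply: RintegralD => //; exact: bmeas_integrable. Qed.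

Lemma integB s t f g : bmeas s t f -> bmeas s t g ->
  integ s t (fun x => f x - g x) = integ s t f - integ s t g.
Proof. by move=> bf bg; apply: RintegralB => //; exact: bmeas_integrable. Qed.

Lemma integZ s t (k : R) f : bmeas s t f ->
  integ s t (fun x => k * f x) = k * integ s t f.
Proof. by move=> bf; apply: RintegralZl => //; exact: bmeas_integrable. Qed.

Lemma integ_cst s t (k : R) : s <= t -> integ s t (cst k) = k * (t - s).
Proof.
move=> st; rewrite /integ Rintegral_cst //= lebesgue_measure_itv /= lte_fin.
by move: st; rewrite le_eqVlt => /predU1P[->|->]; rewrite ?ltxx ?subrr //= -EFinD.
Qed.

Lemma integ_ge s t f : t <= s -> integ s t f = 0.
Proof. by move=> ts; rewrite /integ set_itv_ge ?Rintegral_set0 // bnd_simp -leNgt. Qed.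

Lemma integ_eq0 s t f : (forall x, s < x < t -> f x = 0) -> integ s t f = 0.
Proof.
move=> f0; have [st|ts] := leP s t; last by rewrite integ_ge // ltW.
by rewrite (@integ_ext _ _ _ (cst 0)) // integ_cst // mul0r.
Qed.

Lemma le_integ s t f g : bmeas s t f -> bmeas s t g ->
  (forall x, s < x < t -> f x <= g x) -> integ s t f <= integ s t g.
Proof.
move=> bf bg fg; apply: le_Rintegral; [exact: measurable_itv|exact: bmeas_integrable|exact: bmeas_integrable|].
by move=> x /oo_itvP /fg.
Qed.

Lemma integ_ge0 s t f : (forall x, s < x < t -> 0 <= f x) -> 0 <= integ s t f.
Proof. by move=> fg; apply: Rintegral_ge0 => x /oo_itvP /fg. Qed.

Lemma integ_cat s r t f : s <= r -> r <= t -> bmeas s t f ->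
  integ s t f = integ s r f + integ r t f.
Proof.
rewrite le_eqVlt => /predU1P[->|sr]; first by rewrite (@integ_ge r r) ?add0r.
rewrite le_eqVlt => /predU1P[->|rt]; first by rewrite (@integ_ge t t) ?addr0.
move=> bf.
have bf1 := bmeas_sub (lexx _) (ltW rt) bf.
have bf2 := bmeas_sub (ltW sr) (lexx _) bf.
rewrite /integ; have /= <- := @Rintegral_itvB _ f (BRight s) (BLeft t) r (bmeas_integrable bf) _ _;
  rewrite ?bnd_simp // ?ltW //.
rewrite (@Rintegral_itv_bndo_bndc _ (BRight s) r); last exact: bmeas_integrable.
by rewrite addrC subrK.
Qed.

Lemma norm_integ s t f : bmeas s t f -> `|integ s t f| <= integ s t (fun x => `|f x|).
Proof. by move=> bf; apply: le_normr_Rintegral => //; exact: bmeas_integrable. Qed.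

Lemma norm_integ_le s t f K : s <= t -> bmeas s t f ->
  (forall x, s < x < t -> `|f x| <= K) -> `|integ s t f| <= K * (t - s).
Proof.
move=> st bf fK; apply: le_trans (norm_integ bf) _.
rewrite -integ_cst //; apply: le_integ => //; [exact: bmeas_norm|exact: bmeas_cst].
Qed.

Lemma norm_integ_le_off s t f K (l : seq R) : s <= t -> 0 <= K -> bmeas s t f ->
  (forall x, s < x < t -> x \notin l -> `|f x| <= K) -> `|integ s t f| <= K * (t - s).
Proof.
move=> st K0 bf fK.
set g := fun x => if x \in l then 0 else f x.
have fg x : s < x < t -> x \notin l -> f x = g x by rewrite /g => _ /negPf ->.
have bg := bmeas_off bf fg.
rewrite (integ_off bf fg); apply: norm_integ_le => // x sxt.
by rewrite /g; case: ifPn => [_|/fK]; [rewrite normr0|apply].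
Qed.

End OpenIntervalIntegral.

(* Matching on the shape of the goal keeps the unifier from unfolding integrals. *)
Ltac bmeas_step := lazymatch goal with
  | |- bmeas _ _ (fun x => ?g x) => change (fun x => g x) with g
  | |- bmeas _ _ (fun x => @?f x + @?g x) => apply: (@bmeasD _ _ _ f g)
  | |- bmeas _ _ (fun x => - @?f x) => apply: (@bmeasN _ _ _ f)
  | |- bmeas _ _ (fun x => @?f x * @?g x) => apply: (@bmeasM _ _ _ f g)
  | |- bmeas _ _ (fun x => `|@?f x|) => apply: (@bmeas_norm _ _ _ f)
  | |- bmeas _ _ (fun _ => ?k) => exact: bmeas_cst
  | |- bmeas _ _ (cst _) => exact: bmeas_cst
  | |- bmeas ?s ?t ?f => match goal with
      H : bmeas s t f |- _ => exact: H
    end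
  end.

Ltac bmeas_auto := repeat bmeas_step.

(** * Primitives of bounded functions: product rule, differentiation and gluing *)

Section Primitives.
Context {R : realType}.
Implicit Types (s t r x y : R) (f g F G : R -> R).

(* The increment F y - F x is imposed on the closed interval, so that a
   primitive is determined by f up to a constant, including at s and t. *)
Definition primitive_on s t F f : Prop :=
  bmeas s t f /\
  forall x y, s <= x -> x <= y -> y <= t -> F y - F x = integ x y f.

Lemma primitive_bmeasr s t F f : primitive_on s t F f -> bmeas s t f.
Proof. by case. Qed.

Lemma primitive_sub s t s' t' F f : s <= s' -> t' <= t ->
  primitive_on s t F f -> primitive_on s' t' F f.
Proof.
move=> ss tt [bf Ff]; split; first exact: bmeas_sub bf.
by move=> x y sx xy yt; apply: Ff => //; [exact: le_trans sx|exact: le_trans tt].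
Qed.

Lemma primitive_ext s t F G f g : (forall x, s <= x <= t -> F x = G x) ->
  (forall x, s < x < t -> f x = g x) ->
  primitive_on s t F f -> primitive_on s t G g.
Proof.
move=> FG fg [bf Ff]; split; first exact: bmeas_ext fg bf.
move=> x y sx xy yt; rewrite -!FG ?Ff //; last 2 first.
- by rewrite sx (le_trans xy).
- by rewrite yt (le_trans sx).
apply: integ_ext => z /andP[xz zy].
by apply: fg; rewrite (le_lt_trans sx) // (lt_le_trans zy).
Qed.

Lemma primitive_norm_le s t F f K x y : primitive_on s t F f ->
  (forall z, s < z < t -> `|f z| <= K) -> s <= x -> x <= y -> y <= t ->
  `|F y - F x| <= K * (y - x).
Proof.
move=> [bf Ff] fK sx xy yt; rewrite Ff //; apply: norm_integ_le => //.
  exact: bmeas_sub bf.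
move=> z /andP[xz zy]; apply: fK.
by rewrite (le_lt_trans sx) // (lt_le_trans zy).
Qed.

Lemma primitive_lipschitz s t F f : primitive_on s t F f ->
  exists2 K : R, 0 <= K & forall x y, s <= x -> x <= y -> y <= t ->
    `|F y - F x| <= K * (y - x).
Proof.
move=> Ff; have [[_ [M fM]] _] := Ff.
exists (Num.max M 0); first by rewrite le_max lexx orbT.
by move=> x y; apply: (primitive_norm_le Ff) => z zst; rewrite le_max fM.
Qed.

Lemma primitive_continuous s t F f : primitive_on s t F f ->
  {within `[s, t], continuous F}.
Proof.
move=> /primitive_lipschitz [K K0 FK]; apply/subspace_continuousP => x /=.
rewrite in_itv /= => /andP[sx xt]; apply/cvgrPdist_le => e e0.
have K1 : 0 < K + 1 by rewrite ltr_wpDl.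
have eK : 0 < e / (K + 1) by rewrite divr_gt0.
rewrite near_withinE; apply/nbhs_ballP; exists (e / (K + 1)); first exact: eK.
move=> y xy /=; rewrite in_itv /= => /andP[sy yt].
have h : K * `|x - y| <= e.
  apply: (@le_trans _ _ ((K + 1) * `|x - y|)); first by rewrite ler_wpM2r // lerDl.
  by rewrite mulrC -ler_pdivlMr //; apply/ltW.
apply: le_trans h; have [{}xy|yx] := leP x y.
  by rewrite distrC (le_trans (FK _ _ sx xy yt)) // distrC ger0_norm // subr_ge0.
by rewrite (le_trans (FK _ _ sy (ltW yx) xt)) // ger0_norm // subr_ge0 ltW.
Qed.

Lemma primitive_bmeas s t F f : primitive_on s t F f -> bmeas s t F.
Proof. by move=> /primitive_continuous; exact: bmeas_continuous. Qed.

Lemma primitive_integ s t f : bmeas s t f ->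
  primitive_on s t (fun x => integ s x f) f.
Proof.
move=> bf; split => // x y sx xy yt.
rewrite (@integ_cat _ s x y) //; last exact: bmeas_sub bf.
by rewrite addrC addKr.
Qed.

Lemma primitive_cst s t (k : R) : primitive_on s t (cst k) (cst 0).
Proof.
split; first exact: bmeas_cst.
by move=> x y _ xy _; rewrite integ_cst // mul0r subrr.
Qed.

Lemma primitive_id s t : primitive_on s t id (cst 1).
Proof.
split; first exact: bmeas_cst.
by move=> x y _ xy _; rewrite integ_cst // mul1r.
Qed.

Lemma primitiveD s t F G f g : primitive_on s t F f -> primitive_on s t G g ->
  primitive_on s t (fun x => F x + G x) (fun x => f x + g x).
Proof.
move=> [bf Ff] [bg Gg]; split; first exact: bmeasD.
move=> x y sx xy yt; rewrite integD; [|exact: bmeas_sub bf|exact: bmeas_sub bg].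
by rewrite -Ff // -Gg // opprD addrACA.
Qed.

Lemma primitiveZ s t (k : R) F f : primitive_on s t F f ->
  primitive_on s t (fun x => k * F x) (fun x => k * f x).
Proof.
move=> [bf Ff]; split; first exact: bmeasZ.
move=> x y sx xy yt; rewrite integZ; last exact: bmeas_sub bf.
by rewrite -Ff // mulrBr.
Qed.

Lemma primitiveB s t F G f g : primitive_on s t F f -> primitive_on s t G g ->
  primitive_on s t (fun x => F x - G x) (fun x => f x - g x).
Proof.
move=> Ff /(primitiveZ (-1)) /(primitiveD Ff).
by apply: primitive_ext => x _; rewrite mulN1r.
Qed.

Lemma primitive_cat s r t F f : primitive_on s r F f -> primitive_on r t F f ->
  primitive_on s t F f.
Proof.
move=> [bf Ff] [bg Fg].
have bfg := bmeas_cat bf bg; split => // x y sx xy yt.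
have [yr|/ltW ry] := leP y r; first exact: Ff.
have [rx|/ltW xr] := leP r x; first exact: Fg.
rewrite (@integ_cat _ x r y) //; last exact: bmeas_sub bfg.
by rewrite -Ff // -Fg //; ring.
Qed.

(** Cut the interval into n + 1 equal pieces: each contributes O(1/n^2), so the total is O(1/n) for
    every n. *)
Lemma additive_quadratic_eq0 (Phi : R -> R -> R) s t C : s <= t ->
  (forall x y z, s <= x -> x <= y -> y <= z -> z <= t -> Phi x z = Phi x y + Phi y z) ->
  (forall x y, s <= x -> x <= y -> y <= t -> `|Phi x y| <= C * (y - x) ^+ 2) ->
  Phi s t = 0.
Proof.
move=> st Phiadd PhiC.
have C0 : 0 <= C * (t - s) ^+ 2 by apply: le_trans (PhiC s t _ _ _).
have bound n : `|Phi s t| <= C * (t - s) ^+ 2 / n.+1%:R.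
  pose d := (t - s) / n.+1%:R.
  have d0 : 0 <= d by rewrite divr_ge0 // subr_ge0.
  have dn : d * n.+1%:R = t - s by rewrite mulfVK.
  have ind k : (k <= n.+1)%N -> `|Phi s (s + d * k%:R)| <= k%:R * (C * d ^+ 2).
    elim: k => [_|k IH kn].
      by rewrite mulr0 addr0 mul0r (le_trans (PhiC _ _ _ _ _)) // subrr expr0n mulr0.
    have h1 : s <= s + d * k%:R by rewrite lerDl mulr_ge0.
    have h2 : s + d * k%:R <= s + d * k.+1%:R by rewrite lerD2l ler_wpM2l // ler_nat.
    have h3 : s + d * k.+1%:R <= t.
      by rewrite -lerBrDl -dn ler_wpM2l // ler_nat.
    rewrite (Phiadd _ _ _ (lexx _) h1 h2 h3) (le_trans (ler_normD _ _)) //.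
    rewrite -[X in _ <= X * _]natr1 mulrDl mul1r lerD ?IH ?(ltnW kn) //.
    apply: le_trans (PhiC _ _ h1 h2 h3) _.
    rewrite (_ : _ - _ = d) //; rewrite -natr1; ring.
  have := ind n.+1 (leqnn _); rewrite dn addrC subrK => /le_trans; apply.
  rewrite /d expr_div_n le_eqVlt; apply/orP; left; apply/eqP; field.
  by rewrite nat1r pnatr_eq0.
apply/eqP; rewrite -normr_eq0 eq_le normr_ge0 andbT leNgt; apply/negP => P0.
have := @archi_boundP _ (C * (t - s) ^+ 2 / `|Phi s t|).
set m := Num.bound _ => /(_ _) am.
have {am} : C * (t - s) ^+ 2 / `|Phi s t| < m%:R by apply: am; rewrite divr_ge0.
rewrite ltr_pdivrMr // => am.
have := bound m; rewrite ler_pdivlMr // => bm.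
have : m%:R * `|Phi s t| <= `|Phi s t| * m.+1%:R by rewrite mulrC ler_wpM2l // ler_nat.
by move=> /(lt_le_trans am) /lt_le_trans /(_ bm); rewrite ltxx.
Qed.

(* The error in the product rule is an additive interval function of quadratic
   size, which makes Fubini's theorem unnecessary. *)
Lemma primitiveM s t F G f g : primitive_on s t F f -> primitive_on s t G g ->
  primitive_on s t (fun x => F x * G x) (fun x => f x * G x + F x * g x).
Proof.
move=> Ff Gg.
have bF := primitive_bmeas Ff; have bG := primitive_bmeas Gg.
have bf := primitive_bmeasr Ff; have bg := primitive_bmeasr Gg.
have bfG := bmeasM bf bG; have bFg := bmeasM bF bg.
have bs := bmeasD bfG bFg.
split => // x0 y0 sx0 xy0 y0t.
have [K K0 FK] := primitive_lipschitz Ff; have [K' K'0 GK] := primitive_lipschitz Gg.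
apply/eqP; rewrite -subr_eq0; apply/eqP.
pose Phi x y := F y * G y - F x * G x - integ x y (fun z => f z * G z + F z * g z).
have [_ [M fM]] := bf; have [_ [M' gM]] := bg.
apply: (@additive_quadratic_eq0 Phi x0 y0 (Num.max M 0 * K' + K * Num.max M' 0 + K * K')) => //.
- move=> x y z x0x xy yz zy0.
  rewrite /Phi (@integ_cat _ x y z) //; last first.
    by apply: bmeas_sub bs; [exact: le_trans x0x|exact: le_trans y0t].
  ring.
move=> x y x0x xy yy0.
have sx := le_trans sx0 x0x; have yt := le_trans yy0 y0t.
have sub h : bmeas s t h -> bmeas x y h by exact: bmeas_sub.
(* Centre F and G at x. The linear terms cancel, leaving a product of two increments and an integral
   over a short interval of bounded factors times increments; both are quadratic in y - x. *)
have e1 : F y * G y - F x * G x =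
   (F y - F x) * G x + F x * (G y - G x) + (F y - F x) * (G y - G x) by ring.
have e2 : (F y - F x) * G x = integ x y (fun z => G x * f z).
  by rewrite integZ; [rewrite mulrC (proj2 Ff)|exact: sub].
have e3 : F x * (G y - G x) = integ x y (fun z => F x * g z).
  by rewrite integZ; [rewrite (proj2 Gg)|exact: sub].
have e4 : integ x y (fun z => f z * (G z - G x) + (F z - F x) * g z) =
    integ x y (fun z => f z * G z + F z * g z)
      - (F y - F x) * G x - F x * (G y - G x).
  rewrite e2 e3 -!integB; try by apply: sub; bmeas_auto.
  by apply: integ_ext => z _; ring.
have ->: Phi x y = (F y - F x) * (G y - G x) -
   integ x y (fun z => f z * (G z - G x) + (F z - F x) * g z).
  by rewrite e4 /Phi e1; ring.
apply: le_trans (ler_normB _ _) _; rewrite [leRHS]mulrDl [leRHS]addrC lerD //.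
  rewrite normrM [X in _ <= X](_ : _ = K * (y - x) * (K' * (y - x))); last by ring.
  by rewrite ler_pM ?FK ?GK.
rewrite expr2 mulrA; apply: norm_integ_le => //.
  by apply: sub; bmeas_auto.
move=> z /andP[xz zy]; have szt : s < z < t.
  by rewrite (le_lt_trans sx) // (lt_le_trans zy).
apply: le_trans (ler_normD _ _) _; rewrite [leRHS]mulrDl lerD // normrM.
  rewrite -mulrA ler_pM //; first by rewrite le_max fM.
  rewrite (le_trans (GK _ _ sx (ltW xz) _)) ?(le_trans (ltW zy)) //.
  by rewrite ler_wpM2l // lerD2r ltW.
rewrite mulrAC ler_pM //; last by rewrite le_max gM.
rewrite (le_trans (FK _ _ sx (ltW xz) _)) ?(le_trans (ltW zy)) //.
by rewrite ler_wpM2l // lerD2r ltW.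
Qed.

Lemma integ_by_parts s t F G f g : s <= t -> primitive_on s t F f -> primitive_on s t G g ->
  integ s t (fun x => f x * G x) = F t * G t - F s * G s - integ s t (fun x => F x * g x).
Proof.
move=> st Ff Gg; have [_ /(_ s t (lexx _) st (lexx _)) ->] := primitiveM Ff Gg.
have bF := primitive_bmeas Ff; have bG := primitive_bmeas Gg.
have bf := primitive_bmeasr Ff; have bg := primitive_bmeasr Gg.
by rewrite integD; [rewrite addrK|bmeas_auto..].
Qed.

Lemma primitive_horner s t (q : {poly R}) : primitive_on s t (horner q) (horner q^`()).
Proof.
elim/poly_ind: q => [|q c IH].
  apply: primitive_ext (primitive_cst s t 0) => x _; rewrite ?deriv0 ?horner0 //.
apply: primitive_ext (primitiveD (primitiveM IH (primitive_id s t)) (primitive_cst s t c)) => x _.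
  by rewrite !hornerE.
by rewrite derivD derivM derivX derivC !hornerE.
Qed.

Lemma bmeas_horner s t (q : {poly R}) : bmeas s t (horner q).
Proof. exact: primitive_bmeas (primitive_horner s t q). Qed.

Lemma continuous_at_eq s t x f g : s < x < t -> (forall y, s < y < t -> f y = g y) ->
  {for x, continuous g} -> {for x, continuous f}.
Proof.
move=> sxt fg cg; rewrite /prop_for /continuous_at fg //.
apply: cvg_trans cg; apply: near_eq_cvg.
have [_ h] : (`]s, t[ : set R) x /\ open (`]s, t[ : set R).
  by split; [exact/oo_itvP|exact: interval_open].
near=> y; apply/esym/fg.
near: y; have /andP[sx xt] := sxt.
by apply: filterS (near_in_itvoo _); [move=> y; rewrite in_itv /=; exact|rewrite in_itv].
Unshelve. all: by end_near.
Qed.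

Lemma primitive_derive s t x F f : primitive_on s t F f -> s < x < t ->
  {for x, continuous f} -> is_derive x 1 F (f x).
Proof.
move=> Ff /andP[sx xt] cf.
have key : h^-1 *: ((F \o shift x) (h *: (1 : R)) - F x) @[h --> 0^'] --> f x.
  apply/cvgrPdist_le => e e0.
  have /cvgrPdist_le /(_ e e0) /nbhs_ballP [d d0 fd] := cf.
  pose d' := Num.min d (Num.min (x - s) (t - x)).
  have d'0 : 0 < d' by rewrite !lt_min d0 !subr_gt0 sx xt.
  apply/nbhs_ballP; exists d'; first exact: d'0.
  move=> h /=; rewrite (_ : h *: (1 : R) = h); last exact: mulr1.
  rewrite /ball /= sub0r normrN => hd hn0.
  have [hd1 hd2 hd3] : [/\ `|h| < d, `|h| < x - s & `|h| < t - x].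
    by move: hd; rewrite !lt_min => /andP[? /andP[? ?]].
  (* Subtract the candidate tangent: what remains is a primitive of [f - f x], which is at most e
     near x. The endpoints [m] and [M] below treat both signs of h together. *)
  have pG := primitiveB Ff (primitiveZ (f x) (primitive_id s t)).
  pose m := Num.min x (h + x); pose M := Num.max x (h + x).
  have hm : s <= m by rewrite le_min ltW //=; move: hd2; rewrite ltr_norml => /andP[? _]; lra.
  have hM : M <= t by rewrite ge_max ltW //=; move: hd3; rewrite ltr_norml => /andP[_ ?]; lra.
  have pG' := primitive_sub hm hM pG.
  have mM : m <= M by rewrite ge_min le_max lexx.
  have bound z : m < z < M -> `|f z - f x * 1| <= e.
    rewrite mulr1 distrC => /andP[mz zM]; apply: fd; rewrite /ball /=.
    have : `|x - z| <= `|h|.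
      move: mz zM; rewrite gt_min lt_max => A B; rewrite ler_norml.
      have [h0|h0] := leP 0 h; [rewrite (ger0_norm h0)|rewrite (ltr0_norm h0)].
      - by apply/andP; case/orP: A; case/orP: B => *; lra.
      - by apply/andP; case/orP: A; case/orP: B => *; lra.
    by move=> /le_lt_trans; apply.
  have := primitive_norm_le pG' bound (lexx _) mM (lexx _).
  have Mm : M - m = `|h|.
    rewrite /M /m; case: (leP x (h + x)) => A.
      by rewrite addrK ger0_norm //; lra.
    by rewrite ltr0_norm; [ring|lra].
  rewrite Mm => bnd.
  have -> : f x - h^-1 *: (F (h + x) - F x) = - (h^-1 * ((F (h + x) - f x * (h + x)) - (F x - f x * x))).
    by rewrite /GRing.scale /=; field.
  rewrite normrN normrM normfV ler_pdivrMl ?normr_gt0 // [leRHS]mulrC.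
  move: bnd; rewrite /M /m; case: (leP x (h + x)) => A //.
  by rewrite distrC.
have dF : derivable F x 1 by apply/cvg_ex; exists (f x).
by apply: DeriveDef => //; exact: cvg_lim.
Qed.

Lemma primitive_derive1 s t x F f : primitive_on s t F f -> s < x < t ->
  {for x, continuous f} -> derive1 F x = f x.
Proof. by move=> Ff sxt /(primitive_derive Ff sxt) ?; rewrite derive1E derive_val. Qed.

Lemma primitive_glue (I : nat -> R) n F f :
  (forall i, (i < n)%N -> primitive_on (I i) (I i.+1) F f) -> (0 < n)%N ->
  primitive_on (I 0%N) (I n) F f.
Proof.
elim: n => // n IH h _; case: n IH h => [|n] IH h; first exact: h.
by apply: primitive_cat (h n.+1 (ltnSn _)); apply: IH => // i ?; apply: h; apply: ltnW.
Qed.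

Lemma integ_sqr_eq0 s t f : s < t -> {within `[s, t], continuous f} ->
  integ s t (fun x => f x ^+ 2) = 0 -> forall x, s < x < t -> f x = 0.
Proof.
move=> st cf f0 x /andP[sx xt].
have bf := bmeas_continuous cf.
have b2 : bmeas s t (fun x => f x ^+ 2) by apply: bmeas_ext (bmeasM bf bf) => y _; rewrite expr2.
apply/eqP; apply: contraT => fx0.
have e0 : 0 < `|f x| / 2 by rewrite divr_gt0 // normr_gt0.
have /continuous_within_itvP := cf => /(_ st) [cx _ _].
have /cvgrPdist_le /(_ _ e0) /nbhs_ballP [d d0 fd] : {for x, continuous f}.
  by apply: cx; rewrite in_itv /= sx.
(* On the strip from x to y the absolute value of f stays above half of its value at x, so the
   integral of the square would be positive. *)
pose y := Num.min t (x + d / 2).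
have d20 : 0 < d / 2 by rewrite divr_gt0.
have xy : x < y by rewrite lt_min xt ltrDl.
have yt : y <= t by rewrite ge_min lexx.
have yd : y <= x + d / 2 by rewrite ge_min lexx orbT.
have big z : x < z < y -> (`|f x| / 2) ^+ 2 <= f z ^+ 2.
  move=> /andP[xz zy]; rewrite -[leRHS]real_normK ?num_real // ler_sqr ?nnegrE ?(ltW e0) //.
  have : `|f x - f z| <= `|f x| / 2.
    by apply: fd; rewrite /ball /= ltr0_norm; have /= := d20; lra.
  have := lerB_dist (f x) (f z); lra.
have : integ x y (cst ((`|f x| / 2) ^+ 2)) <= 0.
  rewrite -f0 (@integ_cat _ s x t) ?(ltW sx) ?(ltW xt) //.
  rewrite (@integ_cat _ x y t) ?(ltW xy) //; last exact: bmeas_sub (ltW sx) _ b2.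
  apply: (@le_trans _ _ (integ x y (fun x => f x ^+ 2))).
    apply: le_integ => //; [exact: bmeas_cst|exact: (bmeas_sub (ltW sx) yt b2)].
  have h1 : 0 <= integ s x (fun x => f x ^+ 2) by apply: integ_ge0 => ? _; exact: sqr_ge0.
  have h2 : 0 <= integ y t (fun x => f x ^+ 2) by apply: integ_ge0 => ? _; exact: sqr_ge0.
  lra.
rewrite integ_cst ?(ltW xy) // leNgt mulr_gt0 ?subr_gt0 // exprn_gt0 //.
Qed.

End Primitives.

Ltac bmeas_auto ::= repeat first [bmeas_step | exact: bmeas_horner].

(** * Legendre polynomials and weighted projections *)

Section PolynomialsOnIntervals.
Context {R : realType}.
Implicit Types (s t x y : R) (f w : R -> R) (q r : {poly R}).

Lemma poly_eq0_itv s t q : s < t -> (forall y, s < y < t -> q.[y] = 0) -> q = 0.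
Proof.
move=> st q0; apply/eqP; apply: contraT => qn0.
(* These are distinct interior points, and [size q] of them are more roots than the degree allows.
   The shift by two keeps them away from t. *)
pose pt (i : nat) := s + (t - s) / i.+2%:R.
have st0 : 0 < t - s by rewrite subr_gt0.
have inj : injective pt.
  move=> i j /addrI /(mulfI (lt0r_neq0 st0)) /invr_inj /eqP.
  by rewrite eqr_nat => /eqP [].
have := @max_poly_roots _ q (map pt (iota 0 (size q))) qn0.
rewrite size_map size_iota ltnn => -> //; last by rewrite map_inj_uniq ?iota_uniq.
apply/allP => _ /mapP [i _ ->]; apply/rootP/q0.
rewrite /pt ltrDl divr_gt0 //= -ltrBrDl ltr_pdivrMr // ltr_pMr // ltr1n //.
Qed.

Lemma size_sub_lead n q r : (size q <= n.+1)%N -> size r = n.+1 ->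
  (size (q - (q`_n / r`_n) *: r)%R <= n)%N.
Proof.
move=> sq sr; have r0 : r`_n != 0.
  by have := lead_coef_eq0 r; rewrite lead_coefE sr /= -size_poly_eq0 sr => ->.
apply/leq_sizeP => j; rewrite leq_eqVlt => /predU1P[<-|nj].
  by rewrite coefB coefZ mulfVK // subrr.
by rewrite coefB coefZ (nth_default _ (leq_trans sq nj)) [r`_j]nth_default ?sr // mulr0 subr0.
Qed.

Lemma antiderivative q :
  exists2 Q : {poly R}, deriv Q = q & (size Q <= (size q).+1)%N.
Proof.
exists (\poly_(i < (size q).+1) (q`_i.-1 / i%:R)); last exact: size_poly.
apply/polyP => i.
rewrite coef_deriv coef_poly ltnS; case: ltnP => iq.
  by rewrite -[_ *+ i.+1]mulr_natr mulfVK //= pnatr_eq0.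
by rewrite mul0rn nth_default.
Qed.

(** For a polynomial integrand, an antiderivative and the chain rule for [\Po] give the change of
    variables. *)
Lemma integ_affine s t (m c : R) f q : 0 < m -> s <= t ->
  (forall z, m * s + c < z < m * t + c -> f z = q.[z]) ->
  integ (m * s + c) (m * t + c) f = m * integ s t (fun y => f (m * y + c)).
Proof.
move=> m0 st fq; have [Q dQ _] := antiderivative q.
have st' : m * s + c <= m * t + c by rewrite lerD2r ler_wpM2l // ltW.
rewrite (@integ_ext _ _ _ _ (horner (deriv Q))); last by rewrite dQ.
have [_ <-] := primitive_horner (m * s + c) (m * t + c) Q; rewrite ?lexx //.
pose A : {poly R} := m *: 'X + c%:P.
have eA z : A.[z] = m * z + c by rewrite /A !hornerE.
have dA : deriv A = m%:P by rewrite derivD derivZ derivX derivC addr0 alg_polyC.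
rewrite (@integ_ext _ _ _ _ (horner (m^-1 *: (deriv (Q \Po A))))); last first.
  move=> y /andP[sy yt]; rewrite fq ?ltrD2r ?ltr_pM2l ?sy //.
  by rewrite deriv_comp dA dQ hornerZ hornerM hornerC horner_comp eA mulrCA mulVf ?mulr1 ?gt_eqF.
rewrite (@integ_ext _ _ _ _ (fun y => m^-1 * (deriv (Q \Po A)).[y])); last by move=> y _; rewrite hornerZ.
rewrite integZ; last exact: bmeas_horner.
have [_ <-] := primitive_horner s t (Q \Po A); rewrite ?lexx //.
by rewrite !horner_comp !eA mulrA divff ?gt_eqF // mul1r.
Qed.

Lemma integ_sqr_poly_gt0 s t w q (wm : R) : s < t -> 0 < wm -> bmeas s t w ->
  (forall y, s < y < t -> wm <= w y) -> q != 0 ->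
  0 < integ s t (fun y => w y * (q.[y] * q.[y])).
Proof.
move=> st wm0 bw wmw qn0.
have bq := bmeas_horner s t q.
apply: (@lt_le_trans _ _ (integ s t (fun y => wm * (q.[y] * q.[y])))); last first.
  by apply: le_integ; [bmeas_auto..|] => y /wmw ?; rewrite ler_wpM2r // -expr2 sqr_ge0.
rewrite integZ; last by bmeas_auto.
rewrite mulr_gt0 // lt_neqAle integ_ge0 ?andbT; last by move=> y _; rewrite -expr2 sqr_ge0.
rewrite eq_sym; apply: contra_neq qn0 => h.
apply: (poly_eq0_itv st); apply: integ_sqr_eq0 => //.
  exact: primitive_continuous (primitive_horner s t q).
Qed.

(** The w-weighted least-squares projection onto degree less than n, [size] being one more than the
    degree. *)
Definition is_proj s t w n f (pi : {poly R}) : Prop :=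
  (size pi <= n)%N /\
  forall q, (size q <= n)%N -> integ s t (fun y => w y * ((f y - pi.[y]) * q.[y])) = 0.

(** Gram-Schmidt: the residual [e] of X^n after projection is orthogonal to all lower degrees, and
    adding the component of f along [e] passes from n to n + 1. *)
Lemma proj_exists s t w (wm : R) n f : s < t -> 0 < wm -> bmeas s t w ->
  (forall y, s < y < t -> wm <= w y) -> bmeas s t f -> exists pi, is_proj s t w n f pi.
Proof.
move=> st wm0 bw wmw; elim: n f => [|n IH] f bf.
  exists 0; split; first by rewrite size_poly0.
  move=> q; rewrite leqn0 size_poly_eq0 => /eqP ->.
  by apply: integ_eq0 => y _; rewrite horner0 !mulr0.
have [r [sr hr]] := IH (horner 'X^n) (bmeas_horner s t _).
have [pi [spi hpi]] := IH f bf.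
pose e : {poly R} := 'X^n - r.
have se : size e = n.+1 by rewrite size_polyDl ?size_polyXn // size_polyN ltnS.
have le : e`_n = 1 by rewrite coefB coefXn eqxx (nth_default _ sr) subr0.
have en0 : e != 0 by rewrite -size_poly_eq0 se.
have e2 := integ_sqr_poly_gt0 st wm0 bw wmw en0.
have he q : (size q <= n)%N -> integ s t (fun y => w y * (e.[y] * q.[y])) = 0.
  by move=> sq; rewrite -[RHS](hr q sq); apply: integ_ext => y _; rewrite hornerD hornerN.
have b1 := bmeas_horner s t.
pose c := integ s t (fun y => w y * (f y * e.[y])) / integ s t (fun y => w y * (e.[y] * e.[y])).
have hpie : integ s t (fun y => w y * (pi.[y] * e.[y])) = 0.
  by rewrite -[RHS](he pi spi); apply: integ_ext => y _; ring.
exists (pi + c *: e); split.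
  rewrite (leq_trans (size_polyD _ _)) // geq_max (leq_trans spi) //=.
  by rewrite (leq_trans (size_scale_leq _ _)) // se.
move=> q sq.
pose q' := q - q`_n *: e.
have sq' : (size q' <= n)%N by have := size_sub_lead sq se; rewrite le divr1.
have eq y : q.[y] = q'.[y] + q`_n * e.[y] by rewrite !hornerE subrK.
rewrite (@integ_ext _ _ _ _ (fun y => (w y * ((f y - pi.[y]) * q'.[y]) - c * (w y * (e.[y] * q'.[y])))
   + q`_n * ((w y * (f y * e.[y]) - w y * (pi.[y] * e.[y])) - c * (w y * (e.[y] * e.[y]))))); last first.
  by move=> y _; rewrite hornerD hornerZ eq; ring.
rewrite integD; [|bmeas_auto..].
rewrite integZ; [|bmeas_auto..].
rewrite !integB; try by bmeas_auto.
rewrite hpi // hpie !integZ; try by bmeas_auto.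
by rewrite he // mulr0 !subr0 mulfVK ?gt_eqF // subrr mulr0 addr0.
Qed.

(** The surviving factor makes the boundary terms at 1 and -1 vanish when Rodrigues' formula is
    integrated by parts. *)
Lemma derivn_rodrigues n j : (j <= n)%N -> exists r : {poly R},
  derivn j (('X^2 - 1) ^+ n) = ('X^2 - 1) ^+ (n - j) * r.
Proof.
elim: j => [_|j IH jn]; first by exists 1; rewrite mulr1 subn0.
have [r hr] := IH (ltnW jn).
have e : (n - j)%N = (n - j.+1).+1 by rewrite subnSK.
set P : {poly R} := 'X^2 - 1 in hr *.
exists ((deriv P *+ (n - j)) * r + P * deriv r).
rewrite derivnS hr derivM deriv_exp mulrDr e /=; congr (_ + _).
  by rewrite mulrA mulrnAr [deriv P * _]mulrC.
by rewrite exprSr mulrA.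
Qed.

Lemma legendre_orth n q : (size q <= n)%N ->
  integ (-1) 1 (fun y => (legendre n).[y] * q.[y]) = 0.
Proof.
move=> sq.
(* Each integration by parts removes one derivative from the Rodrigues power and lowers the degree
   of r; after k steps r has become zero. *)
have key k : (k <= n)%N -> forall r, (size r <= k)%N ->
    integ (-1) 1 (fun y => (derivn k (('X^2 - 1) ^+ n)).[y] * r.[y]) = 0.
  have N11 : -1 <= 1 :> R by lra.
  elim: k => [_ r|k IH kn r sr].
    rewrite leqn0 size_poly_eq0 => /eqP ->.
    by apply: integ_eq0 => y _; rewrite horner0 !mulr0.
  rewrite derivnS (integ_by_parts N11 (primitive_horner _ _ _) (primitive_horner _ _ r)).
  rewrite (IH (ltnW kn)); last first.
    have [->|rn0] := eqVneq r 0; first by rewrite deriv0 size_poly0.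
    by rewrite -ltnS (leq_trans (lt_size_deriv rn0)).
  have [g ->] := derivn_rodrigues (ltnW kn).
  have -> : (n - k)%N = (n - k.+1).+1 by rewrite subnSK.
  have e1 : ('X^2 - 1 : {poly R}).[1] = 0 by rewrite !hornerE /=; try ring.
  have e2 : ('X^2 - 1 : {poly R}).[-1] = 0 by rewrite !hornerE /=; try ring.
  by rewrite exprS -mulrA !hornerM e1 e2 !mul0r subrr subr0.
rewrite (@integ_ext _ _ _ _ (fun y => (2 ^+ n * n`!%:R)^-1 * ((derivn n (('X^2 - 1) ^+ n)).[y] * q.[y]))).
  rewrite integZ ?key ?mulr0 //.
  by apply: bmeasM; exact: bmeas_horner.
by move=> y _; rewrite /legendre hornerZ mulrA.
Qed.

Lemma size_legendre n : size (legendre n : {poly R}) = n.+1.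
Proof.
rewrite /legendre size_scale; last first.
  by rewrite invr_eq0 mulf_neq0 ?expf_neq0 ?pnatr_eq0 // -lt0n fact_gt0.
have m : ('X^2 - 1 : {poly R}) \is monic by rewrite monicXnsubC.
have sz : size (('X^2 - 1 : {poly R}) ^+ n) = (n * 2).+1.
  have s2 : size ('X^2 - 1 : {poly R}) = 3%N by apply: (@size_XnsubC R 2 1).
  rewrite -[LHS]prednK; last by rewrite size_poly_gt0 monic_neq0 // monic_exp.
  by rewrite size_exp s2 mulnC.
apply/eqP; rewrite eqn_leq; apply/andP; split.
  apply/leq_sizeP => j nj; rewrite coef_derivn nth_default ?mul0rn // sz.
  by rewrite muln2 -addnn ltn_add2l.
(* The coefficient of degree n is a nonzero falling factorial times the leading coefficient 1 of the
   power. *)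
rewrite ltnNge; apply/negP => /leq_sizeP /(_ n (leqnn _)) /eqP.
rewrite coef_derivn -mulr_natr mulf_eq0 pnatr_eq0 => /orP[].
  have /monicP : (('X^2 - 1 : {poly R}) ^+ n) \is monic by rewrite monic_exp.
  by rewrite lead_coefE sz /= muln2 -addnn => ->; rewrite oner_eq0.
by rewrite -leqn0 leqNgt ffact_gt0 leq_addr.
Qed.

(** Induction on the degree: peeling off the Legendre component splits the integral of q^2 by
    orthogonality, and point values are treated in the two parts separately. *)
Lemma inverse_inequality_ref n : exists2 C : R, 0 <= C &
  forall q, (size q <= n)%N -> forall y, -1 <= y <= 1 ->
    q.[y] * q.[y] <= C * integ (-1) 1 (fun z => q.[z] * q.[z]).
Proof.
have N11 : -1 < 1 :> R by lra.
elim: n => [|n [C C0 IH]].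
  exists 0 => // q; rewrite leqn0 size_poly_eq0 => /eqP -> y _.
  by rewrite horner0 !mul0r.
pose l : {poly R} := legendre n.
have ln0 : l != 0 by rewrite -size_poly_eq0 size_legendre.
have bh := bmeas_horner (-1) 1.
have [B B0 lB] : exists2 B : R, 0 <= B & forall y, -1 <= y <= 1 -> l.[y] * l.[y] <= B.
  have [K K0 lK] := primitive_lipschitz (primitive_horner (-1) 1 l).
  exists ((`|l.[-1]| + K * 2) ^+ 2); first exact: sqr_ge0.
  move=> y /andP[y1 y2]; rewrite -expr2 -[leLHS]real_normK ?num_real //.
  rewrite ler_sqr ?nnegrE ?addr_ge0 ?mulr_ge0 //.
  have := lK _ _ (lexx _) y1 y2; have : K * (y - -1) <= K * 2 by rewrite ler_wpM2l //; lra.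
  have := lerB_dist (l.[y]) (l.[-1]); lra.
have N0 : 0 < integ (-1) 1 (fun z => l.[z] * l.[z]).
  have := @integ_sqr_poly_gt0 _ _ (cst 1) l 1 N11 ltr01 (bmeas_cst _ _ _) (fun y _ => lexx _) ln0.
  by congr (_ < _); apply: integ_ext => y _; rewrite mul1r.
set N := integ _ _ _ in N0.
(* The factors 2 come from (u + v)^2 <= 2 u^2 + 2 v^2; B / N compares the maximum of the square of
   the Legendre polynomial with its integral. *)
exists (Num.max (2 * C) (2 * B / N)); first by rewrite le_max mulr_ge0.
move=> q sq y y1.
pose c := q`_n / l`_n.
pose q' := q - c *: l.
have sq' : (size q' <= n)%N := size_sub_lead sq (size_legendre n).
have eq z : q.[z] = q'.[z] + c * l.[z] by rewrite !hornerE subrK.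
have -> : integ (-1) 1 (fun z => q.[z] * q.[z]) =
    integ (-1) 1 (fun z => q'.[z] * q'.[z]) + c ^+ 2 * N.
  rewrite (@integ_ext _ _ _ _ (fun z => q'.[z] * q'.[z] + ((2 * c) * (l.[z] * q'.[z]) + c ^+ 2 * (l.[z] * l.[z])))); last first.
    by move=> z _; rewrite eq; ring.
  rewrite !integD; try by bmeas_auto.
  rewrite !integZ; try by bmeas_auto.
  by rewrite legendre_orth // mulr0 add0r.
have I0 : 0 <= integ (-1) 1 (fun z => q'.[z] * q'.[z]).
  by apply: integ_ge0 => z _; rewrite -expr2 sqr_ge0.
have h1 := IH _ sq' _ y1; have h2 := lB _ y1.
apply: (@le_trans _ _ (2 * (q'.[y] * q'.[y]) + 2 * c ^+ 2 * (l.[y] * l.[y]))).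
  have := sqr_ge0 (q'.[y] - c * l.[y]); rewrite eq; nra.
rewrite mulrDr lerD //.
  apply: (@le_trans _ _ (2 * C * integ (-1) 1 (fun z => q'.[z] * q'.[z]))); first nra.
  by rewrite ler_wpM2r // le_max lexx.
apply: (@le_trans _ _ (2 * B / N * (c ^+ 2 * N))).
  rewrite (_ : _ * (c ^+ 2 * N) = 2 * c ^+ 2 * B); last by field; rewrite gt_eqF.
  by rewrite ler_wpM2l // mulr_ge0 // sqr_ge0.
by rewrite ler_wpM2r ?le_max ?lexx ?orbT // mulr_ge0 ?sqr_ge0 // ltW.
Qed.

Lemma size_comp_affine (P : {poly R}) (m c : R) : m != 0 ->
  size (P \Po (m *: 'X + c%:P)) = size P.
Proof.
move=> m0; apply: size_comp_poly2.
by rewrite size_polyDl size_scale // size_polyX // ltnS size_polyC_leq1.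
Qed.

Lemma inverse_inequality n : exists2 C : R, 0 <= C &
  forall s t q, s < t -> (size q <= n)%N -> forall y, s <= y <= t ->
    q.[y] * q.[y] * (t - s) <= C * integ s t (fun z => q.[z] * q.[z]).
Proof.
have [C C0 hC] := inverse_inequality_ref n.
(* The reference interval has length 2: t - s is twice the slope m of the map from it. *)
exists (2 * C); first by rewrite mulr_ge0.
move=> s t q st sq y /andP[sy yt].
pose m := (t - s) / 2; pose c := (s + t) / 2.
have m0 : 0 < m by rewrite divr_gt0 // subr_gt0.
pose A : {poly R} := m *: 'X + c%:P.
have eA z : A.[z] = m * z + c by rewrite /A !hornerE.
have sqA : (size (q \Po A) <= n)%N by rewrite size_comp_affine // gt_eqF.
have y1 : -1 <= (y - c) / m <= 1.
  by rewrite ler_pdivlMr // ler_pdivrMr // /m /c; apply/andP; split; lra.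
have := hC _ sqA _ y1; rewrite horner_comp eA [m * _]mulrC mulfVK ?gt_eqF // subrK => h.
have := @integ_affine (-1) 1 m c (fun z => q.[z] * q.[z]) (q * q) m0 _ _.
have -> : m * -1 + c = s by rewrite /m /c; field.
have -> : m * 1 + c = t by rewrite /m /c; field.
move=> ->; [|by lra|by move=> z _; rewrite hornerM].
have -> : t - s = 2 * m by rewrite /m; field.
move: h; rewrite (@integ_ext _ _ _ _ (fun z => q.[m * z + c] * q.[m * z + c])).
  set I := integ _ _ _ => h.
  have e : 2 * C * (m * I) = C * I * (2 * m) by ring.
  by rewrite e ler_wpM2r // mulr_ge0 // ltW.
by move=> z _; rewrite horner_comp eA.
Qed.

(** Sup-norm stability of the weighted projection: an energy bound followed by the inverse
    inequality. The length of the interval cancels, so one constant serves every element of every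
    mesh. *)
Lemma proj_bound n : exists2 C : R, 0 <= C &
  forall s t w f (pi : {poly R}) (wm wM K : R), s < t -> 0 < wm -> bmeas s t w ->
    (forall y, s < y < t -> wm <= w y <= wM) -> bmeas s t f ->
    (forall y, s < y < t -> `|f y| <= K) -> 0 <= K ->
    is_proj s t w n f pi -> forall y, s <= y <= t -> `|pi.[y]| <= C * (wM / wm + 1) * K.
Proof.
have [C C0 hC] := inverse_inequality n.
exists (C + 1); first by rewrite addr_ge0.
move=> s t w f pi wm wM K st wm0 bw wmM bf fK K0 [spi hpi] y yst.
have wm' z : s < z < t -> wm <= w z by move=> /wmM /andP[].
have wM' z : s < z < t -> w z <= wM by move=> /wmM /andP[].
have wM0 : 0 < wM.
  have /wmM /andP[h1 h2] : s < (s + t) / 2 < t by apply/andP; split; lra.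
  by rewrite (lt_le_trans wm0) // (le_trans h1).
have bpi := bmeas_horner s t pi.
pose I := integ s t (fun z => w z * (pi.[z] * pi.[z])).
have I1 : wm * integ s t (fun z => pi.[z] * pi.[z]) <= I.
  rewrite -integZ; last by bmeas_auto.
  by apply: le_integ; [bmeas_auto..|] => z /wm' ?; rewrite ler_wpM2r // -expr2 sqr_ge0.
(* In f^2 = pi^2 + 2 (f - pi) pi + (f - pi)^2 the middle term integrates to zero against w, and the
   last one is dropped. *)
have I2 : I <= K ^+ 2 * (wM * (t - s)).
  have e0 := hpi _ spi.
  have : integ s t (fun z => w z * (pi.[z] * pi.[z])) <=
     integ s t (fun z => K ^+ 2 * w z + ((-2) * (w z * ((f z - pi.[z]) * pi.[z])))).
    apply: le_integ; [bmeas_auto..|] => z zst.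
    have w0 : 0 <= w z by apply: le_trans (wm' _ zst); apply: ltW.
    rewrite (_ : _ + _ = w z * (K ^+ 2 + (-2) * ((f z - pi.[z]) * pi.[z]))); last by ring.
    rewrite ler_wpM2l //.
    have : f z ^+ 2 <= K ^+ 2.
      by rewrite -[leLHS]real_normK ?num_real // ler_sqr ?nnegrE ?fK.
    have := sqr_ge0 (f z - pi.[z]); nra.
  rewrite integD ?integZ ?e0 ?mulr0 ?addr0; try by bmeas_auto.
  move=> /le_trans; apply; rewrite ler_wpM2l ?sqr_ge0 // -integ_cst ?(ltW st) //.
  by apply: le_integ; [bmeas_auto..|] => z /wM'.
have h := hC _ _ _ st spi _ yst.
have ts0 : 0 < t - s by rewrite subr_gt0.
have h2 : pi.[y] ^+ 2 <= C * (wM / wm) * K ^+ 2.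
  rewrite expr2 -(ler_pM2r ts0) -(ler_pM2l wm0).
  rewrite (_ : wm * (C * (wM / wm) * K ^+ 2 * (t - s)) = C * (K ^+ 2 * (wM * (t - s)))); last first.
    by field; rewrite gt_eqF.
  apply: (@le_trans _ _ (wm * (C * integ s t (fun z => pi.[z] * pi.[z])))).
    by rewrite ler_wpM2l // ltW.
  by rewrite mulrCA ler_wpM2l // (le_trans I1).
have q0 : 0 <= wM / wm by rewrite divr_ge0 // ltW.
have b0 : 0 <= (C + 1) * (wM / wm + 1) by rewrite mulr_ge0 ?addr_ge0.
rewrite -ler_sqr ?nnegrE ?mulr_ge0 // ?addr_ge0 // real_normK ?num_real //.
apply: le_trans h2 _; rewrite exprMn ler_wpM2r ?sqr_ge0 //.
(* The two additions of 1 make the constant at least 1, so that its square dominates [C * (wM / wm)]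
   and no square root appears in it. *)
have : 1 <= (C + 1) * (wM / wm + 1) by nra.
nra.
Qed.

End PolynomialsOnIntervals.

(** * Superconvergence of the flux form *)

(* Elements are numbered from 0: element i is ]x i, x i.+1[, which is the element
   i.+1 of [is_mesh]. *)
Section Mesh.
Context {R : realType} (a b : R) (N : nat) (x : nat -> R) (hm : is_mesh a b N x).
Implicit Types (i j n : nat) (y : R) (f w g : R -> R).

Lemma mesh_le i j : (i <= j)%N -> (j <= N)%N -> x i <= x j.
Proof.
elim: j => [|j IH]; first by rewrite leqn0 => /eqP ->.
rewrite leq_eqVlt => /predU1P[->//|ij jN].
by rewrite (le_trans (IH ij (ltnW jN))) // ltW //; case: hm => _ _; apply.
Qed.

Lemma mesh_lt i : (i < N)%N -> x i < x i.+1.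
Proof. by case: hm => _ _; apply. Qed.

Lemma mesh_ge_a i : (i <= N)%N -> a <= x i.
Proof. by case: hm => <- _ _; exact: mesh_le. Qed.

Lemma mesh_le_b i : (i <= N)%N -> x i <= b.
Proof. by case: hm => _ <- _ iN; exact: mesh_le. Qed.

Lemma mesh_locate_cc y : (0 < N)%N -> a <= y <= b -> exists2 i, (i < N)%N & x i <= y <= x i.+1.
Proof.
case: hm => <- <- _ N0 /andP[ya yb].
elim: {1 2 3}N N0 yb => // n IH _ yb.
have [yn|ny] := leP (x n) y; first by exists n; rewrite ?yn.
case: n IH yb ny => [|n] IH yb ny; first by move: ya; rewrite leNgt ny.
by have [i i1 i2] := IH isT (ltW ny); exists i => //; exact: ltnW.
Qed.

Definition nodes : seq R := [seq x i | i <- iota 0 N.+1].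

Lemma mesh_locate y : a < y < b -> y \notin nodes -> exists2 i, (i < N)%N & x i < y < x i.+1.
Proof.
move=> /andP[ay yb] yn.
have N0 : (0 < N)%N.
  by rewrite lt0n; apply/eqP => N0; case: hm => ea eb _; move: ay yb; rewrite -ea -eb N0 => /lt_trans h /h; rewrite ltxx.
have [|i iN /andP[h1 h2]] := @mesh_locate_cc y N0; first by rewrite !ltW.
have ne j : (j <= N)%N -> y != x j.
  move=> jN; apply: contraNneq yn => ->; apply/mapP; exists j => //.
  by rewrite mem_iota.
exists i => //; rewrite !lt_neqAle h1 h2 !andbT eq_sym !ne //; exact: ltnW.
Qed.

Lemma mesh_size_ge i : (i < N)%N -> x i.+1 - x i <= mesh_size N x.
Proof.
by move=> iN; exact: (@le_bigmax _ _ _ 0 (fun i : 'I_N => x i.+1 - x i) (Ordinal iN)).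
Qed.

Lemma mesh_size_ge0 : 0 <= mesh_size N x.
Proof. exact: bigmax_ge_id. Qed.

Lemma mesh_size_le : a <= b -> mesh_size N x <= b - a.
Proof.
move=> ab; apply/bigmax_leP; split; first by rewrite subr_ge0.
by move=> i _; rewrite lerB ?mesh_ge_a ?mesh_le_b // ltnW.
Qed.

Lemma mesh_itv i y : (i < N)%N -> x i < y < x i.+1 -> a < y < b.
Proof.
move=> iN /andP[h1 h2].
by rewrite (le_lt_trans (mesh_ge_a (ltnW iN))) // (lt_le_trans h2) // mesh_le_b.
Qed.

Lemma bmeas_elem i f : (i < N)%N -> bmeas a b f -> bmeas (x i) (x i.+1) f.
Proof. by move=> iN; apply: bmeas_sub; rewrite ?mesh_ge_a ?mesh_le_b // ltnW. Qed.

Lemma primitive_elem i F f : (i < N)%N -> primitive_on a b F f ->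
  primitive_on (x i) (x i.+1) F f.
Proof.
by move=> iN; apply: primitive_sub; [exact: (mesh_ge_a (ltnW iN))|exact: (mesh_le_b iN)].
Qed.

Lemma bmeas_mesh f : a < b -> (forall i, (i < N)%N -> bmeas (x i) (x i.+1) f) -> bmeas a b f.
Proof.
case: hm => ea eb _ ab hf.
have N0 : (0 < N)%N by rewrite lt0n; apply/eqP => N0; move: ab; rewrite -ea -eb N0 ltxx.
rewrite -ea -eb; elim: N hf N0 => // n IH hf _.
case: n IH hf => [|n] IH hf; first exact: hf.
by apply: bmeas_cat (hf n.+1 (ltnSn _)); apply: IH => // i ?; apply: hf; apply: ltnW.
Qed.

Lemma integ_mesh n f : (n <= N)%N -> bmeas a b f ->
  integ a (x n) f = \sum_(i < n) integ (x i) (x i.+1) f.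
Proof.
move=> nN bf; elim: n nN => [|n IH] nN.
  by rewrite big_ord0 integ_ge //; case: hm => ->.
rewrite big_ord_recr /= -IH; last exact: ltnW.
apply: integ_cat; [exact/mesh_ge_a/ltnW|exact/ltW/mesh_lt|].
by apply: bmeas_sub bf => //; exact: mesh_le_b.
Qed.

Lemma norm_integ_mesh_le s t f K : a <= s -> s <= t -> t <= b -> 0 <= K -> bmeas a b f ->
  (forall i y, (i < N)%N -> x i < y < x i.+1 -> `|f y| <= K) -> `|integ s t f| <= K * (t - s).
Proof.
move=> sa st tb K0 bf fK; apply: (@norm_integ_le_off _ _ _ _ _ nodes) => //.
  exact: bmeas_sub bf.
move=> y /andP[sy yt] /mesh_locate [|i iN]; last exact: fK.
by rewrite (le_lt_trans sa) // (lt_le_trans yt).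
Qed.

(** The degree is less than n on each open element; values at the nodes are free, as nodes form a
    null set. *)
Definition ppoly n f : Prop := forall i, (i < N)%N ->
  exists2 q : {poly R}, (size q <= n)%N & forall y, x i < y < x i.+1 -> f y = q.[y].

Lemma ppoly_bmeas n f : a < b -> ppoly n f -> bmeas a b f.
Proof.
move=> ab pf; apply: bmeas_mesh => // i /pf [q _ fq].
by apply: bmeas_ext (bmeas_horner _ _ q) => y /fq.
Qed.

Lemma ppolyD n f g : ppoly n f -> ppoly n g -> ppoly n (fun y => f y + g y).
Proof.
move=> pf pg i iN; have [q sq fq] := pf i iN; have [r sr gr] := pg i iN.
exists (q + r); first by rewrite (leq_trans (size_polyD _ _)) // geq_max sq.
by move=> y h; rewrite hornerD fq ?gr.
Qed.

Lemma ppolyZ n (k : R) f : ppoly n f -> ppoly n (fun y => k * f y).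
Proof.
move=> pf i iN; have [q sq fq] := pf i iN.
exists (k *: q); first by rewrite (leq_trans (size_scale_leq _ _)).
by move=> y h; rewrite hornerZ fq.
Qed.

Lemma ppolyB n f g : ppoly n f -> ppoly n g -> ppoly n (fun y => f y - g y).
Proof.
move=> pf pg i iN; have [q sq fq] := pf i iN; have [r sr gr] := pg i iN.
exists (q - r); first by rewrite (leq_trans (size_polyD _ _)) // geq_max sq size_polyN.
by move=> y h; rewrite !hornerE fq ?gr.
Qed.

Lemma ppoly_cst n (k : R) : (0 < n)%N -> ppoly n (cst k).
Proof.
move=> n0 i iN; exists k%:P; first by rewrite (leq_trans (size_polyC_leq1 _)).
by move=> y _; rewrite hornerC.
Qed.

(** The pieces are extended by zero and summed; the open elements are disjoint, so at most one term
    is nonzero. *)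
Lemma piecewise_glue (P : nat -> {poly R} -> Prop) :
  (forall i, (i < N)%N -> exists q, P i q) ->
  exists f, forall i, (i < N)%N -> exists2 q, P i q & forall y, x i < y < x i.+1 -> f y = q.[y].
Proof.
move=> hP.
have [r hr] : exists r : nat -> {poly R}, forall i, (i < N)%N -> P i (r i).
  suff : forall i, exists q, (i < N)%N -> P i q by move=> /choice [r hr]; exists r.
  move=> i; case: (ltnP i N) => iN; last by exists 0.
  by have [q Pq] := hP i iN; exists q.
exists (fun y => \sum_(i < N) if x i < y < x i.+1 then (r i).[y] else 0).
move=> i iN; exists (r i); first exact: hr.
move=> y iy; rewrite (bigD1 (Ordinal iN)) //= iy big1 ?addr0 // => j ji.
case: ifP => // /andP[j1 j2]; have /andP[i1 i2] := iy.
have : (j < i)%N \/ (i < j)%N.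
  by apply/orP; rewrite -neq_ltn; apply: contra ji => /eqP h; apply/eqP/val_inj.
case=> h.
  by have := mesh_le h (ltnW iN); rewrite leNgt (lt_trans i1 j2).
by have := mesh_le h (ltnW (ltn_ord j)); rewrite leNgt (lt_trans j1 i2).
Qed.

Definition pproj w n f g : Prop := forall i, (i < N)%N ->
  exists2 q, is_proj (x i) (x i.+1) w n f q & forall y, x i < y < x i.+1 -> g y = q.[y].

Lemma pproj_ppoly w n f g : pproj w n f g -> ppoly n g.
Proof. by move=> h i /h [q [sq _] gq]; exists q. Qed.

Lemma pproj_exists w n f (wm : R) : 0 < wm -> bmeas a b w ->
  (forall y, a < y < b -> wm <= w y) -> bmeas a b f -> exists g, pproj w n f g.
Proof.
move=> wm0 bw wmw bf; apply: piecewise_glue => i iN.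
apply: (@proj_exists _ _ _ _ wm) => //; [exact: mesh_lt|exact: bmeas_elem| |exact: bmeas_elem].
by move=> y /(mesh_itv iN) /wmw.
Qed.

Lemma pproj_orth_elem w n f g q i : pproj w n f g -> ppoly n q -> (i < N)%N ->
  integ (x i) (x i.+1) (fun y => w y * ((f y - g y) * q y)) = 0.
Proof.
move=> pg pq iN; have [r [sr hr] gr] := pg i iN; have [q' sq qq] := pq i iN.
by rewrite -[RHS](hr q' sq); apply: integ_ext => y h; rewrite gr ?qq.
Qed.

Lemma pproj_orth w n f g q : a < b -> bmeas a b w -> bmeas a b f ->
  pproj w n f g -> ppoly n q -> integ a b (fun y => w y * ((f y - g y) * q y)) = 0.
Proof.
move=> ab bw bf pg pq.
have bg := ppoly_bmeas ab (pproj_ppoly pg); have bq := ppoly_bmeas ab pq.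
have <- : x N = b by case: hm.
rewrite integ_mesh //; last by bmeas_auto.
by apply: big1 => i _; exact: pproj_orth_elem pg pq (ltn_ord i).
Qed.

Lemma ppoly_eq0 w n (wm : R) q : a < b -> 0 < wm -> bmeas a b w ->
  (forall y, a < y < b -> wm <= w y) -> ppoly n q ->
  integ a b (fun y => w y * (q y * q y)) = 0 ->
  forall i y, (i < N)%N -> x i < y < x i.+1 -> q y = 0.
Proof.
move=> ab wm0 bw wmw pq q0 i y iN iy.
have bq := ppoly_bmeas ab pq.
have [r sr qr] := pq i iN; rewrite qr //.
have [->|rn0] := eqVneq r 0; first by rewrite horner0.
have wmi : forall y, x i < y < x i.+1 -> wm <= w y by move=> z /(mesh_itv iN) /wmw.
have := integ_sqr_poly_gt0 (mesh_lt iN) wm0 (bmeas_elem iN bw) wmi rn0.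
suff -> : integ (x i) (x i.+1) (fun y => w y * (r.[y] * r.[y])) = 0 by rewrite ltxx.
rewrite (@integ_ext _ _ _ _ (fun y => w y * (q y * q y))); last by move=> z /qr ->.
have F0 j : (j < N)%N -> 0 <= integ (x j) (x j.+1) (fun y => w y * (q y * q y)).
  move=> jN; apply: integ_ge0 => z /(mesh_itv jN) /wmw wz.
  by apply: mulr_ge0; [exact: le_trans (ltW wm0) wz|rewrite -expr2 sqr_ge0].
have : \sum_(j < N) integ (x j) (x j.+1) (fun y => w y * (q y * q y)) = 0.
  by rewrite -integ_mesh //; [case: hm => _ -> _|bmeas_auto].
move=> /eqP; rewrite psumr_eq0; last by move=> j _; exact: F0.
by move=> /allP /(_ (Ordinal iN)); rewrite mem_index_enum => /(_ isT) /= /eqP.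
Qed.

End Mesh.

(** * Projection error and discrete flux error on a fixed mesh *)

Section Superconvergence.
Context {R : realType} (a b : R) (N : nat) (x : nat -> R).
Context (hab : a < b) (hm : is_mesh a b N x).
Context (w : R -> R) (wm wM : R) (bw : bmeas a b w) (wm0 : 0 < wm).
Context (wB : forall y, a < y < b -> wm <= w y <= wM).
(** [k0] is the one element on which w may vary. [Cp] is the sup-norm constant of the projection on
    all subintervals, supplied later by [proj_bound]. *)
Context (p k0 : nat) (hp : (2 <= p)%N) (Cp : R) (Cp0 : 0 <= Cp).
Context (hCp : forall s t (f : R -> R) pi (K : R), a <= s -> s < t -> t <= b ->
  bmeas s t f -> (forall y, s < y < t -> `|f y| <= K) -> 0 <= K ->
  is_proj s t w p f pi -> forall y, s <= y <= t -> `|pi.[y]| <= Cp * K).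
Implicit Types (f g q : R -> R) (y : R) (i : nat).

Local Notation h := (mesh_size N x).
Local Notation J f := (integ a b f).

(** As D is orthogonal to degree less than p, [pi - (Q - D)] is the projection of [f - Q] and hence
    at most [Cp * K]. With D = 0 this is the plain projection error; with D a multiple of the
    Legendre polynomial it isolates the leading part of the error. *)
Lemma element_residual s t f (pi Q D : {poly R}) (K : R) : a <= s -> s < t -> t <= b ->
  bmeas s t f -> is_proj s t w p f pi -> (size (Q - D)%R <= p)%N ->
  (forall q : {poly R}, (size q <= p)%N -> integ s t (fun y => w y * (D.[y] * q.[y])) = 0) ->
  (forall y, s < y < t -> `|f y - Q.[y]| <= K) ->
  forall y, s < y < t -> `|f y - pi.[y] - D.[y]| <= (1 + Cp) * K.
Proof.
move=> sa st tb bf [spi hpi] sQD hD fQ y yst.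
have K0 : 0 <= K by apply: le_trans (fQ _ yst).
have bws := bmeas_sub sa tb bw.
have pr : is_proj s t w p (fun y => f y - Q.[y]) (pi - (Q - D)).
  split; first by rewrite (leq_trans (size_polyD _ _)) // geq_max spi size_polyN.
  move=> q sq; rewrite (@integ_ext _ _ _ _ (fun y => w y * ((f y - pi.[y]) * q.[y]) - w y * (D.[y] * q.[y]))); last first.
    by move=> z _; rewrite !(hornerD, hornerN); ring.
  by rewrite integB ?hpi ?hD ?subr0 //; bmeas_auto.
have := hCp sa st tb _ fQ K0 pr (y := y).
rewrite mulrDl mul1r => hb.
rewrite (_ : f y - pi.[y] - D.[y] = (f y - Q.[y]) - (pi - (Q - D)).[y]); last first.
  by rewrite !(hornerD, hornerN); ring.
apply: le_trans (ler_normB _ _) _; rewrite lerD ?fQ // hb //; first by bmeas_auto.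
by have /andP[/ltW -> /ltW ->] := yst.
Qed.

Lemma wM_gt0 : 0 < wM.
Proof.
have /wB /andP[h1 h2] : a < (a + b) / 2 < b by rewrite !midf_lt.
exact: lt_le_trans wm0 (le_trans h1 h2).
Qed.

Lemma w_ge0 y : a < y < b -> 0 <= w y.
Proof. by move=> /wB /andP[h1 _]; exact: le_trans (ltW wm0) h1. Qed.

Lemma norm_w_le y : a < y < b -> `|w y| <= wM.
Proof. by move=> yab; rewrite ger0_norm ?w_ge0 //; have /andP[] := wB yab. Qed.

Lemma norm_wM_le y (v K : R) : a < y < b -> `|v| <= K -> `|w y * v| <= wM * K.
Proof. by move=> yab vK; rewrite normrM ler_pM // norm_w_le. Qed.

Lemma integ_w_gt : wm * (b - a) <= J w.
Proof.
rewrite -integ_cst ?(ltW hab) //; apply: le_integ; [bmeas_auto..|].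
by move=> y /wB /andP[].
Qed.

Lemma integ_w_gt0 : 0 < J w.
Proof. by apply: lt_le_trans integ_w_gt; rewrite mulr_gt0 // subr_gt0. Qed.

Lemma pproj_norm_le f g (K : R) : bmeas a b f -> 0 <= K -> pproj N x w p f g ->
  (forall i y, (i < N)%N -> x i < y < x i.+1 -> `|f y| <= K) ->
  forall i y, (i < N)%N -> x i < y < x i.+1 -> `|g y| <= Cp * K.
Proof.
move=> bf K0 pg fK i y iN iy; have [r hr gr] := pg i iN.
rewrite gr //; apply: (hCp _ _ _ _ _ K0 hr).
- by apply: (mesh_ge_a hm); exact: ltnW.
- exact: (mesh_lt hm iN).
- exact: (mesh_le_b hm).
- exact: (bmeas_elem hm iN bf).
- by move=> z; exact: fK.
- by have /andP[/ltW -> /ltW ->] := iy.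
Qed.

Lemma mesh_N_gt0 : (0 < N)%N.
Proof.
rewrite lt0n; apply/eqP => N0; case: hm => ea eb _.
by move: hab; rewrite -ea -eb N0 ltxx.
Qed.

Lemma V_bound f (K : R) : bmeas a b f -> 0 <= K -> (forall y, a < y < b -> `|f y| <= K) ->
  forall y, a <= y <= b -> `|integ a y f| <= (b - a) * K.
Proof.
move=> bf K0 fK y /andP[ay yb].
apply: (@le_trans _ _ (K * (y - a))); last by rewrite mulrC ler_wpM2r // lerB.
apply: norm_integ_le => //; first exact: bmeas_sub bf.
by move=> z /andP[az zy]; rewrite fK // az (lt_le_trans zy).
Qed.

Lemma V_norm_le f y : bmeas a b f -> a <= y <= b -> `|integ a y f| <= J (fun y => `|f y|).
Proof.
move=> bf /andP[ay yb].
apply: le_trans (norm_integ (bmeas_sub (lexx _) yb bf)) _.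
rewrite (@integ_cat _ a y b) ?lerDl ?integ_ge0 //; bmeas_auto.
Qed.

(** F starts from zero at the left node of each element, so it can grow over one element length
    only. *)
Lemma primitive_mesh_bound f F (K : R) : primitive_on a b F f -> 0 <= K ->
  (forall i y, (i < N)%N -> x i < y < x i.+1 -> `|f y| <= K) ->
  (forall i, (i <= N)%N -> F (x i) = 0) ->
  forall y, a <= y <= b -> `|F y| <= K * h.
Proof.
move=> Ff K0 fK F0 y /(mesh_locate_cc hm mesh_N_gt0) [i iN /andP[iy yi]].
rewrite -[F y]subr0 -(F0 i (ltnW iN)).
have Fi := primitive_elem hm iN Ff.
apply: le_trans (primitive_norm_le Fi (fK i ^~ iN) (lexx _) iy yi) _.
by rewrite ler_wpM2l // (le_trans _ (mesh_size_ge x iN)) // lerD2r.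
Qed.

(* If r = beta e' is the flux of a function e that vanishes at a, then V1 r is e
   and V2 r is the primitive of e. *)
Definition V1 f y : R := integ a y (fun z => w z * f z).

Definition V2 f y : R := integ a y (V1 f).

Lemma V1_primitive f : bmeas a b f -> primitive_on a b (V1 f) (fun z => w z * f z).
Proof. by move=> bf; apply: primitive_integ; bmeas_auto. Qed.

Lemma V1_bmeas f : bmeas a b f -> bmeas a b (V1 f).
Proof. by move=> bf; exact: primitive_bmeas (V1_primitive bf). Qed.

Lemma V2_primitive f : bmeas a b f -> primitive_on a b (V2 f) (V1 f).
Proof. by move=> bf; apply: primitive_integ; exact: V1_bmeas. Qed.

Lemma V2_bmeas f : bmeas a b f -> bmeas a b (V2 f).
Proof. by move=> bf; exact: primitive_bmeas (V2_primitive bf). Qed.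

Lemma V1B f g y : bmeas a b f -> bmeas a b g -> a <= y <= b ->
  V1 (fun z => f z - g z) y = V1 f y - V1 g y.
Proof.
move=> bf bg /andP[ay yb]; rewrite -integB; try by apply: (bmeas_sub (lexx _) yb); bmeas_auto.
by apply: integ_ext => z _; rewrite mulrBr.
Qed.

Lemma V2B f g y : bmeas a b f -> bmeas a b g -> a <= y <= b ->
  V2 (fun z => f z - g z) y = V2 f y - V2 g y.
Proof.
move=> bf bg /andP[ay yb].
rewrite -integB; try by apply: (bmeas_sub (lexx _) yb); exact: V1_bmeas.
by apply: integ_ext => z /andP[az zy]; rewrite V1B // (ltW az) ltW // (lt_le_trans zy).
Qed.

Section Interpolation.
Context (sigma pi : R -> R) (A : R) (bs : bmeas a b sigma) (A0 : 0 <= A).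
Context (hpi : pproj N x w p sigma pi).
Context (hA : forall i y, (i < N)%N -> x i < y < x i.+1 -> `|sigma y - pi y| <= A).
Context (wcst : forall i, (i < N)%N -> i != k0 ->
  exists om, forall y, x i < y < x i.+1 -> w y = om).

Let E := V1 (fun y => sigma y - pi y).

Let D := V2 (fun y => sigma y - pi y).

Lemma pi_bmeas : bmeas a b pi.
Proof. exact: ppoly_bmeas (pproj_ppoly hpi). Qed.

Lemma interp_primitive : primitive_on a b E (fun y => w y * (sigma y - pi y)).
Proof. by have bpi := pi_bmeas; apply: primitive_integ; bmeas_auto. Qed.

Lemma interp_bmeas : bmeas a b E.
Proof. exact: primitive_bmeas interp_primitive. Qed.

Lemma interp_node i : (i <= N)%N -> E (x i) = 0.
Proof.
move=> iN; have [bE _] := interp_primitive.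
rewrite /E /V1 (integ_mesh hm) //; apply: big1 => j _.
have jN : (j < N)%N by apply: leq_trans iN.
have p1 : ppoly N x p (cst 1) by apply: ppoly_cst; exact: ltnW.
rewrite -[RHS](pproj_orth_elem hpi p1 jN).
by apply: integ_ext => y _; rewrite mulr1.
Qed.

Lemma interp_bound y : a <= y <= b -> `|E y| <= wM * A * h.
Proof.
apply: (primitive_mesh_bound interp_primitive).
- by rewrite mulr_ge0 // ltW // wM_gt0.
- by move=> i z iN iz; apply: norm_wM_le; [exact: (mesh_itv hm iN)|exact: (hA iN)].
- exact: interp_node.
Qed.

(** Integration by parts against the identity moves the derivative off E. The identity is an
    admissible test because p >= 2. *)
Lemma interp_mean i : (i < N)%N -> integ (x i) (x i.+1) E = 0.
Proof.
move=> iN.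
have pE := primitive_elem hm iN interp_primitive.
have pX := primitive_id (x i) (x i.+1).
have := integ_by_parts (ltW (mesh_lt hm iN)) pX pE.
rewrite !interp_node ?(ltnW iN) // !mulr0 subrr sub0r.
rewrite (@integ_ext _ _ _ _ E); last by move=> y _; rewrite mul1r.
move=> ->; have X : ppoly N x p id.
  by move=> j _; exists 'X; [rewrite size_polyX|move=> y _; rewrite hornerX].
have h0 := pproj_orth_elem hpi X iN; rewrite (_ : integ _ _ _ = 0) ?oppr0 //.
by rewrite -[RHS]h0; apply: integ_ext => y _; ring.
Qed.

Lemma dual_primitive : primitive_on a b D E.
Proof. exact: primitive_integ interp_bmeas. Qed.

Lemma dual_bound y : a <= y <= b -> `|D y| <= wM * A * h * h.
Proof.
apply: (primitive_mesh_bound dual_primitive).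
- by rewrite !mulr_ge0 ?mesh_size_ge0 // ltW // wM_gt0.
- move=> i z iN iz; apply: interp_bound.
  by have /andP[/ltW -> /ltW ->] := mesh_itv hm iN iz.
- move=> i iN; rewrite /D /V2 (integ_mesh hm) //; last exact: interp_bmeas.
  by apply: big1 => j _; apply: interp_mean; apply: leq_trans iN.
Qed.

(* The weight is constant off the interface element, so the means of [w * E]
   there vanish with those of [E]. *)
Lemma weighted_interp_mean i : (i <= N)%N ->
  `|integ a (x i) (fun y => w y * E y)| <= wM ^+ 2 * A * h ^+ 2.
Proof.
move=> iN.
have bE := interp_bmeas; have bwE : bmeas a b (fun y => w y * E y) by bmeas_auto.
have wMg := ltW wM_gt0; have h0 := mesh_size_ge0 N x.
have B0 : 0 <= wM ^+ 2 * A * h ^+ 2 by rewrite !mulr_ge0 // ?exprn_ge0.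
rewrite (integ_mesh hm) //.
have -> : \sum_(j < i) integ (x j) (x j.+1) (fun y => w y * E y) =
    if (k0 < i)%N then integ (x k0) (x k0.+1) (fun y => w y * E y) else 0.
  elim: i iN => [|i IH] iN; first by rewrite big_ord0.
  rewrite big_ord_recr /= IH ?(ltnW iN) //.
  have [->|ik] := eqVneq i k0; first by rewrite ltnn ltnSn add0r.
  rewrite [in RHS]ltnS [in RHS]leq_eqVlt [k0 == i]eq_sym (negPf ik) /=.
  have [om hom] := wcst iN ik.
  rewrite [X in _ + X](_ : _ = 0) ?addr0 //.
  rewrite (@integ_ext _ _ _ _ (fun y => om * E y)); last by move=> y /hom ->.
  by rewrite integZ ?interp_mean ?mulr0 //; exact: (bmeas_elem hm iN bE).
case: ifP => [ki|_]; last by rewrite normr0.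
have kN : (k0 < N)%N by apply: leq_trans iN.
apply: le_trans (_ : (wM * (wM * A * h)) * (x k0.+1 - x k0) <= _).
  apply: norm_integ_le; [exact: ltW (mesh_lt hm kN)|exact: (bmeas_elem hm kN bwE)|].
  move=> y /(mesh_itv hm kN) yab; apply: norm_wM_le => //; apply: interp_bound.
  by have /andP[/ltW -> /ltW ->] := yab.
rewrite [leRHS](_ : _ = wM * (wM * A * h) * h); last by ring.
by rewrite ler_wpM2l ?(mesh_size_ge x kN) // !mulr_ge0.
Qed.

(** Testing with 1 shows that f and its projection have the same weighted integral over each
    element. *)
Lemma integ_proj_node f g i : bmeas a b f -> pproj N x w p f g -> (i <= N)%N ->
  integ a (x i) (fun y => w y * g y) = integ a (x i) (fun y => w y * f y).
Proof.
move=> bf pg iN; have bg := ppoly_bmeas hm hab (pproj_ppoly pg).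
rewrite !(integ_mesh hm) //; try by bmeas_auto.
apply: eq_bigr => j _; have jN : (j < N)%N by apply: leq_trans iN.
have p1 : ppoly N x p (cst 1) by apply: ppoly_cst; exact: ltnW.
have bj u : bmeas a b u -> bmeas (x j) (x j.+1) u := @bmeas_elem _ _ _ _ _ hm j u jN.
have := pproj_orth_elem pg p1 jN.
rewrite (@integ_ext _ _ _ _ (fun y => w y * f y - w y * g y)); last by move=> y _; rewrite mulr1 mulrBr.
rewrite integB; try by apply: bj; bmeas_auto.
by move=> /subr0_eq.
Qed.

Lemma integ_weight_le y : a <= y <= b -> `|integ a y w| <= wM * (b - a).
Proof.
move=> yab; rewrite mulrC; apply: V_bound => //; first exact: ltW wM_gt0.
by move=> z; exact: norm_w_le.
Qed.

(** Sup bound of the corrector in units of A h: the first summand comes from the projection of E,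
    the second from the constant that restores mean zero. *)
Definition corrector_const (gamma : R) : R := `|gamma| * (Cp * wM + wM ^+ 2 / wm).

(** Bound of [V1] of the corrector in units of A h^2: the weighted mean of E up to a node, the
    remaining part of one element, and the constant. *)
Definition corrector_int_const (gamma : R) : R :=
  `|gamma| * (wM ^+ 2 + Cp * wM ^+ 2 + wM ^+ 3 / wm).

(** [som] is gamma times the projection of E plus a constant. Integration against w gains a factor
    h, since weighted integrals of the projection up to a node are those of E, where almost
    everything cancels. *)
Lemma corrector (gamma : R) : exists som, [/\ ppoly N x p som,
  J (fun y => w y * som y) = 0,
  forall i y, (i < N)%N -> x i < y < x i.+1 ->
    `|som y| <= corrector_const gamma * (A * h),
  forall y, a <= y <= b ->
    `|V1 som y| <= corrector_int_const gamma * (A * h ^+ 2) &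
  forall q, ppoly N x p q -> J (fun y => w y * q y) = 0 ->
    J (fun y => w y * ((gamma * E y - som y) * q y)) = 0].
Proof.
have bE := interp_bmeas.
have wg : forall y, a < y < b -> wm <= w y by move=> y /wB /andP[].
have [PE pPE] := pproj_exists hm p wm0 bw wg bE.
have ppPE := pproj_ppoly pPE.
have bPE := ppoly_bmeas hm hab ppPE.
have h0 := mesh_size_ge0 N x; have wMg := ltW wM_gt0.
have hba := mesh_size_le hm (ltW hab).
have ba0 : 0 < b - a by rewrite subr_gt0.
have Jw0 := integ_w_gt0; have Jwm := integ_w_gt.
set I := J (fun y => w y * E y).
set B := wM ^+ 2 * A * h ^+ 2.
have B0 : 0 <= B by rewrite !mulr_ge0 // ?exprn_ge0.
have xN : x N = b by case: hm.
have IB : `|I| <= B by have := weighted_interp_mean (leqnn N); rewrite xN.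
have JPE : J (fun y => w y * PE y) = I.
  by have := integ_proj_node bE pPE (leqnn N); rewrite xN.
have PEb : forall i y, (i < N)%N -> x i < y < x i.+1 -> `|PE y| <= Cp * (wM * A * h).
  apply: (pproj_norm_le bE) => //; first by rewrite !mulr_ge0.
  move=> i y iN /(mesh_itv hm iN) /andP[ay yb].
  by apply: interp_bound; rewrite !ltW.
(* Tests of weighted mean zero do not see constants, so a constant may be added to give [som] mean
   zero; it inherits the order h^2 of I. *)
pose kap := - (gamma * I / J w).
have kapb : `|kap| <= `|gamma| * (B / (wm * (b - a))).
  rewrite /kap normrN -mulrA normrM ler_wpM2l // normrM normfV (gtr0_norm Jw0).
  by apply: ler_pM => //; rewrite ?invr_ge0 ?(ltW Jw0) // lef_pV2 // posrE // mulr_gt0.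
exists (fun y => gamma * PE y + kap); split.
- by apply: ppolyD; [exact: ppolyZ|apply: ppoly_cst; exact: ltnW].
- rewrite (@integ_ext _ _ _ _ (fun y => gamma * (w y * PE y) + kap * w y)); last first.
    by move=> y _; ring.
  rewrite integD ?integZ ?JPE; try by bmeas_auto.
  by rewrite /kap mulNr mulfVK ?gt_eqF // subrr.
- move=> i y iN iy; apply: le_trans (ler_normD _ _) _.
  have -> : corrector_const gamma * (A * h) =
     `|gamma| * (Cp * (wM * A * h)) + `|gamma| * (wM ^+ 2 * A * h / wm).
    by rewrite /corrector_const; ring.
  apply: lerD; first by rewrite normrM ler_wpM2l // (PEb _ _ iN).
  (* The bound on [kap] carries h^2 / (b - a); one factor h is traded for b - a. *)
  apply: le_trans kapb _; rewrite ler_wpM2l // ler_pdivrMr ?mulr_gt0 //.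
  rewrite (_ : _ / wm * _ = wM ^+ 2 * A * h * (b - a)); last by field; rewrite gt_eqF.
  rewrite (_ : B = wM ^+ 2 * A * h * h); last by rewrite /B; ring.
  by rewrite ler_wpM2l // !mulr_ge0 ?exprn_ge0.
- move=> y yab; have /andP[ay yb] := yab.
  have sb f : bmeas a b f -> bmeas a y f by exact: bmeas_sub.
  rewrite /V1 (@integ_ext _ _ _ _ (fun y => gamma * (w y * PE y) + kap * w y)); last first.
    by move=> z _; ring.
  rewrite integD ?integZ; try by apply: sb; bmeas_auto.
  apply: le_trans (ler_normD _ _) _.
  have -> : corrector_int_const gamma * (A * h ^+ 2) =
     `|gamma| * (B + wM * (Cp * (wM * A * h)) * h) + `|gamma| * (wM * B / wm).
    by rewrite /corrector_int_const /B; ring.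
  apply: lerD; last first.
    rewrite normrM; apply: le_trans (ler_pM _ _ kapb (integ_weight_le yab)) _ => //.
    rewrite -[leLHS]mulrA ler_wpM2l // le_eqVlt; apply/orP; left; apply/eqP; field.
    by rewrite !gt_eqF.
  rewrite normrM ler_wpM2l //.
  (* Up to the last node before y, [PE] may be replaced by E; the rest lies in one element and gains
     h from its length. *)
  have [i iN /andP[iy yi]] := mesh_locate_cc hm mesh_N_gt0 yab.
  rewrite (@integ_cat _ a (x i)) ?(mesh_ge_a hm (ltnW iN)) //; last by apply: sb; bmeas_auto.
  apply: le_trans (ler_normD _ _) _; apply: lerD.
    by rewrite (integ_proj_node bE pPE (ltnW iN)); exact: weighted_interp_mean (ltnW iN).
  apply: le_trans (_ : wM * (Cp * (wM * A * h)) * (y - x i) <= _).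
    apply: (norm_integ_mesh_le hm) => //; first exact: (mesh_ge_a hm (ltnW iN)).
    + by rewrite !mulr_ge0.
    + by bmeas_auto.
    + by move=> j z jN jz; apply: norm_wM_le (mesh_itv hm jN jz) (PEb _ _ jN jz).
  rewrite ler_wpM2l ?mulr_ge0 //.
  by apply: le_trans (mesh_size_ge x iN); rewrite lerD2r.
- move=> q pq q0; have bq := ppoly_bmeas hm hab pq.
  rewrite (@integ_ext _ _ _ _ (fun y => gamma * (w y * ((E y - PE y) * q y)) + (- kap) * (w y * q y))); last first.
    by move=> z _; ring.
  rewrite integD ?integZ; try by bmeas_auto.
  by rewrite q0 (pproj_orth hm hab bw bE pPE pq) !mulr0 addr0.
Qed.

Section Discrete.
Context (gamma c Cs : R) (Cs0 : 0 <= Cs) (s : R -> R).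
Context (ps : ppoly N x p s) (s0 : J (fun y => w y * s y) = 0).
Context (sig0 : J (fun y => w y * sigma y) = 0).

Local Notation G t := (fun y => t y - gamma * V1 t y
  - c * V2 t y).

Context (hstab : forall (t Rm : R -> R) (eps : R), ppoly N x p t ->
  J (fun y => w y * t y) = 0 -> bmeas a b Rm -> 0 <= eps ->
  (forall y, a < y < b -> `|Rm y| <= eps) ->
  (forall q, ppoly N x p q -> J (fun y => w y * q y) = 0 ->
     J (fun y => w y * (G t y * q y)) = J (fun y => w y * (Rm y * q y))) ->
  J (fun y => `|w y * t y|) <= Cs * eps).
Context (hG : forall q, ppoly N x p q -> J (fun y => w y * q y) = 0 ->
  J (fun y => w y * (G (fun z => sigma z - s z) y * q y)) = 0).

Lemma G_bmeas t : bmeas a b t -> [/\ bmeas a b (V1 t), bmeas a b (V2 t) & bmeas a b (G t)].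
Proof.
move=> bt; have b1 := V1_bmeas bt; have b2 := V2_bmeas bt.
by split => //; bmeas_auto.
Qed.

Lemma GB t u y : bmeas a b t -> bmeas a b u -> a < y < b ->
  G (fun z => t z - u z) y = G t y - G u y.
Proof.
move=> bt bu /andP[ay yb].
by rewrite /= V1B ?V2B ?(ltW ay) ?(ltW yb) //; ring.
Qed.

(** Sup bound of the remaining data [Rm] in units of A h^2: the primitive of E and the two V terms
    of the corrector. *)
Definition residual_const : R := `|c| * wM
  + (`|gamma| + `|c| * (b - a)) * corrector_int_const gamma.

(** The same for [R'], which also contains the V terms of [t'], bounded by stability. *)
Definition flux_const : R := (1 + `|gamma| * Cs + `|c| * ((b - a) * Cs)) * residual_const.

Lemma corrector_int_const_ge0 : 0 <= corrector_int_const gamma.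
Proof.
have wMg := ltW wM_gt0.
by rewrite mulr_ge0 // !addr_ge0 ?mulr_ge0 ?exprn_ge0 ?invr_ge0 ?(ltW wm0).
Qed.

Lemma residual_const_ge0 : 0 <= residual_const.
Proof.
have wMg := ltW wM_gt0; have := corrector_int_const_ge0 => h1.
apply: addr_ge0; apply: mulr_ge0 => //; apply: addr_ge0 => //; apply: mulr_ge0 => //.
by rewrite subr_ge0 ltW.
Qed.

(* [t - som] is the discrete flux error after subtraction of the part of
   [gamma E] that is visible to the test space. *)
Lemma discrete_flux_error :
  (forall i y, (i < N)%N -> x i < y < x i.+1 -> `|pi y - s y| <=
     corrector_const gamma * (A * h) + Cp * (1 + wM / wm) * flux_const * (A * h ^+ 2)) /\
  (forall y, a <= y <= b -> `|V1 (fun z => pi z - s z) y| <=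
     (corrector_int_const gamma + Cs * residual_const) * (A * h ^+ 2)).
Proof.
have [som [psom som0 somb Vsomb somq]] := corrector gamma.
have bsom := ppoly_bmeas hm hab psom; have bss := ppoly_bmeas hm hab ps.
have bpi := pi_bmeas; have bE := interp_bmeas; have bD := primitive_bmeas dual_primitive.
have ppi := pproj_ppoly hpi.
have h0 := mesh_size_ge0 N x; have wMg := ltW wM_gt0.
have ba0 : 0 < b - a by rewrite subr_gt0.
have Ah0 : 0 <= A * h ^+ 2 by rewrite mulr_ge0 ?exprn_ge0.
have Jpi : J (fun y => w y * pi y) = 0.
  by have := integ_proj_node bs hpi (leqnn N); case: hm => _ -> _; rewrite sig0.
have Dsig y : a < y < b -> G (fun z => sigma z - pi z) y = (sigma y - pi y) - gamma * E y - c * D y by [].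
pose t := fun y => pi y - s y.
pose t' := fun y => t y - som y.
have bt : bmeas a b t by rewrite /t; bmeas_auto.
have bt' : bmeas a b t' by rewrite /t'; bmeas_auto.
have pt' : ppoly N x p t' by apply: ppolyB => //; apply: ppolyB.
have [bV bW bG] := G_bmeas bsom.
have [bV' bW' bG'] := G_bmeas bt'.
pose Rm := fun y => c * D y + gamma * V1 som y
   + c * V2 som y.
have bR : bmeas a b Rm by rewrite /Rm; bmeas_auto.
set eps := residual_const * (A * h ^+ 2).
have S20 := corrector_int_const_ge0.
have eps0 : 0 <= eps by rewrite mulr_ge0 // residual_const_ge0.
have Rb y : a < y < b -> `|Rm y| <= eps.
  move=> /andP[ay yb]; have yab : a <= y <= b by rewrite !ltW.
  have -> : eps = `|c| * (wM * A * h * h) + `|gamma| * (corrector_int_const gamma * (A * h ^+ 2))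
     + `|c| * ((b - a) * (corrector_int_const gamma * (A * h ^+ 2))).
    by rewrite /eps /residual_const; ring.
  apply: le_trans (ler_normD _ _) _; apply: lerD; [apply: le_trans (ler_normD _ _) _; apply: lerD|]; rewrite normrM ler_wpM2l //.
  - exact: dual_bound.
  - exact: Vsomb.
  - apply: V_bound => //; first by rewrite mulr_ge0.
    by move=> z /andP[az zb]; apply: Vsomb; rewrite !ltW.
have t'0 : J (fun y => w y * t' y) = 0.
  rewrite -/(V1 t' b) /t' V1B ?lexx ?(ltW hab) // [V1 som b]som0 subr0.
  by rewrite /t V1B ?lexx ?(ltW hab) // [V1 pi b]Jpi [V1 s b]s0 subrr.
pose Ge : R -> R := G (fun z => sigma z - s z).
pose Gt' : R -> R := G t'.
have bes : bmeas a b (fun z => sigma z - s z) by bmeas_auto.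
have bsp : bmeas a b (fun z => sigma z - pi z) by bmeas_auto.
have bGe : bmeas a b Ge by have [] := G_bmeas bes.
have bGt' : bmeas a b Gt' by have [] := G_bmeas bt'.
(* Against admissible tests the first term vanishes by Galerkin orthogonality, the second by the
   projection property and the third by the choice of [som]; only [Rm] survives. *)
have GtE y : a < y < b -> Gt' y = Ge y - (sigma y - pi y) + (gamma * E y - som y) + Rm y.
  move=> yab; have e1 := @GB t som y bt bsom yab.
  have e2 := @GB (fun z => sigma z - s z) (fun z => sigma z - pi z) y bes bsp yab.
  have e3 : t = (fun y => (sigma y - s y) - (sigma y - pi y)).
    by apply/funext => z; rewrite /t; ring.
  have e4 : G t y = Ge y - (sigma y - pi y - gamma * E y - c * D y) by rewrite e3.
  have e5 : Gt' y = G t y - G som y := e1.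
  by rewrite e5 e4 /Rm; ring.
have eqn q : ppoly N x p q -> J (fun y => w y * q y) = 0 ->
    J (fun y => w y * (Gt' y * q y)) = J (fun y => w y * (Rm y * q y)).
  move=> pq q0; have bq := ppoly_bmeas hm hab pq.
  have e1 : J (fun y => w y * (Ge y * q y)) = 0 := hG pq q0.
  have e2 := somq q pq q0.
  have e3 := pproj_orth hm hab bw bs hpi pq.
  rewrite (@integ_ext _ _ _ _ (fun y => w y * (Ge y * q y)
      - w y * ((sigma y - pi y) * q y) + w y * ((gamma * E y - som y) * q y) + w y * (Rm y * q y))); last first.
    by move=> y yab; rewrite GtE //; ring.
  rewrite integD; [|bmeas_auto..].
  rewrite integD; [|bmeas_auto..].
  rewrite integB; [|bmeas_auto..].
  by rewrite e1 e2 e3 subrr !add0r.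
have AA := @hstab t' Rm eps pt' t'0 bR eps0 Rb eqn.
have bwt' : bmeas a b (fun y => w y * t' y) by bmeas_auto.
have Vt'b y : a <= y <= b -> `|V1 t' y| <= Cs * eps.
  by move=> yab; apply: le_trans (V_norm_le bwt' yab) AA.
(* Now that [V1 t'] is bounded, the lower-order terms of the operator move to the right: [t'] and
   [R'] have the same moments against mean-zero tests. *)
pose R' := fun y => Rm y + gamma * V1 t' y
   + c * V2 t' y.
have bR' : bmeas a b R' by rewrite /R'; bmeas_auto.
pose eps' := (1 + `|gamma| * Cs + `|c| * ((b - a) * Cs)) * eps.
have Ce0 : 0 <= Cs * eps by rewrite mulr_ge0.
have R'b y : a < y < b -> `|R' y| <= eps'.
  move=> /andP[ay yb]; have yab : a <= y <= b by rewrite !ltW.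
  have -> : eps' = eps + `|gamma| * (Cs * eps) + `|c| * ((b - a) * (Cs * eps)).
    by rewrite /eps'; ring.
  apply: le_trans (ler_normD _ _) _; apply: lerD; [apply: le_trans (ler_normD _ _) _; apply: lerD|]; rewrite ?normrM ?ler_wpM2l //.
  - by apply: Rb; rewrite ay.
  - exact: Vt'b.
  - apply: V_bound => // z /andP[az zb]; apply: Vt'b; by rewrite !ltW.
have eps'0 : 0 <= eps'.
  by rewrite mulr_ge0 // !addr_ge0 ?mulr_ge0 // ltW.
have wg : forall y, a < y < b -> wm <= w y by move=> y /wB /andP[].
have [P pP] := pproj_exists hm p wm0 bw wg bR'.
have ppP := pproj_ppoly pP; have bP := ppoly_bmeas hm hab ppP.
have Pb : forall i y, (i < N)%N -> x i < y < x i.+1 -> `|P y| <= Cp * eps'.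
  by apply: (pproj_norm_le bR') => // i y iN /(mesh_itv hm iN); exact: R'b.
have Jw0 := integ_w_gt0; have Jwm := integ_w_gt.
pose kap := J (fun y => w y * P y) / J w.
have CpE : 0 <= Cp * eps' by rewrite mulr_ge0.
have kapb : `|kap| <= Cp * (wM / wm) * eps'.
  rewrite /kap normrM normfV (gtr0_norm Jw0) ler_pdivrMr //.
  apply: le_trans (_ : wM * (Cp * eps') * (b - a) <= _).
    apply: (norm_integ_mesh_le hm) => //; [exact: ltW|by rewrite mulr_ge0|by bmeas_auto|].
    by move=> j z jN jz; apply: norm_wM_le (mesh_itv hm jN jz) (Pb _ _ jN jz).
  apply: le_trans (_ : Cp * (wM / wm) * eps' * (wm * (b - a)) <= _); last first.
    rewrite ler_wpM2l //; apply: mulr_ge0 => //; apply: mulr_ge0 => //.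
    by rewrite divr_ge0 // ltW.
  by rewrite le_eqVlt; apply/orP; left; apply/eqP; field; rewrite gt_eqF.
(* [z] has mean zero, so it is an admissible test, and it is orthogonal to all of these, itself
   included. Hence z = 0, and [t'] is the projection of [R'] up to a constant. *)
pose z := fun y => t' y - P y + kap.
have pz : ppoly N x p z.
  by apply: ppolyD; [exact: ppolyB|apply: ppoly_cst; exact: ltnW].
have bz := ppoly_bmeas hm hab pz.
have Jz : J (fun y => w y * z y) = 0.
  rewrite (@integ_ext _ _ _ _ (fun y => w y * t' y - w y * P y + kap * w y)); last first.
    by move=> y _; rewrite /z; ring.
  rewrite integD ?integB ?integZ; try by bmeas_auto.
  by rewrite t'0 /kap mulfVK ?gt_eqF // sub0r addrC subrr.
have zz : J (fun y => w y * (z y * z y)) = 0.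
  have e1 := eqn z pz Jz; have e2 := pproj_orth hm hab bw bR' pP pz.
  rewrite (@integ_ext _ _ _ _ (fun y => (w y * (Gt' y * z y) - w y * (Rm y * z y))
     + w y * ((R' y - P y) * z y) + kap * (w y * z y))); last first.
    by move=> y _; rewrite {1}/z /R' /Gt'; ring.
  rewrite integD; [|bmeas_auto..].
  rewrite integD; [|bmeas_auto..].
  rewrite integB; [|bmeas_auto..].
  rewrite integZ; [|bmeas_auto..].
  by rewrite e1 e2 Jz subrr mulr0 !addr0.
have z0 := ppoly_eq0 hm hab wm0 bw wg pz zz.
split=> [i y iN iy|y yab].
  rewrite (_ : pi y - s y = som y + (P y - kap)); last first.
    by have := z0 i y iN iy; rewrite /z /t' /t; lra.
  apply: le_trans (ler_normD _ _) _; apply: lerD; first exact: (somb i).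
  apply: le_trans (ler_normB _ _) _.
  have -> : Cp * (1 + wM / wm) * flux_const * (A * h ^+ 2) = Cp * eps' + Cp * (wM / wm) * eps'.
    by rewrite /eps' /flux_const /eps; ring.
  by rewrite lerD // (Pb i).
have -> : V1 (fun z => pi z - s z) y =
    V1 som y + V1 t' y.
  by rewrite -/t /t' V1B // addrC subrK.
apply: le_trans (ler_normD _ _) _; rewrite mulrDl lerD // ?Vsomb //.
by rewrite -mulrA; exact: Vt'b.
Qed.

End Discrete.

End Interpolation.

End Superconvergence.

(** * Stability and the estimate at the special points, uniform in the mesh *)

Section AbstractEstimate.
Context {R : realType}.
Implicit Types (a b s t y : R) (f g q w : R -> R).

(** Antidifferentiate the approximation of [S 1] and match the value at s: each integration gains
    one factor t - s. *)
Lemma taylor_approx s t (S : nat -> R -> R) n (M : R) : s < t ->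
  (forall j, (j < n)%N -> primitive_on s t (S j) (S j.+1)) ->
  (forall y, s < y < t -> `|S n y| <= M) ->
  exists2 Q : {poly R}, (size Q <= n)%N &
    forall y, s < y < t -> `|S 0%N y - Q.[y]| <= M * (t - s) ^+ n.
Proof.
move=> st; elim: n S => [|n IH] S hS SM.
  exists 0; first by rewrite size_poly0.
  by move=> y yst; rewrite horner0 subr0 expr0 mulr1 SM.
have [Q1 sQ1 hQ1] := IH (fun j => S j.+1) (fun j jn => hS j.+1 jn) SM.
have [Q dQ sQ] := antiderivative Q1.
exists (Q + (S 0%N s - Q.[s])%:P).
  rewrite (leq_trans (size_polyD _ _)) // geq_max (leq_trans sQ) //=.
  by rewrite (leq_trans (size_polyC_leq1 _)).
move=> y /andP[sy yt]; rewrite hornerD hornerC.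
have P0 := primitiveB (hS 0%N (ltn0Sn _)) (primitive_horner s t Q).
have K0 : 0 <= M * (t - s) ^+ n.
  by apply: le_trans (hQ1 y _); rewrite ?normr_ge0 // sy.
have bnd z : s < z < t -> `|S 1%N z - (deriv Q).[z]| <= M * (t - s) ^+ n by rewrite dQ; exact: hQ1.
have := primitive_norm_le P0 bnd (lexx _) (ltW sy) (ltW yt).
rewrite (_ : _ - (_ + _) = S 0%N y - Q.[y] - (S 0%N s - Q.[s])); last by ring.
move=> /le_trans; apply; rewrite exprSr mulrA ler_wpM2l // lerD2r ltW //.
Qed.

Lemma weighted_cauchy_schwarz a b w (t : R -> R) :
  bmeas a b w -> bmeas a b t -> (forall y, a < y < b -> 0 <= w y) -> 0 < integ a b w ->
  integ a b (fun y => `|w y * t y|) ^+ 2 <= integ a b w * integ a b (fun y => w y * (t y * t y)).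
Proof.
move=> bw bt w0 W0; set A := integ a b (fun y => `|_|); set W := integ a b w.
have bwt : bmeas a b (fun y => `|w y * t y|) by bmeas_auto.
(* Complete the square around the mean value A / W. *)
pose l := A / W.
have lW : l * W = A by rewrite mulfVK // gt_eqF.
have : 0 <= integ a b (fun y => w y * (t y * t y) - 2 * l * `|w y * t y| + l ^+ 2 * w y).
  apply: integ_ge0 => y yab; rewrite normrM (ger0_norm (w0 _ yab)).
  rewrite (_ : _ + _ = w y * (`|t y| - l) ^+ 2); first by rewrite mulr_ge0 ?sqr_ge0 ?w0.
  by rewrite sqrrB real_normK ?num_real //; ring.
rewrite integD ?integB ?integZ; try by bmeas_auto.
rewrite -/A -/W => h; have : 0 <= W * (integ a b (fun y => w y * (t y * t y)) - 2 * l * A + l ^+ 2 * W).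
  by rewrite mulr_ge0 // ltW.
by rewrite (_ : W * _ = W * integ a b (fun y => w y * (t y * t y)) - A ^+ 2); [rewrite subr_ge0|rewrite -lW; ring].
Qed.

(** The equation is tested with t itself. The gamma term is the integral of (V1 t)^2 / 2
    differentiated and vanishes; the c term becomes c times the integral of (V1 t)^2, which has the
    right sign. The weighted Cauchy-Schwarz inequality concludes. *)
Lemma coercive_stability a b w (wm wM : R) (gamma c : R) (t g : R -> R) (eps : R) : a < b ->
  bmeas a b w -> 0 < wm -> (forall y, a < y < b -> wm <= w y <= wM) -> 0 <= c ->
  bmeas a b t -> integ a b (fun y => w y * t y) = 0 -> bmeas a b g -> 0 <= eps ->
  (forall y, a < y < b -> `|g y| <= eps) ->
  integ a b (fun y => w y * ((t y - gamma * V1 a w t y - c * V2 a w t y) * t y))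
    = integ a b (fun y => w y * (g y * t y)) ->
  integ a b (fun y => `|w y * t y|) <= wM * (b - a) * eps.
Proof.
move=> ab bw wm0 wB c0 bt t0 bg e0 ge eqn.
have w0 y : a < y < b -> 0 <= w y by move=> /wB /andP[h1 _]; apply: le_trans h1; apply: ltW.
have P1 := V1_primitive bw bt; have P2 := V2_primitive bw bt.
have b1 := V1_bmeas bw bt; have b2 := V2_bmeas bw bt.
have V1b : V1 a w t b = 0 by [].
have V1a : V1 a w t a = 0 by rewrite /V1 integ_ge.
have i1 : integ a b (fun y => w y * t y * V1 a w t y) = 0.
  have := integ_by_parts (ltW ab) P1 P1; rewrite V1a V1b !mulr0 subrr sub0r.
  rewrite (@integ_ext _ a b (fun y => V1 a w t y * (w y * t y)) (fun y => w y * t y * V1 a w t y)).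
    by move=> /eqP; rewrite -addr_eq0 -mulr2n mulrn_eq0 /= => /eqP.
  by move=> y _; rewrite mulrC.
have i2 : integ a b (fun y => w y * t y * V2 a w t y) = - integ a b (fun y => V1 a w t y * V1 a w t y).
  by have := integ_by_parts (ltW ab) P1 P2; rewrite V1a V1b !mul0r subrr sub0r.
have e1 : integ a b (fun y => w y * (t y * t y)) <= integ a b (fun y => w y * (g y * t y)).
  rewrite -eqn (@integ_ext _ _ _ (fun y => w y * ((t y - gamma * V1 a w t y - c * V2 a w t y) * t y))
    (fun y => w y * (t y * t y) - gamma * (w y * t y * V1 a w t y) - c * (w y * t y * V2 a w t y))); last first.
    by move=> y _; ring.
  rewrite !integB ?integZ; try by bmeas_auto.
  rewrite i1 i2 mulr0 subr0 mulrN opprK lerDl mulr_ge0 //.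
  by apply: integ_ge0 => y _; rewrite -expr2 sqr_ge0.
set A := integ a b _.
have bwt : bmeas a b (fun y => `|w y * t y|) by bmeas_auto.
have e2 : integ a b (fun y => w y * (g y * t y)) <= eps * A.
  rewrite -integZ //; apply: le_integ; [bmeas_auto..|] => y yab.
  rewrite mulrCA (le_trans (ler_norm _)) // normrM ler_wpM2r //; exact: ge.
set W := integ a b w.
have W0 : 0 < W := integ_w_gt0 ab bw wm0 wB.
have WM : W <= wM * (b - a).
  rewrite -integ_cst ?(ltW ab) //; apply: le_integ; [bmeas_auto..|].
  by move=> y /wB /andP[].
have A0 : 0 <= A by apply: integ_ge0.
have CS : A ^+ 2 <= W * integ a b (fun y => w y * (t y * t y)).
  exact: weighted_cauchy_schwarz.
have h : A ^+ 2 <= W * (eps * A).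
  by apply: le_trans CS _; rewrite ler_wpM2l ?(ltW W0) // (le_trans e1).
apply: le_trans (_ : W * eps <= _); last by rewrite ler_wpM2r.
have [->|An0] := eqVneq A 0; first by rewrite mulr_ge0 // ltW.
have Ap : 0 < A by rewrite lt_neqAle eq_sym An0.
by rewrite -(ler_pM2r Ap) -expr2 -mulrA.
Qed.

(** The integral in the conclusion bounds [V1] of t in the sup norm. Both coercivity and the inf-sup
    condition yield this form. *)
Definition flux_stable a b N (x : nat -> R) p w (gamma c Cs : R) : Prop :=
  forall (t g : R -> R) (eps : R), ppoly N x p t ->
    integ a b (fun y => w y * t y) = 0 -> bmeas a b g -> 0 <= eps ->
    (forall y, a < y < b -> `|g y| <= eps) ->
    (forall q, ppoly N x p q -> integ a b (fun y => w y * q y) = 0 ->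
       integ a b (fun y => w y * ((t y - gamma * V1 a w t y - c * V2 a w t y) * q y))
         = integ a b (fun y => w y * (g y * q y))) ->
    integ a b (fun y => `|w y * t y|) <= Cs * eps.

(* Galerkin orthogonality of the flux error r: the test functions are the
   primitives of w * q, and two integrations by parts bring them to w * q. *)
Definition flux_orthogonal a b N (x : nat -> R) p w (gamma c : R) (r : R -> R) : Prop :=
  forall q, ppoly N x p q -> integ a b (fun y => w y * q y) = 0 ->
    integ a b (fun y => w y * ((r y - gamma * V1 a w r y - c * V2 a w r y) * q y)) = 0.

(** [Lam] is any polynomial of degree p orthogonal to lower degrees, so that one statement covers
    Legendre polynomials off the interface and generalized ones on it. The constant is fixed before
    mesh, weight and solution. *)
Theorem superconvergence (p : nat) a b (wm wM gamma c Cs : R) :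
  (2 <= p)%N -> a < b -> 0 < wm -> 0 <= Cs ->
  exists2 C : R, 0 <= C &
  forall N (x : nat -> R) w (k0 : nat) (sigma s : R -> R) (M : R),
    is_mesh a b N x -> bmeas a b w -> (forall y, a < y < b -> wm <= w y <= wM) ->
    (forall i, (i < N)%N -> i != k0 -> exists om, forall y, x i < y < x i.+1 -> w y = om) ->
    bmeas a b sigma -> integ a b (fun y => w y * sigma y) = 0 ->
    ppoly N x p s -> integ a b (fun y => w y * s y) = 0 ->
    flux_stable a b N x p w gamma c Cs ->
    flux_orthogonal a b N x p w gamma c (fun y => sigma y - s y) ->
    0 <= M ->
    (forall i, (i < N)%N -> exists2 Q : {poly R}, (size Q <= p)%N &
      forall y, x i < y < x i.+1 -> `|sigma y - Q.[y]| <= M * mesh_size N x ^+ p) ->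
    (forall i, (i < N)%N -> exists2 Q : {poly R}, (size Q <= p.+1)%N &
      forall y, x i < y < x i.+1 -> `|sigma y - Q.[y]| <= M * mesh_size N x ^+ p.+1) ->
    forall i (Lam : {poly R}), (i < N)%N -> size Lam = p.+1 ->
      (forall q : {poly R}, (size q <= p)%N ->
         integ (x i) (x i.+1) (fun y => w y * (Lam.[y] * q.[y])) = 0) ->
      (forall l, x i <= l <= x i.+1 -> integ (x i) l (fun y => w y * Lam.[y]) = 0 ->
         `|V1 a w (fun y => sigma y - s y) l| <= C * M * mesh_size N x ^+ p.+2) /\
      (forall g : R, x i < g < x i.+1 -> Lam.[g] = 0 ->
         `|sigma g - s g| <= C * M * mesh_size N x ^+ p.+1).
Proof.
move=> hp ab wm0 Cs0.
have [Cpb Cpb0 hpb] := @proj_bound R p.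
pose Cp := Cpb * (wM / wm + 1).
pose c1 := corrector_const wm wM Cp gamma.
pose c2 := Cp * (1 + wM / wm) * flux_const a b wm wM Cp gamma c Cs.
pose c3 := corrector_int_const wm wM Cp gamma + Cs * residual_const a b wm wM Cp gamma c.
pose C1 := (1 + Cp) * (1 + `|c1| + `|c2| * (b - a)).
pose C2 := (1 + Cp) * (`|wM| + `|c3|).
have ba0 : 0 < b - a by rewrite subr_gt0.
(* No weight is given yet, so the sign of wM is unknown; absolute values stand in for
   nonnegativity. *)
exists (`|C1| + `|C2|); first by rewrite addr_ge0.
move=> N x w k0 sigma s M hm bw wB wcst bs sig0 ps s0 hstab hG M0 hQp hQp1 i Lam iN sLam oLam.
have wMg := wM_gt0 ab wm0 wB.
have Cp0 : 0 <= Cp by rewrite mulr_ge0 // addr_ge0 // divr_ge0 // ltW.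
have Cp1 : 0 <= 1 + Cp by rewrite addr_ge0.
have hCp u v f pi (K : R) : a <= u -> u < v -> v <= b ->
    bmeas u v f -> (forall y, u < y < v -> `|f y| <= K) -> 0 <= K ->
    is_proj u v w p f pi -> forall y, u <= y <= v -> `|pi.[y]| <= Cp * K.
  move=> au uv vb bf fK K0 pf; apply: (hpb u v w f pi wm wM K) => //.
    exact: bmeas_sub bw.
  by move=> y /andP[uy yv]; apply: wB; rewrite (le_lt_trans au) // (lt_le_trans yv).
set h := mesh_size N x.
have h0 : 0 <= h := mesh_size_ge0 N x.
have hba : h <= b - a := mesh_size_le hm (ltW ab).
have wg : forall y, a < y < b -> wm <= w y by move=> y /wB /andP[].
have [pi hpi] := pproj_exists hm p wm0 bw wg bs.
pose A := (1 + Cp) * (M * h ^+ p).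
have A0 : 0 <= A by rewrite !mulr_ge0 // exprn_ge0.
have orth0 j : (j < N)%N -> forall q : {poly R}, (size q <= p)%N ->
    integ (x j) (x j.+1) (fun y => w y * ((0 : {poly R}).[y] * q.[y])) = 0.
  by move=> jN q _; apply: integ_eq0 => y _; rewrite horner0 mul0r mulr0.
have hA j y : (j < N)%N -> x j < y < x j.+1 -> `|sigma y - pi y| <= A.
  move=> jN jy; have [Q sQ hQ] := hQp j jN; have [r hr pir] := hpi j jN.
  rewrite pir //.
  have := @element_residual _ a b w bw p Cp hCp (x j) (x j.+1) sigma r Q 0 _
    (mesh_ge_a hm (ltnW jN)) (mesh_lt hm jN) (mesh_le_b hm jN) (bmeas_elem hm jN bs) hr _ (orth0 j jN) hQ y jy.
  by rewrite horner0 !subr0; apply.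
have [] := @discrete_flux_error _ a b N x ab hm w wm wM bw wm0 wB p k0 hp Cp Cp0 hCp
  sigma pi A bs A0 hpi hA wcst gamma c Cs Cs0 s ps s0 sig0 hstab hG.
rewrite -/c1 -/c2 -/c3 -/h => dflux dV.
have [Q sQ hQ] := hQp1 i iN; have [r hr pir] := hpi i iN.
(* Matching the coefficients of degree p leaves [Q - k *: Lam] in the range of the projection. *)
pose k := Q`_p / Lam`_p.
have sQL : (size (Q - k *: Lam)%R <= p)%N := size_sub_lead sQ sLam.
have bwi := bmeas_elem hm iN bw.
have okL (q : {poly R}) : (size q <= p)%N ->
    integ (x i) (x i.+1) (fun y => w y * ((k *: Lam).[y] * q.[y])) = 0.
  move=> sq; rewrite (@integ_ext _ _ _ _ (fun y => k * (w y * (Lam.[y] * q.[y])))); last first.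
    by move=> y _; rewrite hornerZ; ring.
  by rewrite integZ ?oLam ?mulr0 //; bmeas_auto.
have res y : x i < y < x i.+1 -> `|sigma y - pi y - k * Lam.[y]| <= (1 + Cp) * (M * h ^+ p.+1).
  move=> iy; rewrite pir // -hornerZ.
  exact: (@element_residual _ a b w bw p Cp hCp (x i) (x i.+1) sigma r Q (k *: Lam) _
    (mesh_ge_a hm (ltnW iN)) (mesh_lt hm iN) (mesh_le_b hm iN) (bmeas_elem hm iN bs) hr sQL okL hQ y iy).
have Ah : A * h = (1 + Cp) * (M * h ^+ p.+1) by rewrite /A exprSr; ring.
have Ahh : A * h ^+ 2 = (1 + Cp) * (M * h ^+ p.+2) by rewrite /A !exprSr; ring.
have bpi : bmeas a b pi := ppoly_bmeas hm ab (pproj_ppoly hpi).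
have bss := ppoly_bmeas hm ab ps.
split=> [l /andP[il li] Ll|g ig Lg]; last first.
  have -> : sigma g - s g = (sigma g - pi g) + (pi g - s g) by ring.
  apply: le_trans (ler_normD _ _) _.
  apply: le_trans (_ : C1 * (M * h ^+ p.+1) <= _); last first.
    rewrite -[leRHS]mulrA ler_wpM2r ?mulr_ge0 ?exprn_ge0 // (le_trans (ler_norm _)) // lerDl //.
  have := res g ig; rewrite Lg mulr0 subr0 => r1.
  have := dflux i g iN ig; rewrite Ah => r2.
  have r3 : c1 * ((1 + Cp) * (M * h ^+ p.+1)) <= `|c1| * ((1 + Cp) * (M * h ^+ p.+1)).
    by rewrite ler_wpM2r ?ler_norm // !mulr_ge0 // exprn_ge0.
  (* This term is of higher order; one factor h is bounded by b - a. *)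
  have r4 : c2 * (A * h ^+ 2) <= `|c2| * ((b - a) * ((1 + Cp) * (M * h ^+ p.+1))).
    apply: le_trans (_ : `|c2| * (A * h ^+ 2) <= _).
      by rewrite ler_wpM2r ?ler_norm // mulr_ge0 // exprn_ge0.
    rewrite ler_wpM2l // -Ah expr2 mulrA mulrC ler_wpM2r // mulr_ge0 //.
  have -> : C1 * (M * h ^+ p.+1) = (1 + Cp) * (M * h ^+ p.+1) + (`|c1| * ((1 + Cp) * (M * h ^+ p.+1))
     + `|c2| * ((b - a) * ((1 + Cp) * (M * h ^+ p.+1)))) by rewrite /C1; ring.
  by apply: lerD r1 _; apply: le_trans r2 _; apply: lerD.
have al : a <= l by apply: le_trans il; exact: (mesh_ge_a hm (ltnW iN)).
have lb : l <= b by apply: le_trans li _; exact: (mesh_le_b hm iN).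
have lab : a <= l <= b by rewrite al.
have -> : V1 a w (fun y => sigma y - s y) l =
    V1 a w (fun y => sigma y - pi y) l + V1 a w (fun y => pi y - s y) l.
  rewrite !(V1B bw) //; ring.
have node := @interp_node _ a b N x ab hm w bw p hp sigma pi bs hpi i (ltnW iN).
have [_ pE] := @interp_primitive _ a b N x ab hm w bw p sigma pi bs hpi.
have := pE (x i) l (mesh_ge_a hm (ltnW iN)) il lb; rewrite node subr0 => ->.
have bsub f : bmeas a b f -> bmeas (x i) l f.
  by apply: bmeas_sub => //; exact: (mesh_ge_a hm (ltnW iN)).
have bwl := bsub _ bw; have bsl := bsub _ bs; have bpl := bsub _ bpi.
(* The weighted integral of [Lam] up to l is zero, so the leading part of the error may be
   subtracted freely. *)
have -> : integ (x i) l (fun y => w y * (sigma y - pi y)) =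
    integ (x i) l (fun y => w y * (sigma y - pi y - k * Lam.[y])).
  rewrite -[RHS]addr0 -[in RHS](mulr0 k) -[in RHS]Ll -integZ; last by bmeas_auto.
  rewrite -integD; [|bmeas_auto..].
  by apply: integ_ext => y _; ring.
apply: le_trans (ler_normD _ _) _.
apply: le_trans (_ : C2 * (M * h ^+ p.+2) <= _); last first.
  have C2le : C2 <= `|C1| + `|C2| by apply: le_trans (ler_norm _) _; rewrite addrC lerDl.
  by rewrite -[leRHS]mulrA ler_wpM2r // mulr_ge0 // exprn_ge0.
have -> : C2 * (M * h ^+ p.+2) = wM * ((1 + Cp) * (M * h ^+ p.+1)) * h + `|c3| * (A * h ^+ 2).
  by rewrite Ahh /C2 (gtr0_norm wMg) [h ^+ p.+2]exprSr; ring.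
apply: lerD; last first.
  apply: le_trans (dV l lab) _.
  by rewrite ler_wpM2r ?ler_norm // mulr_ge0 // exprn_ge0.
have K0 : 0 <= wM * ((1 + Cp) * (M * h ^+ p.+1)).
  by rewrite mulr_ge0 ?(ltW wMg) // !mulr_ge0 // exprn_ge0.
apply: le_trans (_ : wM * ((1 + Cp) * (M * h ^+ p.+1)) * (l - x i) <= _).
  apply: norm_integ_le => //; first by bmeas_auto.
  move=> y /andP[iy yl]; have iyl : x i < y < x i.+1 by rewrite iy (lt_le_trans yl).
  by rewrite normrM ler_pM ?res // (norm_w_le wm0 wB) //; exact: (mesh_itv hm iN iyl).
by rewrite ler_wpM2l // (le_trans _ (mesh_size_ge x iN)) // lerD2r.
Qed.

End AbstractEstimate.

(** * Weak derivatives *)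

Section TestFunctions.
Context {R : realType}.
Implicit Types (x y s t r : R) (e f g : R -> R).

Local Notation mu := (@lebesgue_measure R).

(* The minimum of (y - x)^2 - r^2 and 0, whose square is C^1. *)
Definition bump_base x r y : R :=
  ((y - x) ^+ 2 - r ^+ 2 - `|(y - x) ^+ 2 - r ^+ 2|) / 2.

Definition bump x r y : R := bump_base x r y ^+ 2.

Definition dbump x r y : R := 4 * (y - x) * bump_base x r y.

Lemma bump_base_in x r y : 0 < r -> x - r <= y <= x + r ->
  bump_base x r y = (y - x) ^+ 2 - r ^+ 2.
Proof.
move=> r0 /andP[h1 h2]; rewrite /bump_base ler0_norm; first by field.
have : 0 <= (r - (y - x)) * (r + (y - x)) by apply: mulr_ge0; lra.
lra.
Qed.

Lemma bump_base_out x r y : 0 < r -> (y <= x - r) || (x + r <= y) -> bump_base x r y = 0.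
Proof.
move=> r0 h; rewrite /bump_base ger0_norm ?subrr ?mul0r //.
have : 0 <= ((y - x) - r) * ((y - x) + r).
  by case/orP: h => h; [apply: mulr_le0|apply: mulr_ge0]; lra.
lra.
Qed.

Lemma continuous_bump_base x r : continuous (bump_base x r).
Proof.
have cq : continuous (fun y => (y - x) ^+ 2 - r ^+ 2).
  rewrite (_ : (fun y => _) = horner (('X - x%:P) ^+ 2 - (r ^+ 2)%:P)); first exact: continuous_horner.
  by apply/funext => y; rewrite !hornerE.
move=> y; apply: cvgM; last exact: cvg_cst.
by apply: cvgB; [exact: cq|apply: cvg_norm; exact: cq].
Qed.

Lemma continuous_dbump x r : continuous (dbump x r).
Proof.
have cl : continuous (fun y => 4 * (y - x)).
  rewrite (_ : (fun y => _) = horner (4%:P * ('X - x%:P))); first exact: continuous_horner.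
  by apply/funext => y; rewrite !hornerE.
by move=> y; apply: cvgM; [exact: cl|exact: continuous_bump_base].
Qed.

Lemma continuous_bump x r : continuous (bump x r).
Proof.
move=> y; have -> : bump x r = (fun z => bump_base x r z * bump_base x r z).
  by apply/funext => z; rewrite /bump expr2.
by apply: cvgM; exact: continuous_bump_base.
Qed.

Lemma bump_primitive x r A B : 0 < r -> A <= x - r -> x + r <= B ->
  primitive_on A B (bump x r) (dbump x r).
Proof.
move=> r0 hA hB; apply: (@primitive_cat _ _ (x - r)).
  apply: primitive_ext (primitive_cst A (x - r) 0) => y /andP[_ yr].
    by rewrite /bump bump_base_out ?expr0n ?yr.
  by rewrite /dbump bump_base_out ?mulr0 ?(ltW yr).
apply: (@primitive_cat _ _ (x + r)).
  pose q : {poly R} := (('X - x%:P) ^+ 2 - (r ^+ 2)%:P) ^+ 2.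
  apply: primitive_ext (primitive_horner (x - r) (x + r) q) => y yr.
    by rewrite /bump bump_base_in // /q !hornerE.
  rewrite /dbump bump_base_in //; last by have /andP[/ltW -> /ltW ->] := yr.
  rewrite /q deriv_exp derivB derivC deriv_exp derivXsubC subr0 /= !expr1 mul1r.
  by rewrite !(hornerMn, hornerM, hornerXsubC, hornerC, horner_exp, hornerD, hornerN); ring.
apply: primitive_ext (primitive_cst (x + r) B 0) => y /andP[yr _].
  by rewrite /bump bump_base_out ?expr0n ?yr ?orbT.
by rewrite /dbump bump_base_out ?mulr0 ?(ltW yr) ?orbT.
Qed.

Lemma bump_out x r y : 0 < r -> (y <= x - r) || (x + r <= y) -> bump x r y = 0.
Proof. by move=> r0 h; rewrite /bump bump_base_out ?expr0n. Qed.

Lemma bump_ge0 x r y : 0 <= bump x r y.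
Proof. exact: sqr_ge0. Qed.

Lemma bump_le x r y : 0 < r -> bump x r y <= r ^+ 4.
Proof.
move=> r0; have r40 : 0 <= r ^+ 4 by rewrite exprn_ge0 // ltW.
have [h|h] := boolP ((y <= x - r) || (x + r <= y)); first by rewrite bump_out.
rewrite /bump bump_base_in //; last by move: h; rewrite negb_or -!ltNge => /andP[/ltW -> /ltW ->].
move: h; rewrite negb_or -!ltNge => /andP[h1 h2].
have a1 : 0 <= (r - (y - x)) * (r + (y - x)) by apply: mulr_ge0; lra.
have a2 := sqr_ge0 (y - x).
have : 0 <= (r ^+ 2 - ((y - x) ^+ 2 - r ^+ 2)) * (r ^+ 2 + ((y - x) ^+ 2 - r ^+ 2)).
  by apply: mulr_ge0; lra.
rewrite (_ : r ^+ 4 = r ^+ 2 * r ^+ 2); last by rewrite -exprD.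
lra.
Qed.

(** On the middle half, of length r, the bump is at least (3 r^2 / 4)^2. *)
Lemma integ_bump_ge x r : 0 < r -> 9 / 16 * r ^+ 5 <= integ (x - r) (x + r) (bump x r).
Proof.
move=> r0.
have bb : bmeas (x - r) (x + r) (bump x r) := primitive_bmeas (bump_primitive r0 (lexx _) (lexx _)).
have h1 : x - r <= x - r / 2 by lra.
have h2 : x - r / 2 <= x + r / 2 by lra.
have h3 : x + r / 2 <= x + r by lra.
rewrite (integ_cat h1) //; last by lra.
rewrite (integ_cat h2) //; last exact: (bmeas_sub h1 _ bb).
have p1 : 0 <= integ (x - r) (x - r / 2) (bump x r) by apply: integ_ge0 => y _; exact: bump_ge0.
have p3 : 0 <= integ (x + r / 2) (x + r) (bump x r) by apply: integ_ge0 => y _; exact: bump_ge0.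
have : integ (x - r / 2) (x + r / 2) (cst (9 / 16 * r ^+ 4)) <= integ (x - r / 2) (x + r / 2) (bump x r).
  apply: le_integ; [exact: bmeas_cst|exact: (bmeas_sub h1 h3 bb)|].
  move=> y /andP[y1 y2] /=; rewrite /bump bump_base_in //; last by apply/andP; split; lra.
  have a1 : 0 <= (r / 2 - (y - x)) * (r / 2 + (y - x)) by apply: mulr_ge0; lra.
  rewrite -sqrrN (_ : 9 / 16 * r ^+ 4 = (3 / 4 * r ^+ 2) ^+ 2); last by field.
  have r20 := sqr_ge0 r.
  by rewrite ler_sqr ?nnegrE; lra.
rewrite integ_cst // (_ : _ * (_ - _) = 9 / 16 * r ^+ 5); last by field.
lra.
Qed.

(** Primitives are required on all larger intervals because [C1c] asks for differentiability on the
    whole line. *)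
Lemma C1c_intro s t s' t' (F psi : R -> R) : s < s' -> t' < t -> continuous psi ->
  (forall A B, A <= s -> t <= B -> primitive_on A B F psi) ->
  (forall y, (y <= s') || (t' <= y) -> F y = 0) ->
  C1c `]s, t[ F /\ derive1 F = psi.
Proof.
move=> ss' t't cpsi prim out.
have dF y : is_derive y 1 F (psi y).
  have h1 : Num.min y s <= s by rewrite ge_min lexx orbT.
  have h2 : Num.min y s <= y by rewrite ge_min lexx.
  have h3 : t <= Num.max y t by rewrite le_max lexx orbT.
  have h4 : y <= Num.max y t by rewrite le_max lexx.
  move: (Num.min y s) (Num.max y t) h1 h2 h3 h4 => A B h1 h2 h3 h4.
  have hA : A - 1 <= s by lra.
  have hB : t <= B + 1 by lra.
  have hy : A - 1 < y < B + 1 by apply/andP; split; lra.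
  exact: (primitive_derive (prim _ _ hA hB) hy (cpsi y)).
have e : derive1 F = psi by apply/funext => y; rewrite derive1E; exact: derive_val.
split=> //; split=> [y||]; [exact: ex_derive|by rewrite e|].
exists `[s', t']; split; first exact: segment_compact.
  move=> y /=; rewrite !in_itv /= => /andP[h1 h2].
  by rewrite (lt_le_trans ss') // (le_lt_trans h2).
move=> y yK; apply: out; apply: contraT; rewrite negb_or -!ltNge => /andP[h1 h2].
by case: yK; rewrite /= in_itv /= !ltW.
Qed.

Lemma bump_C1c x r s t : 0 < r -> s < x - r -> x + r < t -> C1c `]s, t[ (bump x r).
Proof.
move=> r0 sx xt; have [] // := C1c_intro sx xt (@continuous_dbump x r) _ (fun y => bump_out r0).
by move=> A B As tB; apply: (bump_primitive r0); lra.
Qed.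

Lemma integrable_bmeasM s t f g : mu.-integrable `]s, t[ (EFin \o f) -> bmeas s t g ->
  mu.-integrable `]s, t[ (EFin \o (fun y => f y * g y)).
Proof.
move=> intf [mg [K gK]].
have mf : measurable_fun `]s, t[ f by apply/measurable_EFinP; case/integrableP: intf.
apply: (@le_integrable _ _ _ mu _ _ _ (fun y => (`|K| * f y)%:E)) => //.
- by apply/measurable_EFinP; exact: measurable_funM.
- move=> y /oo_itvP sy /=; rewrite lee_fin !normrM normr_id mulrC ler_wpM2r //.
  by rewrite (le_trans (gK y sy)) // ler_norm.
- rewrite (_ : (fun y => _) = (fun y => (`|K|%:E * (EFin \o f) y)%E)); last by apply/funext => y; rewrite EFinM.
  exact: integrableZl.
Qed.

Lemma lebesgue_pt_eq0 (F : R -> R) x (d : R) : mu.-integrable setT (EFin \o F) ->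
  lebesgue_pt F x -> 0 < d ->
  (forall r, 0 < r < d -> integ (x - r) (x + r) (fun y => F y * bump x r y) = 0) -> F x = 0.
Proof.
move=> intF /fine_cvgP [dfin /cvgrPdist_lt dcv] d0 hF.
apply/eqP; apply: contraT => Fx0.
(* With this threshold the deviation of F from [F x] contributes less than |F x| r^5 / 2, whereas
   [F x] times the bump contributes at least 9/16 |F x| r^5. *)
have e0 : 0 < `|F x| / 4 by rewrite divr_gt0 // normr_gt0.
have /filter_ex [r [[[r0 rd] fin] hr]] : \forall r \near 0^'+,
    ((0 < r /\ r < d) /\ davg F x r \is a fin_num) /\ `|0 - fine (davg F x r)| < `|F x| / 4.
  apply: filterI; last exact: dcv.
  apply: filterI => //; apply: filterI; first exact: nbhs_right_gt.
  exact: nbhs_right_lt.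
have xr : x - r <= x + r by lra.
have intFr : mu.-integrable `]x - r, x + r[ (EFin \o F) by exact: (integrableS _ _ _ intF).
have bc : bmeas (x - r) (x + r) (cst (F x)) by exact: bmeas_cst.
have intD : mu.-integrable `]x - r, x + r[ (EFin \o (fun y => F y - F x)).
  have /= := @integrableB _ _ _ mu _ _ _ _ intFr (bmeas_integrable bc); exact.
have intN : mu.-integrable `]x - r, x + r[ (EFin \o (fun y => `|F y - F x|)).
  exact: (integrable_norm intD).
have small : integ (x - r) (x + r) (fun y => `|F y - F x|) < `|F x| / 4 * (r * 2).
  move: hr; rewrite sub0r normrN /davg /iavg ball_itv lebesgue_measure_itv /= lte_fin.
  rewrite ifT; last by lra.
  rewrite -EFinD (_ : (x + r + - (x - r)) = r * 2); last by ring.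
  have -> : (\int[mu]_(y in `](x - r)%R, (x + r)%R[) `|(center (F x) \o F) y|%:E =
      (integ (x - r)%R (x + r)%R (fun y => `|F y - F x|%R))%:E)%E.
    by rewrite /integ /Rintegral fineK // integrable_fin_num.
  have I0 : 0 <= integ (x - r) (x + r) (fun y => `|F y - F x|) by apply: integ_ge0.
  move: (integ _ _ _) I0 => I I0; have r2 : 0 < r * 2 by rewrite mulr_gt0.
  rewrite inver gt_eqF // -EFinM /= ger0_norm; last by rewrite mulr_ge0 ?invr_ge0 ?(ltW r2).
  by rewrite ltr_pdivrMl // mulrC.
have bb : bmeas (x - r) (x + r) (bump x r) := primitive_bmeas (bump_primitive r0 (lexx _) (lexx _)).
have := hF r; rewrite r0 rd => /(_ isT).
have -> : integ (x - r) (x + r) (fun y => F y * bump x r y) =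
   integ (x - r) (x + r) (fun y => (F y - F x) * bump x r y) + F x * integ (x - r) (x + r) (bump x r).
  rewrite -integZ // /integ -RintegralD //; last 2 first.
  - exact: integrable_bmeasM.
  - by apply: bmeas_integrable; bmeas_auto.
  by apply: eq_Rintegral => y _; ring.
have h1 : `|integ (x - r) (x + r) (fun y => (F y - F x) * bump x r y)| <= r ^+ 4 * integ (x - r) (x + r) (fun y => `|F y - F x|).
  apply: le_trans (le_normr_Rintegral _ _) _ => //; first exact: integrable_bmeasM.
  rewrite /integ -RintegralZl //; apply: le_Rintegral => //.
  - by apply: integrable_norm; exact: integrable_bmeasM.
  - rewrite (_ : (EFin \o _) = (fun y => ((r ^+ 4)%:E * (EFin \o (fun y => `|F y - F x|%R)) y)%E)); last by apply/funext => y; rewrite /= EFinM.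
    exact: integrableZl.
  - by move=> y _; rewrite normrM mulrC ler_wpM2r // ger0_norm ?bump_ge0 ?bump_le.
have h2 := integ_bump_ge x r0.
move=> /eqP; rewrite addr_eq0 => /eqP h3.
move: h1; rewrite h3 normrN normrM [`|integ _ _ _|]ger0_norm; last first.
  by apply: integ_ge0 => y _; exact: bump_ge0.
have r40 : 0 < r ^+ 4 by rewrite exprn_gt0.
have k1 : `|F x| * (9 / 16 * r ^+ 5) <= `|F x| * integ (x - r) (x + r) (bump x r) by rewrite ler_wpM2l.
have k2 : r ^+ 4 * integ (x - r) (x + r) (fun y => `|F y - F x|) < r ^+ 4 * (`|F x| / 4 * (r * 2)).
  by rewrite ltr_pM2l.
move=> k3; have := le_lt_trans (le_trans k1 k3) k2.
rewrite (_ : r ^+ 4 * _ = `|F x| * r ^+ 5 / 2); last by field.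
have k4 : 0 < `|F x| * r ^+ 5 by rewrite mulr_gt0 ?normr_gt0 // exprn_gt0.
lra.
Qed.

(* The Lebesgue points of all truncations of e to compact subintervals are zeros
   of e. *)
Lemma weak_eq0 e s t : locally_integrable `]s, t[ e ->
  (forall x r, 0 < r -> s < x - r -> x + r < t ->
     integ s t (fun y => e y * bump x r y) = 0) ->
  {ae mu, forall y, s < y < t -> e y = 0}.
Proof.
move=> [me _ inte] he.
pose K (n : nat) : set R := `[s + n.+1%:R^-1, t - n.+1%:R^-1].
have Kst n : K n `<=` `]s, t[.
  move=> y /=; rewrite !in_itv /= => /andP[]; rewrite !bnd_simp => h1 h2.
  have n0 : 0 < n.+1%:R^-1 :> R by rewrite invr_gt0.
  move: n0 h1 h2; move: (n.+1%:R^-1) => q n0 h1 h2; apply/andP; split; lra.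
have intK n : mu.-integrable setT (EFin \o (e \_ (K n))).
  rewrite -restrict_EFin; apply/(integrable_mkcond _ _).1 => //.
    exact: measurable_itv.
  apply/integrableP; split.
    by apply/measurable_EFinP; apply: measurable_funS me => //; exact: Kst.
  by apply: inte; [exact: Kst|exact: segment_compact].
have leb n : {ae mu, forall y, lebesgue_pt (e \_ (K n)) y}.
  apply: lebesgue_differentiation; apply: open_integrable_locally => //; exact: openT.
suff key (y : R) : (forall n, lebesgue_pt (e \_ (K n)) y) -> s < y < t -> e y = 0.
  have lebe : {ae mu, forall y, forall n, lebesgue_pt (e \_ (K n)) y} by apply/ae_foralln.
  by apply: (negligibleS _ lebe) => y /= ny hy; apply: ny; exact: key.
move=> hy /andP[sy yt].
(* Half the distance from y to the ends: for 1/(n+1) < m and r < m the bump around y is supported in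
   [K n], where the truncation equals e. *)
pose m := Num.min (y - s) (t - y) / 2.
have m0 : 0 < m by rewrite divr_gt0 // lt_min !subr_gt0 sy yt.
have [m1 m2] : m * 2 <= y - s /\ m * 2 <= t - y.
  by rewrite mulfVK //; split; rewrite ge_min lexx ?orbT.
have [n nm] : exists n : nat, n.+1%:R^-1 < m.
  have := archi_boundP (ltW (_ : 0 < m^-1)); rewrite invr_gt0 m0 => /(_ isT) h.
  exists (Num.bound m^-1); rewrite -[ltRHS]invrK ltf_pV2 ?posrE ?invr_gt0 //.
  by rewrite (lt_trans h) // ltr_nat.
have Kin z : s + n.+1%:R^-1 <= z <= t - n.+1%:R^-1 -> z \in K n.
  by move=> h; rewrite inE /K /= in_itv.
have Ky : (e \_ (K n)) y = e y.
  rewrite patchE Kin //; move: nm; move: (n.+1%:R^-1) => q nm.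
  by apply/andP; split; lra.
rewrite -Ky; apply: (lebesgue_pt_eq0 (intK n) (hy n) m0) => r /andP[r0 rm].
have sr : s < y - r by lra.
have rt : y + r < t by lra.
rewrite -[RHS](he _ _ r0 sr rt) /integ.
rewrite Rintegral_mkcond [RHS]Rintegral_mkcond; apply: eq_Rintegral => z _.
rewrite [LHS]patchE [RHS]patchE.
have [/andP[z1 z2]|nz] := boolP (y - r < z < y + r).
  rewrite mem_set; last by apply/oo_itvP; rewrite z1.
  rewrite mem_set; last by apply/oo_itvP; rewrite (lt_trans sr z1) (lt_trans z2 rt).
  rewrite patchE Kin //; move: nm; move: (n.+1%:R^-1) => q nm.
  by apply/andP; split; lra.
rewrite memNset; last by move=> /oo_itvP; apply/negP.
by case: ifP => // _; rewrite bump_out ?mulr0 //; move: nz; rewrite negb_and -!leNgt.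
Qed.

End TestFunctions.

(** * From weak derivatives to chains of classical primitives *)

Section WeakDerivatives.
Context {R : realType}.
Implicit Types (x y z s t : R) (f g v D : R -> R).

Local Notation mu := (@lebesgue_measure R).

Definition ae_oo s t (P : R -> Prop) : Prop := {ae mu, forall y, s < y < t -> P y}.

Lemma ae_oo_mono2 s t (P Q S : R -> Prop) : (forall y, s < y < t -> P y -> Q y -> S y) ->
  ae_oo s t P -> ae_oo s t Q -> ae_oo s t S.
Proof.
move=> PQS aP aQ; apply: (negligibleS _ (negligibleU aP aQ)) => y /= nS.
apply: contrapT => /not_orP [/contrapT Py /contrapT Qy]; apply: nS => sty.
exact: PQS (Py sty) (Qy sty).
Qed.

Lemma ae_oo_true s t (P : R -> Prop) : (forall y, s < y < t -> P y) -> ae_oo s t P.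
Proof.
by move=> hP; apply: aeW => y; exact: hP.
Qed.

Lemma ae_oo_mono s t (P S : R -> Prop) : (forall y, s < y < t -> P y -> S y) ->
  ae_oo s t P -> ae_oo s t S.
Proof. by move=> PS aP; apply: (ae_oo_mono2 _ aP aP) => y sty Py _; exact: PS. Qed.

Lemma integ_ae s t f g : measurable_fun `]s, t[ f -> measurable_fun `]s, t[ g ->
  ae_oo s t (fun y => f y = g y) -> integ s t f = integ s t g.
Proof.
move=> mf mg fg; congr fine; apply: ae_eq_integral => //.
- exact/measurable_EFinP.
- exact/measurable_EFinP.
by apply: (negligibleS _ fg) => y /= h h'; apply: h => /oo_itvP sty; rewrite h'.
Qed.

Lemma primitive_ae s t F f g : primitive_on s t F f -> bmeas s t g ->
  ae_oo s t (fun y => f y = g y) -> primitive_on s t F g.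
Proof.
move=> [bf Ff] bg fg; split => // x y sx xy yt; rewrite Ff //.
apply: integ_ae; [by case: (bmeas_sub sx yt bf)|by case: (bmeas_sub sx yt bg)|].
apply: (negligibleS _ fg) => z /= h h'; apply: h => /andP[xz zy]; apply: h'.
by rewrite (le_lt_trans sx) // (lt_le_trans zy).
Qed.

Lemma C1c_primitive_on s t (th : R -> R) : C1c `]s, t[ th -> primitive_on s t th (derive1 th).
Proof.
move=> [dth cth _]; split.
  by apply: bmeas_continuous; apply: continuous_subspaceT.
move=> x y _ + _; rewrite le_eqVlt => /predU1P[->|xy]; first by rewrite subrr integ_ge.
have cy : continuous th by move=> z; apply: differentiable_continuous; exact/derivable1_diffP.
have mth : measurable_fun setT (derive1 th) by exact: continuous_measurable_fun.
have bth : bmeas x y (derive1 th) by apply: bmeas_continuous; apply: continuous_subspaceT.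
have := @continuous_FTC2 _ (derive1 th) th x y xy.
have -> : (\int[mu]_(x0 in `[x, y]) ((derive1 th) x0)%:E = (integ x y (derive1 th))%:E)%E.
  rewrite /integ /Rintegral fineK; last exact: (integrable_fin_num _ (bmeas_integrable bth)).
  rewrite integral_itv_obnd_cbnd; last by apply/measurable_EFinP; case: bth.
  by rewrite integral_itv_bndo_bndc //; apply/measurable_EFinP; exact: measurable_funTS.
move=> ftc; apply/esym/EFin_inj; rewrite EFinB; apply: ftc => //.
- exact: continuous_subspaceT.
- split; first by move=> z _; exact: dth.
    by apply: cvg_at_right_filter; exact: cy.
  by apply: cvg_at_left_filter; exact: cy.
Qed.

Lemma C1c_bound s t (th : R -> R) : s < t -> C1c `]s, t[ th -> th s = 0 /\ th t = 0.
Proof.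
move=> st [_ _ [K [_ Kst th0]]]; split; apply: th0 => /Kst /oo_itvP /andP[].
  by rewrite ltxx.
by move=> _; rewrite ltxx.
Qed.

Lemma locally_integrable_bmeas s t f : bmeas s t f -> locally_integrable `]s, t[ f.
Proof.
move=> bf; apply: open_integrable_locally; first exact: interval_open.
exact: bmeas_integrable.
Qed.

Lemma primitive_weak_deriv s t F f : s < t -> primitive_on s t F f -> is_weak_deriv `]s, t[ F f.
Proof.
move=> st Ff; split; [exact/locally_integrable_bmeas/primitive_bmeas/Ff|
  exact/locally_integrable_bmeas/primitive_bmeasr/Ff|] => th cth.
have [ths tht] := C1c_bound st cth.
have := integ_by_parts (ltW st) Ff (C1c_primitive_on cth).
by rewrite ths tht !mulr0 subrr sub0r => /esym /eqP; rewrite eqr_oppLR => /eqP.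
Qed.

(** Mean zero is what makes the primitive vanish again to the right of the support of psi. *)
Lemma C1c_primitive s t s' t' (psi : R -> R) : s < s' -> s' <= t' -> t' < t -> continuous psi ->
  (forall y, (y <= s') || (t' <= y) -> psi y = 0) -> integ s t psi = 0 ->
  C1c `]s, t[ (fun y => integ s y psi) /\ derive1 (fun y => integ s y psi) = psi.
Proof.
move=> ss' st' t't cpsi psi0 int0.
have bpsi x y : bmeas x y psi by apply: bmeas_continuous; apply: continuous_subspaceT.
have zero x y : (y <= s') || (t' <= x) -> integ x y psi = 0.
  move=> h; apply: integ_eq0 => z /andP[xz zy].
  by apply: psi0; case/orP: h => h; apply/orP; [left|right]; lra.
apply: (C1c_intro ss' t't cpsi) => [A B As tB|y].
  apply: (@primitive_cat _ _ s); last exact: primitive_integ.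
  apply: primitive_ext (primitive_cst A s 0) => y /andP[_ ys].
    by rewrite /= integ_ge.
  by rewrite /= psi0 // (le_trans (ltW ys)) // ltW.
case/orP => h; first by rewrite zero ?h.
have sy : s <= y by lra.
have [yt|ty] := leP y t.
  by have := int0; rewrite (@integ_cat _ s y t) // (@zero y t) ?addr0 ?h ?orbT.
rewrite (@integ_cat _ s t y) ?int0 ?add0r ?zero ?(ltW t't) ?orbT //; lra.
Qed.

(* du Bois-Reymond: subtracting a primitive of g leaves a function that is
   orthogonal to all derivatives of test functions, that is, to all bumps of
   mean zero after correction by a fixed bump. *)
Lemma weak_deriv_primitive s t f g : s < t -> bmeas s t f -> bmeas s t g ->
  (forall th, C1c `]s, t[%classic th ->
     integ s t (fun y => f y * derive1 th y) = - integ s t (fun y => g y * th y)) ->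
  exists k : R, ae_oo s t (fun y => f y = k + integ s y g).
Proof.
move=> st bf bg hfg.
pose e0 y := f y - integ s y g.
have pG := primitive_integ bg; have bG := primitive_bmeas pG.
have be0 : bmeas s t e0 by rewrite /e0; bmeas_auto.
have he0 th : C1c `]s, t[%classic th -> integ s t (fun y => e0 y * derive1 th y) = 0.
  move=> cth; have pth := C1c_primitive_on cth; have bdth := primitive_bmeasr pth.
  have bth := primitive_bmeas pth; have [ths tht] := C1c_bound st cth.
  rewrite (@integ_ext _ _ _ _ (fun y => f y * derive1 th y - integ s y g * derive1 th y)); last first.
    by move=> y _; rewrite /e0 mulrBl.
  rewrite integB; [|bmeas_auto..].
  rewrite hfg // (integ_by_parts (ltW st) pG pth) ths tht !mulr0 subrr sub0r.
  by rewrite addrC subrr.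
pose c0 := (s + t) / 2; pose r0 := (t - s) / 4.
have r00 : 0 < r0 by rewrite divr_gt0 // subr_gt0.
have sc : s < c0 - r0 by rewrite /c0 /r0; lra.
have ct : c0 + r0 < t by rewrite /c0 /r0; lra.
pose th0 := bump c0 r0.
have bb x r : bmeas s t (bump x r) by apply: bmeas_continuous; apply: continuous_subspaceT; exact: continuous_bump.
have I0 : 0 < integ s t th0.
  have b1 := bb c0 r0.
  rewrite (@integ_cat _ s (c0 - r0) t) //; [|lra..].
  have b2 := bmeas_sub (ltW sc) (lexx _) b1.
  rewrite (@integ_cat _ (c0 - r0) (c0 + r0) t) //; [|lra..].
  have p1 : 0 <= integ s (c0 - r0) th0 by apply: integ_ge0 => y _; exact: bump_ge0.
  have p2 : 0 <= integ (c0 + r0) t th0 by apply: integ_ge0 => y _; exact: bump_ge0.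
  have p3 := integ_bump_ge c0 r00.
  have p4 : 0 < 9 / 16 * r0 ^+ 5 by rewrite mulr_gt0 ?exprn_gt0 // divr_gt0.
  by rewrite /th0 in p1 p2 *; lra.
(* The mean of [e0] with respect to [th0]. Testing with [psi] shows that every other bump gives the
   same mean. *)
pose k := integ s t (fun y => e0 y * th0 y) / integ s t th0.
exists k.
suff : ae_oo s t (fun y => e0 y - k = 0).
  by apply: ae_oo_mono => y _; rewrite /e0 => h; lra.
apply: weak_eq0; first by apply: locally_integrable_bmeas; bmeas_auto.
move=> x r r1 sx xt.
pose c := integ s t (bump x r) / integ s t th0.
pose psi y := bump x r y - c * th0 y.
have b1 := bb x r; have b2 : bmeas s t th0 := bb c0 r0.
have cpsi : continuous psi.
  move=> y; apply: cvgB; first exact: continuous_bump.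
  by apply: cvgM; [exact: cvg_cst|exact: continuous_bump].
have psi0 : integ s t psi = 0.
  by rewrite integB ?integZ; try bmeas_auto; rewrite mulfVK ?subrr // gt_eqF.
pose s' := Num.min (x - r) (c0 - r0); pose t' := Num.max (x + r) (c0 + r0).
have ss' : s < s' by rewrite lt_min sx.
have t't : t' < t by rewrite gt_max xt.
have h1 : s' <= x - r by rewrite ge_min lexx.
have h2 : s' <= c0 - r0 by rewrite ge_min lexx orbT.
have h3 : x + r <= t' by rewrite le_max lexx.
have h4 : c0 + r0 <= t' by rewrite le_max lexx orbT.
have st' : s' <= t' by lra.
have outpsi y : (y <= s') || (t' <= y) -> psi y = 0.
  move=> h; rewrite /psi /th0 !bump_out ?mulr0 ?subrr //.
    by case/orP: h => h; apply/orP; [left|right]; lra.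
  by case/orP: h => h; apply/orP; [left|right]; lra.
have [cC dC] := C1c_primitive ss' st' t't cpsi outpsi psi0.
have := he0 _ cC; rewrite dC.
have bpsi : bmeas s t psi by rewrite /psi; bmeas_auto.
rewrite (@integ_ext _ _ _ _ (fun y => e0 y * bump x r y - c * (e0 y * th0 y))); last first.
  by move=> y _; rewrite /psi; ring.
rewrite integB ?integZ; try by bmeas_auto.
move=> /subr0_eq h.
rewrite (@integ_ext _ _ _ _ (fun y => e0 y * bump x r y - k * bump x r y)); last first.
  by move=> y _; rewrite mulrBl.
rewrite integB ?integZ; try by bmeas_auto.
by rewrite h /k /c; field; rewrite gt_eqF.
Qed.

Lemma within_continuous_eq0 s t (h : R -> R) : s < t -> {within `[s, t], continuous h} ->
  (forall y, s < y < t -> h y = 0) -> forall y, s <= y <= t -> h y = 0.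
Proof.
move=> st /(continuous_within_itvP _ st) [_ hs ht] h0 y /andP[].
rewrite le_eqVlt => /predU1P[<- _|sy].
  apply/esym; apply: (cvg_unique _ _ hs) => //; apply: cvg_near_cst.
  near=> z; apply: h0; apply/andP; split; near: z; [exact: nbhs_right_gt|exact: nbhs_right_lt].
rewrite le_eqVlt => /predU1P[->|yt]; last by rewrite h0 ?sy.
apply/esym; apply: (cvg_unique _ _ ht) => //; apply: cvg_near_cst.
near=> z; apply: h0; apply/andP; split; near: z; [exact: nbhs_left_gt|exact: nbhs_left_lt].
Unshelve. all: by end_near.
Qed.

Lemma continuous_ae_eq0 s t (h : R -> R) : s < t -> {within `[s, t], continuous h} ->
  ae_oo s t (fun y => h y = 0) -> forall y, s <= y <= t -> h y = 0.
Proof.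
move=> st ch ah; apply: (within_continuous_eq0 st ch); apply: (integ_sqr_eq0 st ch).
have bh := bmeas_continuous ch.
rewrite -[RHS](_ : integ s t (cst 0) = 0); last by rewrite integ_cst ?mul0r ?ltW.
apply: integ_ae => //; last by apply: ae_oo_mono ah => y _ ->; rewrite expr0n.
by have [] : bmeas s t (fun y => h y * h y) by bmeas_auto.
Qed.

Lemma primitive_ae_le s t D d (M : R) : s < t -> primitive_on s t D d ->
  ae_oo s t (fun y => `|D y| <= M) -> forall y, s <= y <= t -> `|D y| <= M.
Proof.
move=> st pD DM y yst; have cD := primitive_continuous pD.
(* [z + |z|] is twice the positive part of z, so an almost-everywhere inequality becomes an equation
   for a continuous function. *)
pose z y := `|D y| - M.
have cz : {within `[s, t], continuous z}.
  by move=> u; apply: cvgB; [apply: cvg_norm; exact: cD|exact: cvg_cst].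
have ch : {within `[s, t], continuous (fun y => z y + `|z y|)}.
  by move=> u; apply: cvgD; [exact: cz|apply: cvg_norm; exact: cz].
have : z y + `|z y| = 0.
  apply: (continuous_ae_eq0 st ch _ yst); apply: ae_oo_mono DM => u _ uM.
  by rewrite ler0_norm ?subrr // subr_le0.
have := normr_ge0 (z y); rewrite /z; lra.
Qed.

Lemma primitive_extend s t v (F : R -> R) f : s < t -> {within `[s, t], continuous v} ->
  primitive_on s t F f -> (forall y, s < y < t -> v y = F y) -> primitive_on s t v f.
Proof.
move=> st cv pF vF; apply: (primitive_ext _ _ pF) => // y yst.
have cF := primitive_continuous pF.
have cd : {within `[s, t], continuous (fun y => v y - F y)}.
  by move=> z; apply: continuousB; [exact: cv|exact: cF].
apply/esym/subr0_eq.
by apply: (within_continuous_eq0 st cd _ yst) => z zst; rewrite vF // subrr.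
Qed.

(** Weak derivatives are bounded almost everywhere, whereas [bmeas] wants a bound at every point;
    truncation at the norm changes them on a null set only. *)
Definition clip (M : R) f y : R := Num.max (- M) (Num.min M (f y)).

Lemma clip_bmeas s t M f : measurable_fun `]s, t[ f -> bmeas s t (clip M f).
Proof.
move=> mf; split; first by apply: measurable_maxr => //; exact: measurable_minr.
exists `|M| => y _; rewrite /clip ler_norml.
have hM := ler_norm (- M); rewrite normrN in hM.
by rewrite le_max ge_max ge_min lerN2 ler_norm hM.
Qed.

Lemma clip_le M f y : 0 <= M -> `|clip M f y| <= M.
Proof.
move=> M0; rewrite /clip ler_norml.
rewrite le_max ge_max ge_min !lexx /= andbT; lra.
Qed.

Lemma clip_id M f y : `|f y| <= M -> clip M f y = f y.
Proof.
rewrite ler_norml /clip => /andP[h1 h2].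
by rewrite min_r // max_r.
Qed.

Lemma sobolev_norm_ae s t m v (M : R) : (sobolev_norm_infty `]s, t[ m v <= M%:E)%E ->
  0 <= M /\ forall j, (j <= m)%N -> ae_oo s t (fun y => `|weak_derivn `]s, t[ j v y| <= M).
Proof.
move=> /bigmax_leP [M0 hM]; split; first by rewrite lee_fin in M0.
move=> j jm; have := hM (Ordinal (jm : (j < m.+1)%N)) isT.
(* The norm at infinity is the essential supremum only over a space of positive measure, which the
   line is. *)
rewrite /= unlock ifT; last first.
  by have := lebesgue_measure_itv (`]-oo, +oo[%R : interval R); rewrite set_itvNyy /= => ->; rewrite ?ltNyy ?ltNyr ?ltry ?lt0y ?ltry.
move=> /ess_sup_inf.ess_supP h; apply: (negligibleS _ h) => y /= ny hy; apply: ny => sty.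
by move: hy; rewrite patchE mem_set ?lee_fin //; apply/oo_itvP.
Qed.

(** Each weak derivative agrees almost everywhere with a constant plus the integral of the next one.
    These continuous representatives form the chain, and v, being continuous, equals the first of
    them everywhere. *)
Theorem sobolev_classical s t m v (M : R) : s < t -> {within `[s, t], continuous v} ->
  sobolev `]s, t[%classic m.+1 +oo%E v -> (sobolev_norm_infty `]s, t[ m.+1 v <= M%:E)%E ->
  exists D : nat -> R -> R,
    [/\ forall j, (j <= m)%N -> primitive_on s t (D j) (D j.+1),
        forall j y, (j <= m.+1)%N -> s <= y <= t -> `|D j y| <= M &
        forall y, s <= y <= t -> v y = D 0%N y].
Proof.
move=> st cv [wd lq] /sobolev_norm_ae [M0 aeM].
pose g j := weak_derivn `]s, t[%classic j v; pose c j := clip M (g j).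
have mg j : (j <= m.+1)%N -> measurable_fun `]s, t[ (g j) by move=> /lq [].
have bc j : (j <= m.+1)%N -> bmeas s t (c j) by move=> jm; apply: clip_bmeas; exact: mg.
have gc j : (j <= m.+1)%N -> ae_oo s t (fun y => g j y = c j y).
  by move=> /aeM; apply: ae_oo_mono => y _ h; rewrite /c clip_id.
have [k hk] : exists k : nat -> R, forall j, (j <= m)%N ->
    ae_oo s t (fun y => c j y = k j + integ s y (c j.+1)).
  suff : forall j, exists k, (j <= m)%N -> ae_oo s t (fun y => c j y = k + integ s y (c j.+1)).
    by move=> /choice [k hk]; exists k.
  move=> j; case: (leqP j m) => jm; last by exists 0.
  have [k hk] : exists k, ae_oo s t (fun y => c j y = k + integ s y (c j.+1)); last by exists k.
  apply: weak_deriv_primitive => //; [exact/bc/leqW|exact: bc|] => th cth.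
  have [_ _ /(_ th cth)] := wd j jm.
  have [mdth _] := primitive_bmeasr (C1c_primitive_on cth).
  have [mth _] := primitive_bmeas (C1c_primitive_on cth).
  have e i (u : R -> R) : (i <= m.+1)%N -> measurable_fun `]s, t[ u ->
      integ s t (fun y => g i y * u y) = integ s t (fun y => c i y * u y).
    move=> im mU; have [mc _] := bc i im.
    apply: integ_ae; [exact: (measurable_funM (mg i im) mU)|exact: (measurable_funM mc mU)|].
    by apply: ae_oo_mono (gc i im) => y _ ->.
  by rewrite -(e j _ (leqW jm) mdth) -(e j.+1 _ jm mth).
(* The derivative of order m + 1 has no continuous representative, so the truncation itself ends the
   chain. *)
pose D j := if (j <= m)%N then (fun y => k j + integ s y (c j.+1)) else c j.
have cD j : (j <= m.+1)%N -> ae_oo s t (fun y => c j y = D j y).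
  move=> jm; rewrite /D; case: ifP => [/hk //|_]; exact: ae_oo_true.
have pD0 j : (j <= m)%N -> primitive_on s t (D j) (c j.+1).
  move=> jm; rewrite /D jm.
  apply: primitive_ext (primitiveD (primitive_cst s t (k j)) (primitive_integ (bc j.+1 jm))) => y _ //.
  by rewrite add0r.
have bD j : (j <= m.+1)%N -> bmeas s t (D j).
  rewrite leq_eqVlt => /predU1P[->|jm]; last exact: primitive_bmeas (pD0 j jm).
  by rewrite /D ltnn; exact: bc.
have cM j y : `|c j y| <= M by apply: clip_le.
exists D; split=> [j jm|j y|y yst].
- by apply: primitive_ae (pD0 j jm) (bD _ _) (cD _ _).
- rewrite leq_eqVlt => /predU1P[->|jm] yst; first by rewrite /D ltnn.
  apply: (primitive_ae_le st (pD0 j jm) _ yst).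
  by apply: ae_oo_mono (cD j (leqW jm)) => z _ <-.
have cD0 := primitive_continuous (pD0 0%N (leq0n _)).
have ch : {within `[s, t], continuous (fun y => v y - D 0%N y)}.
  by move=> z; apply: continuousB; [exact: cv|exact: cD0].
apply/subr0_eq; apply: (continuous_ae_eq0 st ch _ yst).
apply: ae_oo_mono2 (gc 0%N (leq0n _)) (cD 0%N (leq0n _)) => z _.
by rewrite /g /weak_derivn /= => -> ->; rewrite subrr.
Qed.

End WeakDerivatives.

(** * The interface problem and the immersed space *)

Section InterfaceRegularity.
Context {R : realType} (a b alpha betam betap : R).
Context (haal : a < alpha) (halb : alpha < b) (hbm : 0 < betam) (hbp : 0 < betap).
Implicit Types (x y : R) (f g u : R -> R).

Local Notation beta := (pwcst alpha betam betap).
Local Notation w := (weight alpha betam betap).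

Lemma beta_left y : y < alpha -> beta y = betam.
Proof. by rewrite /pwcst => ->. Qed.

Lemma beta_right y : alpha <= y -> beta y = betap.
Proof. by rewrite /pwcst ltNge => ->. Qed.

Lemma beta_gt0 y : 0 < beta y.
Proof. by rewrite /pwcst; case: ifP. Qed.

Lemma weightK y v : beta y * (w y * v) = v.
Proof. by rewrite /weight mulrA divff ?mul1r // gt_eqF ?beta_gt0. Qed.

Lemma weight_measurable : measurable_fun setT w.
Proof.
rewrite (_ : w = (fun y => if y < alpha then betam^-1 else betap^-1)).
  apply: measurable_fun_if => //; apply: measurable_fun_ltr => //.
by apply/funext => y; rewrite /weight /pwcst; case: ifP.
Qed.

Lemma weight_bmeas s t : bmeas s t w.
Proof.
split; first by apply: measurable_funTS; exact: weight_measurable.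
exists (`|betam^-1| + `|betap^-1|) => y _; rewrite /weight /pwcst.
by case: ifP => _; rewrite ?lerDl ?lerDr.
Qed.

Lemma primitive_continuous_at s t F f x : primitive_on s t F f -> s < x < t ->
  {for x, continuous F}.
Proof.
move=> pF sxt; have st : s < t by case/andP: sxt => /lt_trans; apply.
by have /(continuous_within_itvP _ st) [cF _ _] := primitive_continuous pF; apply: cF; rewrite in_itv.
Qed.

Lemma derive1n_chain s t n u (D : nat -> R -> R) :
  (forall j, (j <= n)%N -> primitive_on s t (D j) (D j.+1)) ->
  (forall y, s <= y <= t -> u y = D 0%N y) ->
  forall j y, (j <= n)%N -> s < y < t -> derive1n j u y = D j y.
Proof.
move=> pD uD; elim=> [|j IH] y jn /andP[sy yt].
  by rewrite derive1n0 uD // !ltW.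
rewrite derive1nS.
(* The previous derivative is identified inside ]s, t[ only, while [primitive_on] speaks of closed
   intervals. *)
pose s' := (s + y) / 2; pose t' := (y + t) / 2.
have [ss' s'y yt' t't] : [/\ s < s', s' < y, y < t' & t' < t].
  by rewrite /s' /t'; split; lra.
apply: (@primitive_derive1 _ s' t'); last 2 first.
- by rewrite s'y.
- by apply: (primitive_continuous_at (pD j.+1 jn)); rewrite sy.
apply: primitive_ext (primitive_sub (ltW ss') (ltW t't) (pD j (ltnW jn))) => z // /andP[z1 z2].
by rewrite IH ?(ltnW jn) // (lt_le_trans ss') // (le_lt_trans z2).
Qed.

Lemma primitive_cvg_right s t F f : s < t -> primitive_on s t F f -> F y @[y --> s^'+] --> F s.
Proof. by move=> st /primitive_continuous /(continuous_within_itvP _ st) []. Qed.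

Lemma primitive_cvg_left s t F f : s < t -> primitive_on s t F f -> F y @[y --> t^'-] --> F t.
Proof. by move=> st /primitive_continuous /(continuous_within_itvP _ st) []. Qed.

(** [S j] is beta times the derivative of u of order j + 1. The jump conditions of orders 1 to p + 1
    make [S 0] to [S p] continuous across alpha, so the flux is smooth on the whole interval
    although u is not. *)
Theorem interface_regularity p u (M : R) :
  sobolev_interface a b alpha betam betap p.+2 +oo%E u ->
  (interface_norm_infty a b alpha p.+2 u <= M%:E)%E ->
  exists S : nat -> R -> R,
    [/\ forall j, (j <= p)%N -> primitive_on a b (S j) (S j.+1),
        forall j y, (j <= p.+1)%N -> a < y < b -> `|S j y| <= Num.max betap betam * M,
        primitive_on a b u (fun y => w y * S 0%N y) &
        forall y, a < y < b -> y != alpha -> derive1 u y = w y * S 0%N y].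
Proof.
move=> [cu sm sp _ ju]; rewrite ge_max => /andP[nm np].
have [Dm [pDm bDm uDm]] := sobolev_classical haal (within_continuous_sub (lexx _) (ltW halb) cu) sm nm.
have [Dp [pDp bDp uDp]] := sobolev_classical halb (within_continuous_sub (ltW haal) (lexx _) cu) sp np.
have dm := derive1n_chain pDm uDm; have dp := derive1n_chain pDp uDp.
have jD j : (0 < j <= p.+1)%N -> betam * Dm j alpha = betap * Dp j alpha.
  move=> /andP[j0 jp]; have := ju j; rewrite j0 ltnS jp => /(_ isT).
  rewrite /jump.
  have -> : lim (beta y * derive1n j u y @[y --> alpha^'+]) = betap * Dp j alpha.
    apply: cvg_lim => //; apply: cvg_trans (_ : betap * Dp j y @[y --> alpha^'+] --> _).
      apply: near_eq_cvg; near=> y.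
      have y1 : alpha < y by near: y; exact: nbhs_right_gt.
      have y2 : y < b by near: y; exact: nbhs_right_lt.
      by rewrite beta_right ?(ltW y1) // dp ?y1.
    by apply: cvgM; [exact: cvg_cst|exact: primitive_cvg_right halb (pDp j jp)].
  have -> : lim (beta y * derive1n j u y @[y --> alpha^'-]) = betam * Dm j alpha.
    apply: cvg_lim => //; apply: cvg_trans (_ : betam * Dm j y @[y --> alpha^'-] --> _).
      apply: near_eq_cvg; near=> y.
      have y1 : y < alpha by near: y; exact: nbhs_left_lt.
      have y2 : a < y by near: y; exact: nbhs_left_gt.
      by rewrite beta_left // dm ?y2.
    by apply: cvgM; [exact: cvg_cst|exact: primitive_cvg_left haal (pDm j jp)].
  by move=> /subr0_eq.
pose S j y := if y < alpha then betam * Dm j.+1 y else betap * Dp j.+1 y.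
have Sl j y : y < alpha -> S j y = betam * Dm j.+1 y by rewrite /S => ->.
have Sr j y : alpha <= y -> S j y = betap * Dp j.+1 y by rewrite /S ltNge => ->.
have Mm : betam <= Num.max betap betam by rewrite le_max lexx orbT.
have Mp : betap <= Num.max betap betam by rewrite le_max lexx.
exists S; split.
- move=> j jp; apply: (@primitive_cat _ _ alpha).
    apply: primitive_ext (primitiveZ betam (pDm j.+1 jp)) => y /andP[_ yal].
      (* At alpha itself [S j] is defined from the right, and the jump condition identifies that
         value with the one from the left. *)
      by move: yal; rewrite le_eqVlt => /predU1P[->|/Sl ->//]; rewrite Sr // jD.
    by rewrite Sl.
  apply: primitive_ext (primitiveZ betap (pDp j.+1 jp)) => y /andP[yal _].
    by rewrite Sr.
  by rewrite Sr // ltW.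
- move=> j y jp /andP[ay yb]; have [yal|yal] := ltP y alpha.
    rewrite Sl // normrM (gtr0_norm hbm) ler_pM ?(ltW hbm) //.
    by apply: bDm => //; rewrite !ltW.
  rewrite Sr // normrM (gtr0_norm hbp) ler_pM ?(ltW hbp) //.
  by apply: bDp => //; rewrite yal ltW.
- apply: (@primitive_cat _ _ alpha).
    apply: primitive_ext (pDm 0%N (leq0n _)) => y yal; first by rewrite uDm.
    have /andP[_ y1] := yal.
    by rewrite Sl // /weight beta_left // mulrA mulVf ?mul1r ?gt_eqF.
  apply: primitive_ext (pDp 0%N (leq0n _)) => y yal; first by rewrite uDp.
  have /andP[y1 _] := yal.
  by rewrite Sr ?(ltW y1) // /weight beta_right ?(ltW y1) // mulrA mulVf ?mul1r ?gt_eqF.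
- move=> y /andP[ay yb]; rewrite neq_lt => /orP[yal|yal].
    rewrite Sl // /weight beta_left // mulrA mulVf ?mul1r ?gt_eqF //.
    by have := dm 1%N y (ltn0Sn _); rewrite ay yal derive1n1 => ->.
  rewrite Sr ?(ltW yal) // /weight beta_right ?(ltW yal) // mulrA mulVf ?mul1r ?gt_eqF //.
  by have := dp 1%N y (ltn0Sn _); rewrite yb yal derive1n1 => ->.
Unshelve. all: by end_near.
Qed.

Lemma near_dnbhs_neq x : \forall y \near x^', y != alpha.
Proof.
have [->|xal] := eqVneq x alpha; first by rewrite near_withinE; near=> y.
suff : \forall y \near x, y != alpha by exact: cvg_within.
apply/nbhs_ballP; exists `|x - alpha|; first by rewrite /= normr_gt0 subr_eq0.
by move=> y; rewrite /ball /= => h; apply: contraTneq h => ->; rewrite ltxx.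
Unshelve. all: by end_near.
Qed.

End InterfaceRegularity.

(** * Generalized Lobatto and Legendre functions under affine maps *)

Section GeneralizedLobatto.
Context {R : realType}.
Implicit Types (a b s t x y xi ah alpha betam betap : R) (f g : R -> R).

Local Notation mu := (@lebesgue_measure R).

Lemma integ_closed s t f : bmeas s t f -> measurable_fun `[s, t] f ->
  \int[mu]_(y in `[s, t]) f y = integ s t f.
Proof.
move=> bf mf; rewrite /integ /Rintegral; congr fine.
rewrite -integral_itv_obnd_cbnd; last first.
  apply/measurable_EFinP; apply: measurable_funS mf => //.
  by apply: subset_itvr; rewrite bnd_simp.
by rewrite -integral_itv_bndo_bndc //; apply/measurable_EFinP; case: bf.
Qed.

Lemma integ_closed_weight ah betam betap s t (P : {poly R}) : 0 < betam -> 0 < betap ->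
  \int[mu]_(y in `[s, t]) (weight ah betam betap y * P.[y]) =
  integ s t (fun y => weight ah betam betap y * P.[y]).
Proof.
move=> hbm hbp; apply: integ_closed.
  by apply: bmeasM; [exact: weight_bmeas|exact: bmeas_horner].
apply: measurable_funM; first by apply: measurable_funTS; exact: weight_measurable.
by apply: measurable_funTS; apply: continuous_measurable_fun; exact: continuous_horner.
Qed.

(** The weight is constant on either side of alpha, so cutting there reduces to the polynomial
    change of variables. *)
Lemma integ_affine_weight s t (m c : R) alpha betam betap (P : {poly R}) :
  0 < m -> s <= t -> 0 < betam -> 0 < betap ->
  integ (m * s + c) (m * t + c) (fun z => weight (m * alpha + c) betam betap z * P.[z]) =
  m * integ s t (fun y => weight alpha betam betap y * P.[m * y + c]).
Proof.
move=> m0 st hbm hbp.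
have wE y : weight (m * alpha + c) betam betap (m * y + c) = weight alpha betam betap y.
  by rewrite /weight /pwcst ltrD2r ltr_pM2l.
have piece u v (om : R) : u <= v -> (forall y, u < y < v -> weight alpha betam betap y = om) ->
    integ (m * u + c) (m * v + c) (fun z => weight (m * alpha + c) betam betap z * P.[z]) =
    m * integ u v (fun y => weight alpha betam betap y * P.[m * y + c]).
  move=> uv hom.
  rewrite (@integ_affine _ u v m c _ (om *: P)) //; last first.
    move=> z /andP[uz zv]; have ez : z = m * ((z - c) / m) + c.
      by rewrite mulrCA divff ?mulr1 ?subrK // gt_eqF.
    rewrite hornerZ; congr (_ * _); rewrite ez wE hom //.
    by rewrite ltr_pdivlMr // ltr_pdivrMr // ltrBrDr ltrBlDr ![_ * m]mulrC uz zv.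
  by congr (_ * _); apply: integ_ext => y _; rewrite wE.
have left y : y < alpha -> weight alpha betam betap y = betam^-1 by rewrite /weight /pwcst => ->.
have right y : alpha <= y -> weight alpha betam betap y = betap^-1 by rewrite /weight /pwcst ltNge => ->.
have [tal|alt] := leP t alpha.
  by apply: (piece _ _ betam^-1) => // y /andP[_ yt]; rewrite left // (lt_le_trans yt).
have [als|sal] := leP alpha s.
  by apply: (piece _ _ betap^-1) => // y /andP[sy _]; rewrite right // (le_trans als) // ltW.
have bl u v : bmeas u v (fun z => weight (m * alpha + c) betam betap z * P.[z]).
  by apply: bmeasM; [exact: weight_bmeas|exact: bmeas_horner].
have br u v : bmeas u v (fun y => weight alpha betam betap y * P.[m * y + c]).
  apply: bmeasM; first exact: weight_bmeas.
  apply: bmeas_ext (bmeas_horner u v (P \Po (m *: 'X + c%:P))) => y _.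
  by rewrite horner_comp !hornerE.
rewrite (@integ_cat _ _ (m * alpha + c)) ?lerD2r ?ler_pM2l ?(ltW sal) ?(ltW alt) //.
rewrite [in RHS](@integ_cat _ s alpha t) ?(ltW sal) ?(ltW alt) // mulrDr; congr (_ + _).
  by apply: (piece _ _ betam^-1); [exact: ltW|move=> y /andP[_ yt]; rewrite left].
by apply: (piece _ _ betap^-1); [exact: ltW|move=> y /andP[sy _]; rewrite right // ltW].
Qed.

Lemma primitive_affine_weight s t (m c : R) alpha betam betap (P : {poly R}) (G : R -> R) :
  0 < m -> s <= t -> 0 < betam -> 0 < betap ->
  primitive_on (m * s + c) (m * t + c) G (fun z => weight (m * alpha + c) betam betap z * P.[z]) ->
  primitive_on s t (fun y => G (m * y + c))
    (fun y => weight alpha betam betap y * (m *: (P \Po (m *: 'X + c%:P))).[y]).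
Proof.
move=> m0 st hbm hbp [_ GP]; split.
  by apply: bmeasM; [exact: weight_bmeas|exact: bmeas_horner].
move=> x y sx xy yt.
rewrite GP ?lerD2r ?ler_pM2l // integ_affine_weight // -integZ; last first.
  apply: bmeasM; first exact: weight_bmeas.
  apply: bmeas_ext (bmeas_horner x y (P \Po (m *: 'X + c%:P))) => z _.
  by rewrite horner_comp !hornerE.
by apply: integ_ext => z _; rewrite hornerZ horner_comp !(hornerD, hornerZ, hornerX, hornerC); ring.
Qed.

Lemma affine_primitive s t g (k e : R) : s < t -> {within `[s, t], continuous g} ->
  (forall y, s < y < t -> g y = k * y + e) -> primitive_on s t g (cst k).
Proof.
move=> st cg; apply: (primitive_extend st cg).
apply: primitive_ext (primitiveD (primitiveZ k (primitive_id s t)) (primitive_cst s t e)) => y _ //.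
by rewrite /= mulr1 addr0.
Qed.

(** The flux of g is constant on each side, and the jump condition makes the two constants equal;
    [k] is their common value. *)
Lemma interface_affine_primitive ah betam betap vl vr g : -1 < ah < 1 -> 0 < betam -> 0 < betap ->
  interface_affine ah betam betap vl vr g ->
  exists k : R, primitive_on (-1) 1 g (fun z => weight ah betam betap z * k).
Proof.
move=> /andP[ah1 ah2] hbm hbp [cg [[k1 [e1 g1]] [k2 [e2 g2]]] jg _ _].
have p1 : primitive_on (-1) ah g (cst k1).
  by apply: (affine_primitive ah1 (within_continuous_sub (lexx _) (ltW ah2) cg) (e := e1)) => y yi; apply: g1; apply/oo_itvP.
have p2 : primitive_on ah 1 g (cst k2).
  by apply: (affine_primitive ah2 (within_continuous_sub (ltW ah1) (lexx _) cg) (e := e2)) => y yi; apply: g2; apply/oo_itvP.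
have d1 y : -1 < y < ah -> derive1 g y = k1 by move=> yi; rewrite (primitive_derive1 p1 yi) //; exact: cvg_cst.
have d2 y : ah < y < 1 -> derive1 g y = k2 by move=> yi; rewrite (primitive_derive1 p2 yi) //; exact: cvg_cst.
have jk : betap * k2 = betam * k1.
  move: jg; rewrite /jump.
  have -> : lim (pwcst ah betam betap y * derive1 g y @[y --> ah^'+]) = betap * k2.
    apply: cvg_lim => //; apply: cvg_near_cst; near=> y.
    have y1 : ah < y by near: y; exact: nbhs_right_gt.
    have y2 : y < 1 by near: y; exact: nbhs_right_lt.
    by rewrite beta_right ?(ltW y1) // d2 // y1.
  have -> : lim (pwcst ah betam betap y * derive1 g y @[y --> ah^'-]) = betam * k1.
    apply: cvg_lim => //; apply: cvg_near_cst; near=> y.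
    have y1 : y < ah by near: y; exact: nbhs_left_lt.
    have y2 : -1 < y by near: y; exact: nbhs_left_gt.
    by rewrite beta_left // d1 // y2.
  by move=> /subr0_eq.
exists (betam * k1); apply: (@primitive_cat _ _ ah).
  apply: primitive_ext p1 => // y /andP[_ yah].
  by rewrite /= /weight beta_left // mulrA mulVf ?mul1r // gt_eqF.
apply: primitive_ext p2 => // y /andP[yah _].
by rewrite -jk /= /weight beta_right ?(ltW yah) // mulrA mulVf ?mul1r // gt_eqF.
Unshelve. all: by end_near.
Qed.

Lemma monic_family_span (L : nat -> {poly R}) n (r : {poly R}) :
  (forall n, L n \is monic /\ size (L n) = n.+1) -> (size r <= n)%N ->
  exists d : nat -> R, r = \sum_(i < n) d i *: L i.
Proof.
move=> hL; elim: n r => [|n IH] r sr.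
  by exists (fun _ => 0); rewrite big_ord0; apply/eqP; rewrite -size_poly_eq0 -leqn0.
have [/monicP lc sL] := hL n.
have lc' : (L n)`_n = 1 by move: lc; rewrite lead_coefE sL.
have [|d hd] := IH (r - r`_n *: L n); first by have := size_sub_lead sr sL; rewrite lc' divr1.
exists (fun i => if (i < n)%N then d i else r`_n).
rewrite big_ord_recr /= ltnn.
under eq_bigr => i _ do rewrite ltn_ord.
by rewrite -hd subrK.
Qed.

Lemma comp_affine_inv (q : {poly R}) (m c : R) : m != 0 ->
  exists2 r : {poly R}, size r = size q & r \Po (m *: 'X + c%:P) = q.
Proof.
move=> m0; exists (q \Po (m^-1 *: 'X + (- c / m)%:P)).
  by rewrite size_comp_affine // invr_eq0.
rewrite -comp_polyA comp_polyD comp_polyZ comp_polyX comp_polyC scalerDr scalerA mulVf // scale1r.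
rewrite -addrA -mul_polyC -polyCM -polyCD.
by rewrite (_ : m^-1 * c + - c / m = 0) ?addr0 ?comp_polyXr //; field.
Qed.

Lemma gen_legendre_orth ah betam betap (L : nat -> {poly R}) p (q : {poly R}) :
  0 < betam -> 0 < betap -> gen_legendre ah betam betap L -> (size q <= p)%N ->
  integ (-1) 1 (fun z => weight ah betam betap z * (L p * q).[z]) = 0.
Proof.
move=> hbm hbp [hL oL] sq; have [d ->] := monic_family_span hL sq.
rewrite mulr_sumr.
have bw : bmeas (-1) 1 (weight ah betam betap) by exact: weight_bmeas.
have : forall n, (n <= p)%N ->
    integ (-1) 1 (fun z => weight ah betam betap z * (\sum_(i < n) L p * (d i *: L i)).[z]) = 0.
  elim=> [_|n IH np].
    by apply: integ_eq0 => z _; rewrite big_ord0 horner0 mulr0.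
  rewrite (@integ_ext _ _ _ _ (fun z => weight ah betam betap z * (\sum_(i < n) L p * (d i *: L i)).[z]
     + d n * (weight ah betam betap z * ((L p).[z] * (L n).[z])))); last first.
    by move=> z _; rewrite big_ord_recr /= hornerD hornerM hornerZ; ring.
  rewrite integD ?integZ; try by bmeas_auto.
  rewrite IH ?(ltnW np) // add0r.
  have : integ (-1) 1 (fun z => weight ah betam betap z * ((L p).[z] * (L n).[z])) = 0.
    by apply: oL; rewrite neq_ltn np orbT.
  by move=> ->; rewrite mulr0.
by apply.
Qed.

End GeneralizedLobatto.

(** * Primitives as members of the Sobolev space *)

Section DiscreteSpace.
Context {R : realType}.
Implicit Types (a b s t x y r alpha betam betap : R) (f g v : R -> R).

Local Notation mu := (@lebesgue_measure R).

Lemma integrable_bump s t x r g : locally_integrable `]s, t[ g -> 0 < r -> s < x - r ->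
  x + r < t -> mu.-integrable `]s, t[ (EFin \o (fun y => g y * bump x r y)).
Proof.
move=> [mg _ intg] r0 sx xt.
have mb : measurable_fun setT (bump x r) by apply: continuous_measurable_fun; exact: continuous_bump.
have Kst : `[x - r, x + r]%classic `<=` `]s, t[%classic.
  move=> y /=; rewrite !in_itv /= => /andP[h1 h2].
  by rewrite (lt_le_trans sx) // (le_lt_trans h2).
have mgK : measurable_fun `[x - r, x + r] g by apply: measurable_funS mg.
have intK : mu.-integrable `[x - r, x + r] (EFin \o (fun y => g y * bump x r y)).
  apply: (@le_integrable _ _ _ mu _ _ _ (fun y => ((r ^+ 4)%:E * (EFin \o g) y)%E)) => //.
  - by apply/measurable_EFinP; apply: measurable_funM => //; exact: measurable_funTS.
  - move=> y yK; change (`|g y * bump x r y|%:E <= `|r ^+ 4 * g y|%:E)%E.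
    rewrite lee_fin [leLHS]normrM [leRHS]normrM mulrC ler_wpM2r //.
    rewrite [leLHS]ger0_norm; last exact: bump_ge0.
    by rewrite [leRHS]ger0_norm ?bump_le // exprn_ge0 // ltW.
  - apply: integrableZl => //; apply/integrableP; split; first exact/measurable_EFinP.
    by apply: intg => //; exact: segment_compact.
apply/(integrable_mkcond _ _).2 => //; move/(integrable_mkcond _ _).1: intK => /(_ (measurable_itv _)).
congr (integrable _ _ _); apply/funext => y; rewrite !patchE.
case: ifPn => [|yK]; first by rewrite inE => /Kst yst; rewrite mem_set.
case: ifP => // _; rewrite /= bump_out ?mulr0 //.
by move: yK; rewrite notin_setE /= in_itv /= => /negP; rewrite negb_and -!ltNge => /orP[|] /ltW ->; rewrite ?orbT.
Qed.

Lemma weak_deriv_ae s t v f g : is_weak_deriv `]s, t[ v g -> bmeas s t f ->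
  is_weak_deriv `]s, t[ v f -> ae_oo s t (fun y => g y = f y).
Proof.
move=> [_ lg hg] bf [_ lf hf].
suff : ae_oo s t (fun y => g y - f y = 0) by apply: ae_oo_mono => y _ /subr0_eq.
apply: weak_eq0; first exact: (locally_integrableB lg lf).
move=> x r r0 sx xt; have cB := bump_C1c r0 sx xt.
have e : integ s t (fun y => g y * bump x r y) = integ s t (fun y => f y * bump x r y).
  by apply: oppr_inj; rewrite -(hg _ cB) -(hf _ cB).
have := @RintegralB _ _ _ mu `]s, t[ _ _ (measurable_itv _)
  (integrable_bump lg r0 sx xt) (integrable_bump lf r0 sx xt).
move=> h; rewrite (@integ_ext _ _ _ _ (fun y => g y * bump x r y - f y * bump x r y)); last first.
  by move=> y _; rewrite mulrBl.
by apply: (etrans h); apply/eqP; rewrite subr_eq0; apply/eqP; exact: e.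
Qed.

Lemma Lq2_bounded s t g (M : R) : s < t -> measurable_fun `]s, t[ g ->
  ae_oo s t (fun y => `|g y| <= M) -> Lq `]s, t[ 2%:E g.
Proof.
move=> st mg gM; split => //; rewrite /finite_norm unlock; apply: poweR_lty.
have mI : measurable (`]s, t[%classic : set R) by exact: measurable_itv.
pose F := fun y : R => (`|g y| `^ 2)%:E.
have mF : measurable_fun `]s, t[ F.
  by apply/measurable_EFinP; apply: measurableT_comp (measurable_powR _) _; exact: measurableT_comp.
rewrite (_ : (fun x => _) = EFin \o ((fun y => `|g y| `^ 2) \_ `]s, t[)); last first.
  apply/funext => y /=; rewrite !patchE; case: ifP => // _.
  by rewrite -[X in `|X|]/(0 : R) normr0 powR0 // pnatr_eq0.
rewrite -restrict_EFin -integral_mkcond.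
apply: (@le_lt_trans _ _ ((`|M| `^ 2)%:E * mu `]s, t[)%E); last first.
  rewrite lebesgue_measure_itv /= lte_fin st -EFinD -EFinM; exact: ltry.
rewrite (_ : (\int[mu]_(x in `]s, t[) F x = \int[mu]_(x in `]s, t[) `|F x|)%E); last first.
  by apply: eq_integral => y _; rewrite /F gee0_abs // lee_fin powR_ge0.
apply: integral_le_bound => //.
apply: (negligibleS _ gM) => y /= h h'; apply: h => /oo_itvP /h' yM.
rewrite /F /= lee_fin ger0_norm ?powR_ge0 // ge0_ler_powR ?nnegrE //.
by rewrite (le_trans yM) // ler_norm.
Qed.

Lemma primitive_sum (I : finType) s t (F f : I -> R -> R) :
  (forall i, primitive_on s t (F i) (f i)) ->
  primitive_on s t (fun y => \sum_i F i y) (fun y => \sum_i f i y).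
Proof.
move=> pF; have : forall r : seq I,
    primitive_on s t (fun y => \sum_(i <- r) F i y) (fun y => \sum_(i <- r) f i y).
  elim=> [|i r IH].
    by apply: primitive_ext (primitive_cst s t 0) => y _; rewrite big_nil.
  by apply: primitive_ext (primitiveD (pF i) IH) => y _; rewrite big_cons.
by apply.
Qed.

(** [weak_deriv] is an arbitrary choice; uniqueness up to null sets makes it agree with the bounded
    function f almost everywhere, hence square integrable. *)
Lemma primitive_H10 a b v f : a < b -> primitive_on a b v f -> v a = 0 -> v b = 0 -> H10 a b v.
Proof.
move=> ab pv va vb; split=> //; first exact: primitive_continuous pv.
have wv := primitive_weak_deriv ab pv.
have wd : is_weak_deriv `]a, b[ v (weak_deriv `]a, b[ v) by apply: xgetPex; exists f.
have bv := primitive_bmeas pv; have bf := primitive_bmeasr pv.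
split=> [j|j].
  by rewrite ltnS leqn0 => /eqP ->.
rewrite leq_eqVlt ltnS leqn0 => /orP[/eqP ->|/eqP ->]; last first.
  case: bv => mv [M vM]; apply: (@Lq2_bounded _ _ _ M) => //.
  exact: ae_oo_true.
case: wd (weak_deriv_ae wd bf wv) => _ [mw _ _] _ wf.
case: bf => mf [M fM]; apply: (@Lq2_bounded _ _ _ M) => //.
by apply: ae_oo_mono wf => y yab e; rewrite [weak_derivn _ _ _ _]e; exact: fM.
Qed.

End DiscreteSpace.

(** * The immersed space as weighted primitives of piecewise polynomials *)

Section ImmersedSpace.
Context {R : realType} (a b alpha betam betap : R) (N k0 p : nat) (x : nat -> R).
Context (hab : a < b) (hm : is_mesh a b N x) (hbm : 0 < betam) (hbp : 0 < betap).
Context (k0N : (k0 < N)%N) (hal : x k0 < alpha < x k0.+1) (hp : (2 <= p)%N).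
Context (L : nat -> {poly R}) (phi : nat -> R -> R).
Local Notation ah := (ref_coord x k0.+1 alpha).
Context (hL : gen_legendre ah betam betap L) (hphi : gen_lobatto ah betam betap L phi).
Implicit Types (i n : nat) (y : R) (s v f : R -> R).

Local Notation w := (weight alpha betam betap).
Local Notation slope i := (2 / (x i.+1 - x i)).
Local Notation shift i := (- (x i + x i.+1) / (x i.+1 - x i)).

Lemma slope_gt0 i : (i < N)%N -> 0 < slope i.
Proof. by move=> iN; rewrite divr_gt0 // subr_gt0 (mesh_lt hm). Qed.

Lemma ref_coordE i y : (i < N)%N -> ref_coord x i.+1 y = slope i * y + shift i.
Proof.
move=> iN; rewrite /ref_coord /=; field.
by rewrite subr_eq0 gt_eqF // (mesh_lt hm).
Qed.

Lemma slope_left i : (i < N)%N -> slope i * x i + shift i = -1.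
Proof. by move=> iN; field; rewrite subr_eq0 gt_eqF // (mesh_lt hm). Qed.

Lemma slope_right i : (i < N)%N -> slope i * x i.+1 + shift i = 1.
Proof. by move=> iN; field; rewrite subr_eq0 gt_eqF // (mesh_lt hm). Qed.

Lemma weight_elem i : (i < N)%N -> i != k0 ->
  exists2 om : R, 0 < om & forall y, x i < y < x i.+1 -> w y = om.
Proof.
move=> iN; have /andP[al1 al2] := hal; rewrite neq_ltn => /orP[ik|ki].
  exists betam^-1; first by rewrite invr_gt0.
  move=> y /andP[_ yi]; rewrite /weight beta_left //.
  by apply: lt_trans al1; apply: lt_le_trans yi _; exact: (mesh_le hm ik (ltnW k0N)).
exists betap^-1; first by rewrite invr_gt0.
move=> y /andP[yi _]; rewrite /weight beta_right //.
by apply/ltW/(lt_trans al2); apply: le_lt_trans yi; exact: (mesh_le hm ki (ltnW iN)).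
Qed.

Lemma refine_primitive (G : R -> R) (P : {poly R}) :
  primitive_on (-1) 1 G (fun z => weight ah betam betap z * P.[z]) ->
  exists2 q : {poly R}, size q = size P &
    primitive_on (x k0) (x k0.+1) (fun y => G (ref_coord x k0.+1 y)) (fun y => w y * q.[y]) /\
    q = slope k0 *: (P \Po (slope k0 *: 'X + (shift k0)%:P)).
Proof.
move=> pG; have m0 := slope_gt0 k0N.
exists (slope k0 *: (P \Po (slope k0 *: 'X + (shift k0)%:P))).
  by rewrite size_scale ?size_comp_affine // gt_eqF.
split=> //; have := @primitive_affine_weight _ (x k0) (x k0.+1) (slope k0) (shift k0) alpha betam betap P G
  m0 (ltW (mesh_lt hm k0N)) hbm hbp.
rewrite slope_left // slope_right // -ref_coordE // => /(_ pG).
by apply: primitive_ext => y _ //; rewrite ref_coordE.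
Qed.

Lemma ah_in : -1 < ah < 1.
Proof.
have /andP[al1 al2] := hal; have m0 := slope_gt0 k0N.
rewrite ref_coordE //; apply/andP; split.
  by rewrite -[ltLHS](slope_left k0N) ltrD2r ltr_pM2l.
by rewrite -[ltRHS](slope_right k0N) ltrD2r ltr_pM2l.
Qed.

(** The flux is a constant for n = 0 and n = 1, and the generalized Legendre polynomial of degree n
    - 1 afterwards. *)
Lemma phi_primitive_ref n : exists2 P : {poly R}, (size P <= maxn 1 n)%N &
  primitive_on (-1) 1 (phi n) (fun z => weight ah betam betap z * P.[z]).
Proof.
have [h0 h1 h2] := hphi; case: n => [|[|n]].
- have [k pk] := interface_affine_primitive ah_in hbm hbp h0.
  exists k%:P; first by rewrite (leq_trans (size_polyC_leq1 _)).
  by apply: primitive_ext pk => z _ //; rewrite hornerC.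
- have [k pk] := interface_affine_primitive ah_in hbm hbp h1.
  exists k%:P; first by rewrite (leq_trans (size_polyC_leq1 _)).
  by apply: primitive_ext pk => z _ //; rewrite hornerC.
have [_ sL] := hL.1 n.+1; exists (L n.+1); first by rewrite sL leq_max leqnn orbT.
have bw : bmeas (-1) 1 (weight ah betam betap) by exact: weight_bmeas.
have := primitive_integ (bmeasM bw (bmeas_horner (-1) 1 (L n.+1))).
apply: primitive_ext => z zi //.
by rewrite h2 // integ_closed_weight.
Qed.

Lemma phi_primitive n : (n <= p)%N -> exists2 q : {poly R}, (size q <= p)%N &
  primitive_on (x k0) (x k0.+1) (fun y => phi n (ref_coord x k0.+1 y)) (fun y => w y * q.[y]).
Proof.
move=> np; have [P sP pP] := phi_primitive_ref n.
have [q sq [pq _]] := refine_primitive pP; exists q => //.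
by rewrite sq (leq_trans sP) // geq_max np andbT ltnW.
Qed.

Lemma ife_space_primitive v : ife_space a b N k0.+1 p x phi v ->
  exists s, [/\ ppoly N x p s, primitive_on a b v (fun y => w y * s y), v a = 0 & v b = 0].
Proof.
move=> [[cv _ va vb] vi [d vk]].
have elem i : (i < N)%N -> exists q : {poly R}, (size q <= p)%N /\
    primitive_on (x i) (x i.+1) v (fun y => w y * q.[y]).
  move=> iN; have st := mesh_lt hm iN; have ci := within_continuous_sub (mesh_ge_a hm (ltnW iN)) (mesh_le_b hm iN) cv.
  have [ik|ik] := eqVneq i k0.
    rewrite ik in ci *; have : forall n : 'I_p.+1, exists q : {poly R}, (size q <= p)%N /\
        primitive_on (x k0) (x k0.+1) (fun y => phi n (ref_coord x k0.+1 y)) (fun y => w y * q.[y]).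
      by move=> n; have [|q sq pq] := @phi_primitive n; [rewrite -ltnS|exists q].
    move=> /choice [q hq]; exists (\sum_(n < p.+1) d n *: q n); split.
      apply/leq_sizeP => j pj; rewrite coef_sum big1 // => n _.
      by rewrite coefZ nth_default ?mulr0 // (leq_trans (hq n).1).
    apply: (primitive_extend (mesh_lt hm k0N) ci _ vk).
    apply: primitive_ext (primitive_sum (fun n : 'I_p.+1 => primitiveZ (d n) (hq n).2)) => y _ //.
    by rewrite horner_sum mulr_sumr; apply: eq_bigr => n _; rewrite hornerZ mulrCA.
  have [q sq vq] := vi i.+1 iN ik.
  have [om om0 wom] := weight_elem iN ik.
  exists (om^-1 *: deriv q); split.
    rewrite (leq_trans (size_scale_leq _ _)) //.
    have [->|qn0] := eqVneq q 0; first by rewrite deriv0 size_poly0.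
    by rewrite -ltnS (leq_trans (lt_size_deriv qn0)).
  apply: (primitive_extend st ci _ vq).
  apply: primitive_ext (primitive_horner (x i) (x i.+1) q) => y yi //.
  by rewrite hornerZ wom // mulrA divff ?mul1r // gt_eqF.
have [s hs] := piecewise_glue hm elem.
exists s; split=> //; first by move=> i iN; have [q [sq _] sE] := hs i iN; exists q.
have N0 : (0 < N)%N by apply: leq_trans k0N.
have pel i : (i < N)%N -> primitive_on (x i) (x i.+1) v (fun y => w y * s y).
  move=> iN; have [q [sq pq] sE] := hs i iN.
  by apply: primitive_ext pq => y yi //; rewrite sE.
by have := primitive_glue pel N0; case: hm => -> ->.
Qed.

(** The sum has constant flux and equal end values; as the weight has positive integral, that flux
    is zero. *)
Lemma phi01_sum xi : -1 <= xi <= 1 -> phi 0%N xi + phi 1%N xi = 1.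
Proof.
have [h0 h1 _] := hphi.
have [k pk] := interface_affine_primitive ah_in hbm hbp h0.
have [k' pk'] := interface_affine_primitive ah_in hbm hbp h1.
have [_ _ _ v00 v01] := h0; have [_ _ _ v10 v11] := h1.
have bw : bmeas (-1) 1 (weight ah betam betap) by exact: weight_bmeas.
have e xi' : -1 <= xi' -> xi' <= 1 -> phi 0%N xi' + phi 1%N xi' - 1 = (k + k') * integ (-1) xi' (weight ah betam betap).
  move=> l1 l2; have [_ /(_ (-1) xi' (lexx _) l1 l2)] := primitiveD pk pk'.
  rewrite v00 v10 addr0 => ->; rewrite -integZ; last exact: weight_bmeas.
  by apply: integ_ext => z _; ring.
have i1 : 0 < integ (-1) 1 (weight ah betam betap).
  have N11 : -1 < 1 :> R by lra.
  pose wm := Num.min betam^-1 betap^-1.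
  have wm0 : 0 < wm by rewrite lt_min !invr_gt0 hbm.
  have := integ_sqr_poly_gt0 N11 wm0 bw _ (oner_neq0 {poly R}).
  rewrite (@integ_ext _ _ _ _ (weight ah betam betap)); last by move=> z _; rewrite -polyC1 hornerC mulr1 mulr1.
  apply=> z _; rewrite /wm /weight /pwcst.
  by case: ifP => _; rewrite ge_min lexx ?orbT.
have kk : k + k' = 0.
  have := e 1 _ (lexx _); rewrite v01 v11 add0r subrr.
  have N11 : -1 <= 1 :> R by lra.
  by move=> /(_ N11) /esym /eqP; rewrite mulf_eq0 (gt_eqF i1) orbF => /eqP.
by move=> /andP[l1 l2]; have := e xi l1 l2; rewrite kk mul0r => /subr0_eq.
Qed.

(** On the interface element the flux is expanded in generalized Legendre polynomials, whose
    weighted primitives are the functions phi; the constant of integration is absorbed by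
    [phi01_sum]. *)
Lemma primitive_ife_space v s : ppoly N x p s -> primitive_on a b v (fun y => w y * s y) ->
  v a = 0 -> v b = 0 -> ife_space a b N k0.+1 p x phi v.
Proof.
move=> ps pv va vb.
have pel i : (i < N)%N -> primitive_on (x i) (x i.+1) v (fun y => w y * s y).
  by move=> iN; exact: (primitive_elem hm iN pv).
split; first exact: primitive_H10 pv va vb.
  case=> // i /= iN; rewrite eqSS => ik.
  have [om _ wom] := weight_elem iN ik; have [q sq sE] := ps i iN.
  have [Q dQ sQ] := antiderivative q.
  exists ((v (x i) - om * Q.[x i])%:P + om *: Q).
    rewrite (leq_trans (size_polyD _ _)) // geq_max (leq_trans (size_polyC_leq1 _)) //=.
    by rewrite (leq_trans (size_scale_leq _ _)) // (leq_trans sQ).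
  move=> y /andP[iy yi]; rewrite hornerD hornerC hornerZ.
  have [_ /(_ (x i) y (lexx _) (ltW iy) (ltW yi))] := pel i iN.
  have [_ hQ] := primitiveZ om (primitive_horner (x i) (x i.+1) Q).
  have := hQ (x i) y (lexx _) (ltW iy) (ltW yi); rewrite dQ => e2 e1.
  have : v y - v (x i) = om * Q.[y] - om * Q.[x i].
    rewrite e1 e2; apply: integ_ext => z /andP[iz zy].
    by rewrite wom ?sE // iz (lt_trans zy).
  lra.
have [r sr sE] := ps k0 k0N.
have m0 := slope_gt0 k0N.
pose m := slope k0; pose c := shift k0.
have mn0 : m != 0 by rewrite gt_eqF.
have [rh srh rhE] := comp_affine_inv r c mn0.
rewrite -srh in sr.
have [hLm _] := hL.
have [d hd] := monic_family_span hLm sr.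
have [h0 h1 h2] := hphi.
have [k pk] := interface_affine_primitive ah_in hbm hbp h1.
have [_ _ _ v10 v11] := h1.
have N11 : -1 <= 1 :> R by lra.
have kn0 : k != 0.
  apply: contra_eq_neq v11 => k0'; have [_ /(_ (-1) 1 (lexx _) N11 (lexx _))] := pk.
  rewrite v10 subr0 => ->; rewrite integ_eq0; first by rewrite eq_sym oner_eq0.
  by move=> z _; rewrite k0' mulr0.
have L0 : L 0%N = 1.
  have [/monicP lc sL] := hLm 0%N.
  by have /size_poly1P [l l0 Ll] : size (L 0%N) == 1%N; [rewrite sL|move: lc; rewrite Ll lead_coefC => ->].
(* The reference primitive of weight * L_n is phi_(n+1), up to normalisation when n = 0. *)
pose G n := if n is 0%N then (fun xi => k^-1 * phi 1%N xi) else phi n.+1.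
have pG n : primitive_on (-1) 1 (G n) (fun z => weight ah betam betap z * (L n).[z]).
  case: n => [|n].
    apply: primitive_ext (primitiveZ k^-1 pk) => z _ //.
    by rewrite L0 -polyC1 hornerC mulr1 mulrCA mulVf // mulr1.
  have bw : bmeas (-1) 1 (weight ah betam betap) by exact: weight_bmeas.
  have := primitive_integ (bmeasM bw (bmeas_horner (-1) 1 (L n.+1))).
  by apply: primitive_ext => z zi //; rewrite /G h2 // integ_closed_weight.
have G1 n : G n (-1) = 0.
  case: n => [|n]; first by rewrite /G v10 mulr0.
  have l1 : (-1 <= -1 :> R) && (-1 <= 1 :> R) by rewrite lexx N11.
  by rewrite /G h2 // integ_closed_weight // integ_ge.
(* The pull-back to the physical element multiplies the flux by the slope m, which [m^-1]
   compensates. *)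
have pS : primitive_on (-1) 1 (fun xi => \sum_(n < p) m^-1 * d n * G n xi)
    (fun z => weight ah betam betap z * (m^-1 *: rh).[z]).
  apply: primitive_ext (primitive_sum (fun n : 'I_p => primitiveZ (m^-1 * d n) (pG n))) => z _ //.
  rewrite hornerZ [in RHS]hd horner_sum !mulr_sumr; apply: eq_bigr => n _.
  by rewrite hornerZ; ring.
have [q _ [pq qE]] := refine_primitive pS.
have qr : q = r.
  rewrite qE -/m -/c comp_polyZ scalerA divff // scale1r; exact: rhE.
have vE y : x k0 <= y <= x k0.+1 ->
    v y = v (x k0) + \sum_(n < p) m^-1 * d n * G n (ref_coord x k0.+1 y).
  move=> /andP[ky yk].
  have [_ /(_ (x k0) y (lexx _) ky yk)] := pel k0 k0N.
  have [_ /(_ (x k0) y (lexx _) ky yk)] := pq.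
  have -> : ref_coord x k0.+1 (x k0) = -1 by rewrite ref_coordE // slope_left.
  rewrite [X in _ - X]big1; last by move=> n _; rewrite G1 mulr0.
  rewrite subr0 qr => e1 e2; rewrite e1.
  have -> : integ (x k0) y (fun y => w y * r.[y]) = v y - v (x k0).
    by rewrite e2; apply: integ_ext => z /andP[kz zy]; rewrite sE // kz (lt_le_trans zy).
  ring.
pose v0 := v (x k0).
(* The value [v0] is v0 times (phi 0 + phi 1); the degree-zero part of the flux adds a multiple of
   phi 1 / k, and degree n' feeds phi of index n' + 1. *)
pose D n := match n with 0%N => v0 | 1%N => v0 + m^-1 * d 0%N / k | n'.+1 => m^-1 * d n' end.
exists D.
move=> y /andP[ky yk]; rewrite vE ?(ltW ky) ?(ltW yk) // -/v0.
have p0 : (0 < p)%N by apply: ltnW.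
set xi := ref_coord x k0.+1 y.
have xi1 : -1 <= xi <= 1.
  rewrite /xi ref_coordE //; apply/andP; split.
    by rewrite -(slope_left k0N) lerD2r ler_pM2l // ltW.
  by rewrite -[leRHS](slope_right k0N) lerD2r ler_pM2l // ltW.
have key p' : v0 + \sum_(n < p'.+1) m^-1 * d n * G n xi = \sum_(n < p'.+2) D n * phi n xi.
  rewrite big_ord_recl [in RHS]big_ord_recl [in RHS]big_ord_recl /= -/v0.
  have -> : \sum_(i < p') m^-1 * d (0 + fintype.bump 0 i)%N * phi (fintype.bump 0 (fintype.bump 0 i)) xi =
      \sum_(i < p') m^-1 * d (fintype.bump 0 i) * phi (fintype.bump 0 i).+1 xi by [].
  have -> : phi (fintype.bump 0 0) xi = phi 1%N xi by [].
  have -> : phi 0%N xi = 1 - phi 1%N xi by rewrite -(phi01_sum xi1) addrK.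
  by field; rewrite kn0.
by have := key p.-1; rewrite (prednK p0).
Qed.

End ImmersedSpace.

(** * Galerkin equations for the flux *)

Section FluxForm.
Context {R : realType} (a b alpha betam betap : R).
Context (hab : a < b) (hbm : 0 < betam) (hbp : 0 < betap).
Implicit Types (s t x y : R) (f g u v F G S sigma q : R -> R) (l : seq R).

Local Notation beta := (pwcst alpha betam betap).
Local Notation w := (weight alpha betam betap).
Local Notation V1 := (V1 a w).
Local Notation V2 := (V2 a w).

Lemma punctured_itv s t y : s < y < t -> y != alpha ->
  exists s' t', [/\ s < s', s' < y, y < t', t' < t & t' < alpha \/ alpha < s'].
Proof.
move=> /andP[sy yt]; rewrite neq_lt => /orP[ya|ay].
  exists ((s + y) / 2), ((y + Num.min t alpha) / 2).
  have : y < Num.min t alpha by rewrite lt_min yt.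
  have : Num.min t alpha <= t by rewrite ge_min lexx.
  have : Num.min t alpha <= alpha by rewrite ge_min lexx orbT.
  by move: (Num.min _ _) => m *; split; [lra|lra|lra|lra|left; lra].
exists ((y + Num.max s alpha) / 2), ((y + t) / 2).
have : Num.max s alpha < y by rewrite gt_max sy.
have : s <= Num.max s alpha by rewrite le_max lexx.
have : alpha <= Num.max s alpha by rewrite le_max lexx orbT.
by move: (Num.max _ _) => m *; split; [lra|lra|lra|lra|right; lra].
Qed.

Lemma weight_locally_cst s t y : s < y < t -> y != alpha ->
  exists s' t' (om : R), [/\ s <= s', s' < y < t', t' <= t &
    forall z, s' <= z <= t' -> z != alpha /\ w z = om].
Proof.
move=> h ya; have [s' [t' [ss' s'y yt' t't [t'a|as']]]] := punctured_itv h ya.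
  exists s', t', betam^-1; rewrite (ltW ss') (ltW t't) s'y; split => // z /andP[_ zt].
  have za : z < alpha by apply: le_lt_trans t'a.
  by rewrite lt_eqF // /weight beta_left.
exists s', t', betap^-1; rewrite (ltW ss') (ltW t't) s'y; split => // z /andP[sz _].
have za : alpha < z by apply: lt_le_trans sz.
by rewrite gt_eqF // /weight beta_right // ltW.
Qed.

Lemma derive1_weight s t v S (q : {poly R}) y : primitive_on s t v (fun z => w z * S z) ->
  (forall z, s < z < t -> S z = q.[z]) -> s < y < t -> y != alpha ->
  derive1 v y = w y * q.[y].
Proof.
move=> pv Sq syt ya; have [s' [t' [om [ss' s'yt' t't wom]]]] := weight_locally_cst syt ya.
rewrite (primitive_derive1 pv syt) ?Sq //.
apply: (continuous_at_eq s'yt') (_ : {for y, continuous (horner (om *: q))}).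
  move=> z /andP[sz zt]; rewrite Sq; last by rewrite (le_lt_trans ss') // (lt_le_trans zt).
  by have [|_ ->] := wom z; rewrite ?hornerZ // (ltW sz) (ltW zt).
exact: continuous_horner.
Qed.

Lemma derive1_flux u F f g y : primitive_on a b F f -> primitive_on a b f g ->
  (forall z, a < z < b -> z != alpha -> derive1 u z = w z * F z) ->
  a < y < b -> y != alpha -> derive1 (fun z => beta z * derive1 u z) y = f y.
Proof.
move=> pF pf du ayb ya; have [s' [t' [om [as' s'yt' t'b wom]]]] := weight_locally_cst ayb ya.
have cf := primitive_continuous_at pf ayb.
have [s2 [t2 [s's2 s2y yt2 t2t' _]]] := punctured_itv s'yt' ya.
apply: (@primitive_derive1 _ s2 t2) => //; last by rewrite s2y.
apply: primitive_ext (primitive_sub _ _ pF) => //.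
- move=> z /andP[sz zt]; have [za _] : z != alpha /\ w z = om.
    by apply: wom; rewrite (le_trans (ltW s's2)) // (le_trans zt) // ltW.
  rewrite du ?weightK //; apply/andP; split.
    by apply: le_lt_trans as' _; apply: lt_le_trans sz.
  by apply: lt_le_trans _ t'b; apply: le_lt_trans t2t'.
- by rewrite (le_trans as') // ltW.
- by rewrite (le_trans _ t'b) // ltW.
Qed.

(** The point x may be alpha: the limit in [flux] is punctured, and beta u' equals the continuous
    function F off alpha. *)
Lemma flux_eq s t u F x : {for x, continuous F} -> s < x < t ->
  (forall y, s < y < t -> y != alpha -> derive1 u y = w y * F y) ->
  flux alpha betam betap u x = F x.
Proof.
move=> cF sxt du; apply: cvg_lim => //.
apply: cvg_trans (_ : F y @[y --> x^'] --> _); last first.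
  by apply: cvg_trans cF; apply: cvg_app; exact: cvg_within.
apply: near_eq_cvg; near=> y.
have y1 : s < y < t.
  near: y; apply: cvg_within.
  by apply: filterS (near_in_itvoo _); [move=> z; rewrite in_itv /=; exact|rewrite in_itv].
have y2 : y != alpha by near: y; exact: near_dnbhs_neq.
by rewrite du // weightK.
Unshelve. all: by end_near.
Qed.

Lemma V1_eq v sigma y : primitive_on a b v (fun z => w z * sigma z) -> v a = 0 ->
  a <= y <= b -> v y = V1 sigma y.
Proof.
move=> [_ pv] va /andP[ay yb]; have := pv a y (lexx _) ay yb.
by rewrite va subr0.
Qed.

Section TestFunction.
Context (v q : R -> R) (bq : bmeas a b q) (pv : primitive_on a b v (fun y => w y * q y)).
Context (va : v a = 0) (vb : v b = 0).

Lemma integ_test F f : primitive_on a b F f ->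
  integ a b (fun y => f y * v y) = - integ a b (fun y => w y * (F y * q y)).
Proof.
move=> pF; rewrite (integ_by_parts (ltW hab) pF pv) va vb !mulr0 subrr sub0r.
by congr (- _); apply: integ_ext => y _; rewrite mulrCA.
Qed.

(** As gamma u' + c u is the derivative of gamma u + c int u, one integration by parts moves it onto
    v' = w q. *)
Lemma integ_lower_order gamma c u sigma : bmeas a b sigma ->
  primitive_on a b u (fun y => w y * sigma y) -> u a = 0 ->
  integ a b (fun y => (gamma * (w y * sigma y) + c * u y) * v y) =
  - integ a b (fun y => w y * ((gamma * V1 sigma y + c * V2 sigma y) * q y)).
Proof.
move=> bs pu ua.
have bw : bmeas a b w by exact: weight_bmeas.
have b1 := V1_bmeas bw bs.
have uE y : a <= y <= b -> V1 sigma y = u y by move=> yab; rewrite (V1_eq pu).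
have p2 : primitive_on a b (V2 sigma) u.
  by apply: primitive_ext (V2_primitive bw bs) => // y /andP[ay yb]; rewrite uE // !ltW.
have pF := primitiveD (primitiveZ gamma pu) (primitiveZ c p2).
rewrite (integ_test pF); congr (- _); apply: integ_ext => y /andP[ay yb].
by rewrite uE // !ltW.
Qed.

Lemma bilin_flux l gamma c u sigma : bmeas a b sigma ->
  primitive_on a b u (fun y => w y * sigma y) -> u a = 0 ->
  (forall y, a < y < b -> y \notin l -> derive1 u y = w y * sigma y) ->
  (forall y, a < y < b -> y \notin l -> derive1 v y = w y * q y) ->
  bilin a b alpha betam betap gamma c u v =
  integ a b (fun y => w y * ((sigma y - gamma * V1 sigma y - c * V2 sigma y) * q y)).
Proof.
move=> bs pu ua du dv.
have bw : bmeas a b w by exact: weight_bmeas.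
have b1 := V1_bmeas bw bs; have b2 := V2_bmeas bw bs.
have bv := primitive_bmeas pv; have bu := primitive_bmeas pu.
rewrite /bilin /ip.
have -> : \int[@lebesgue_measure R]_(y in `]a, b[) (beta y * derive1 u y * derive1 v y) =
    integ a b (fun y => w y * (sigma y * q y)).
  have bf : bmeas a b (fun y => w y * (sigma y * q y)) by bmeas_auto.
  have e y : a < y < b -> y \notin l ->
      w y * (sigma y * q y) = beta y * derive1 u y * derive1 v y.
    by move=> yab yl; rewrite du // dv // weightK // mulrCA.
  by apply/esym/(integ_off bf e).
have -> : \int[@lebesgue_measure R]_(y in `]a, b[) (gamma * derive1 u y * v y) =
    integ a b (fun y => gamma * (w y * sigma y) * v y).
  have bf : bmeas a b (fun y => gamma * (w y * sigma y) * v y) by bmeas_auto.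
  have e y : a < y < b -> y \notin l ->
      gamma * (w y * sigma y) * v y = gamma * derive1 u y * v y.
    by move=> yab yl; rewrite du.
  by apply/esym/(integ_off bf e).
rewrite -[X in _ + X]/(integ a b (fun y => c * u y * v y)) -addrA -integD; [|bmeas_auto..].
rewrite (@integ_ext _ _ _ (fun y => gamma * (w y * sigma y) * v y + c * u y * v y)
  (fun y => (gamma * (w y * sigma y) + c * u y) * v y)); last by move=> y _; rewrite mulrDl.
rewrite (integ_lower_order gamma c bs pu ua) -integB; [|bmeas_auto..].
by apply: integ_ext => y _; ring.
Qed.

(** Off alpha the differential equation writes f as - S1 + gamma u' + c u, which is enough under the
    integral; the first term is then integrated by parts. *)
Lemma ip_flux gamma c f u (S0 S1 S2 : R -> R) :
  primitive_on a b S0 S1 -> primitive_on a b S1 S2 ->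
  primitive_on a b u (fun y => w y * S0 y) ->
  (forall y, a < y < b -> y != alpha -> derive1 u y = w y * S0 y) ->
  exact_solution a b alpha betam betap gamma c f u ->
  ip a b f v =
  integ a b (fun y => w y * ((S0 y - gamma * V1 S0 y - c * V2 S0 y) * q y)).
Proof.
move=> p0 p1 pu du [eqn ua _ _ _].
have bw : bmeas a b w by exact: weight_bmeas.
have bs := primitive_bmeas p0; have b1' := primitive_bmeas p1.
have b1 := V1_bmeas bw bs; have b2 := V2_bmeas bw bs.
have bv := primitive_bmeas pv; have bu := primitive_bmeas pu.
have bf : bmeas a b (fun y => (gamma * (w y * S0 y) + c * u y) * v y - S1 y * v y) by bmeas_auto.
have e y : a < y < b -> y \notin [:: alpha] ->
    (gamma * (w y * S0 y) + c * u y) * v y - S1 y * v y = f y * v y.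
  rewrite inE => yab ya; have /andP[ay yb] := yab; rewrite -eqn; last first.
    by move: ya; rewrite neq_lt => /orP[h|h]; [left|right]; rewrite h ?ay ?yb.
  by rewrite (derive1_flux p0 p1 du) // du //; ring.
rewrite /ip -[LHS]/(integ a b _) -(integ_off bf e).
rewrite integB; [|bmeas_auto..].
rewrite (integ_lower_order gamma c bs pu ua) (integ_test p0) opprK addrC -integB; [|bmeas_auto..].
by apply: integ_ext => y _; ring.
Qed.

End TestFunction.

End FluxForm.

Lemma integ_norm_le_sqrt {R : realType} (a b : R) (f : R -> R) : a < b -> bmeas a b f ->
  integ a b (fun y => `|f y|) <= Num.sqrt (b - a) * Num.sqrt (integ a b (fun y => f y * f y)).
Proof.
move=> ab bf; have ab0 : 0 < b - a by rewrite subr_gt0.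
have b1 : bmeas a b (cst 1) by exact: bmeas_cst.
have i1 : integ a b (cst 1) = b - a by rewrite integ_cst ?mul1r // ltW.
have := @weighted_cauchy_schwarz R a b (cst 1) f b1 bf (fun _ _ => ler01).
rewrite i1 => /(_ ab0).
have -> : integ a b (fun y => `|cst 1 y * f y|) = integ a b (fun y => `|f y|).
  by apply: integ_ext => y _; rewrite /= mul1r.
have -> : integ a b (fun y => cst 1 y * (f y * f y)) = integ a b (fun y => f y * f y).
  by apply: integ_ext => y _; rewrite /= mul1r.
move=> h.
have A0 : 0 <= integ a b (fun y => `|f y|) by apply: integ_ge0.
rewrite -sqrtrM ?(ltW ab0) // -[leLHS](ger0_norm A0) -sqrtr_sqr.
by apply: ler_wsqrtr.
Qed.

(** * Galerkin orthogonality and stability of the immersed scheme *)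

Section ImmersedGalerkin.
Context {R : realType} (a b alpha betam betap : R) (N k0 p : nat) (x : nat -> R).
Context (hab : a < b) (hm : is_mesh a b N x) (hbm : 0 < betam) (hbp : 0 < betap).
Context (k0N : (k0 < N)%N) (hal : x k0 < alpha < x k0.+1) (hp : (2 <= p)%N).
Context (L : nat -> {poly R}) (phi : nat -> R -> R).
Local Notation ah := (ref_coord x k0.+1 alpha).
Context (hL : gen_legendre ah betam betap L) (hphi : gen_lobatto ah betam betap L phi).
Implicit Types (i n : nat) (y gamma c : R) (s q t v u f g : R -> R).

Local Notation w := (weight alpha betam betap).

Let bw : bmeas a b w := @weight_bmeas _ alpha betam betap a b.

Lemma derive1_ppoly v s n y : ppoly N x n s -> primitive_on a b v (fun z => w z * s z) ->
  a < y < b -> y \notin alpha :: nodes N x -> derive1 v y = w y * s y.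
Proof.
move=> ps pv yab; rewrite inE negb_or => /andP[ya yn].
have [i iN iy] := mesh_locate hm yab yn.
have [q _ sq] := ps i iN.
have pvi : primitive_on (x i) (x i.+1) v (fun z => w z * s z).
  exact: (primitive_elem hm iN pv).
by rewrite (derive1_weight pvi sq iy ya) sq.
Qed.

Lemma V1_ife_space q : ppoly N x p q -> integ a b (fun y => w y * q y) = 0 ->
  ife_space a b N k0.+1 p x phi (V1 a w q).
Proof.
move=> pq q0; have bq := ppoly_bmeas hm hab pq.
apply: (primitive_ife_space hab hm hbm hbp k0N hal hp hL hphi pq) => //.
  exact: V1_primitive.
by rewrite /V1 integ_ge.
Qed.

Lemma bilin_ife gamma c (s q : R -> R) u v : ppoly N x p s -> ppoly N x p q ->
  primitive_on a b u (fun y => w y * s y) -> primitive_on a b v (fun y => w y * q y) ->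
  u a = 0 -> v a = 0 -> v b = 0 ->
  bilin a b alpha betam betap gamma c u v =
  integ a b (fun y => w y * ((s y - gamma * V1 a w s y - c * V2 a w s y) * q y)).
Proof.
move=> ps pq pu pv ua va vb.
have bs := ppoly_bmeas hm hab ps; have bq := ppoly_bmeas hm hab pq.
apply: (bilin_flux hab hbm hbp bq pv va vb (l := alpha :: nodes N x) gamma c bs pu ua).
  by move=> y; exact: (derive1_ppoly ps pu).
by move=> y; exact: (derive1_ppoly pq pv).
Qed.

Lemma ife_flux_orthogonal gamma c f u uh s (S0 S1 S2 : R -> R) :
  primitive_on a b S0 S1 -> primitive_on a b S1 S2 ->
  primitive_on a b u (fun y => w y * S0 y) ->
  (forall y, a < y < b -> y != alpha -> derive1 u y = w y * S0 y) ->
  exact_solution a b alpha betam betap gamma c f u ->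
  ppoly N x p s -> primitive_on a b uh (fun y => w y * s y) -> uh a = 0 ->
  ife_solution a b alpha betam betap gamma c N k0.+1 p x phi f uh ->
  flux_orthogonal a b N x p w gamma c (fun y => S0 y - s y).
Proof.
move=> p0 p1 pu du es ps puh uha [_ gal] q pq q0.
have bs := ppoly_bmeas hm hab ps; have bq := ppoly_bmeas hm hab pq.
have bS := primitive_bmeas p0.
have pv := V1_primitive bw bq.
have va : V1 a w q a = 0 by rewrite /V1 integ_ge.
have := gal _ (V1_ife_space pq q0).
rewrite (bilin_ife gamma c ps pq puh pv uha va q0).
rewrite (ip_flux hab hbm hbp bq pv va q0 p0 p1 pu du es).
have [b1 b2 b3 b4] : [/\ bmeas a b (V1 a w s), bmeas a b (V2 a w s),
    bmeas a b (V1 a w S0) & bmeas a b (V2 a w S0)].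
  by split; [exact: V1_bmeas|exact: V2_bmeas|exact: V1_bmeas|exact: V2_bmeas].
move=> e.
rewrite (@integ_ext _ _ _ _ (fun y =>
  w y * ((S0 y - gamma * V1 a w S0 y - c * V2 a w S0 y) * q y) -
  w y * ((s y - gamma * V1 a w s y - c * V2 a w s y) * q y))); last first.
  move=> y /andP[/ltW ay /ltW yb]; have yab : a <= y <= b by rewrite ay.
  by rewrite (V1B bw bS bs yab) (V2B bw bS bs yab); ring.
by rewrite integB; [rewrite e subrr|bmeas_auto..].
Qed.

(** For the inf-sup partner v, with flux q, the form is at most eps int |w q|, hence at most eps
    sqrt(b - a) times the seminorm of v, which cancels. A second Cauchy-Schwarz inequality for w t
    supplies the other sqrt(b - a). *)
Lemma ife_flux_stable gamma c kappa : 0 < kappa ->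
  ife_stable a b alpha betam betap gamma c kappa N k0.+1 p x phi ->
  flux_stable a b N x p w gamma c ((b - a) / kappa).
Proof.
move=> k_gt0 stab t g eps pt t0 bg e0 ge orth.
have bt := ppoly_bmeas hm hab pt.
have b1 := V1_bmeas bw bt; have b2 := V2_bmeas bw bt.
have pW := V1_primitive bw bt.
have Wa : V1 a w t a = 0 by rewrite /V1 integ_ge.
have [v [vS v0 hv]] := stab _ (V1_ife_space pt t0).
have [q [pq pv va vb]] := ife_space_primitive hm hbm hbp k0N hal hp hL hphi vS.
have bq := ppoly_bmeas hm hab pq.
have q0 : integ a b (fun y => w y * q y) = 0.
  by have [_ /(_ a b (lexx _) (ltW hab) (lexx _))] := pv; rewrite va vb subrr.
have h1E (z r : R -> R) : ppoly N x p r -> primitive_on a b z (fun y => w y * r y) ->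
    h1_seminorm a b z = Num.sqrt (integ a b (fun y => w y * r y * (w y * r y))).
  move=> pr pz; have br := ppoly_bmeas hm hab pr.
  have bf : bmeas a b (fun y => w y * r y * (w y * r y)) by bmeas_auto.
  have e y : a < y < b -> y \notin alpha :: nodes N x ->
      w y * r y * (w y * r y) = derive1 z y * derive1 z y.
    by move=> yab yl; rewrite (derive1_ppoly pr pz).
  by congr Num.sqrt; apply/esym/(integ_off bf e).
rewrite (bilin_ife gamma c pt pq pW pv Wa va vb) (orth q pq q0) in hv.
have bwq : bmeas a b (fun y => w y * q y) by bmeas_auto.
have bwt : bmeas a b (fun y => w y * t y) by bmeas_auto.
have cq := integ_norm_le_sqrt hab bwq; rewrite -(h1E v q) // in cq.
have ct := integ_norm_le_sqrt hab bwt; rewrite -(h1E _ _ pt pW) // in ct.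
have up : integ a b (fun y => w y * (g y * q y)) <= eps * integ a b (fun y => `|w y * q y|).
  rewrite -integZ; last by bmeas_auto.
  apply: le_integ; [bmeas_auto..|] => y yab.
  by rewrite mulrCA (le_trans (ler_norm _)) // normrM ler_wpM2r //; exact: ge.
have key : kappa * h1_seminorm a b (V1 a w t) <= eps * Num.sqrt (b - a).
  rewrite -(ler_pM2r v0); apply: le_trans hv _; apply: le_trans up _.
  by rewrite -mulrA; exact: (ler_wpM2l e0 cq).
have s2 : Num.sqrt (b - a) * Num.sqrt (b - a) = b - a.
  by rewrite -expr2 sqr_sqrtr // subr_ge0 ltW.
have s0 : 0 <= Num.sqrt (b - a) by exact: sqrtr_ge0.
move: ct key s2 s0; move: (integ a b _) (h1_seminorm a b _) (Num.sqrt _) => A H r ct key <- r0.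
apply: le_trans ct _.
have -> : r * r / kappa * eps = r * (eps * r / kappa) by ring.
by rewrite ler_wpM2l // ler_pdivlMr // mulrC.
Qed.

Lemma coercive_flux_stable gamma c (wm wM : R) : 0 < wm ->
  (forall y, a < y < b -> wm <= w y <= wM) -> 0 <= c ->
  flux_stable a b N x p w gamma c (wM * (b - a)).
Proof.
move=> wm0 wB c0 t g eps pt t0 bg e0 ge orth.
have bt := ppoly_bmeas hm hab pt.
by apply: (coercive_stability hab bw wm0 wB c0 bt t0 bg e0 ge (orth t pt t0)).
Qed.

End ImmersedGalerkin.

(** * Special points on single elements *)

Section ElementEstimates.
Context {R : realType} (a b alpha betam betap : R) (N k0 p : nat) (x : nat -> R).
Context (hab : a < b) (hm : is_mesh a b N x) (hbm : 0 < betam) (hbp : 0 < betap).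
Context (k0N : (k0 < N)%N) (hal : x k0 < alpha < x k0.+1) (hp : (2 <= p)%N).
Implicit Types (i : nat) (l g y : R) (q : {poly R}).

Local Notation w := (weight alpha betam betap).
Local Notation slope i := (2 / (x i.+1 - x i)).
Local Notation shift i := (- (x i + x i.+1) / (x i.+1 - x i)).
Local Notation refine i P := (P \Po (slope i *: 'X + (shift i)%:P)).

Lemma horner_refine i (P : {poly R}) y : (refine i P).[y] = P.[slope i * y + shift i].
Proof. by rewrite horner_comp !hornerE. Qed.

Lemma refineP i q : (i < N)%N -> exists2 r : {poly R}, size r = size q & refine i r = q.
Proof.
by move=> iN; apply: comp_affine_inv; rewrite gt_eqF // (slope_gt0 hm).
Qed.

Lemma size_refine_legendre i : (i < N)%N -> size (refine i (legendre p)) = p.+1.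
Proof. by move=> iN; rewrite size_comp_affine ?size_legendre // gt_eqF // (slope_gt0 hm). Qed.

(** For p > 0 the Lobatto polynomial of index p + 1 is by definition the integral of the Legendre
    polynomial of degree p; its roots are where the leading part of the error integrates to zero. *)
Lemma integ_refine_legendre i l : (i < N)%N -> x i <= l <= x i.+1 ->
  lobatto p.+1 (ref_coord x i.+1 l) = 0 ->
  integ (x i) l (horner (refine i (legendre p))) = 0.
Proof.
move=> iN /andP[il li]; rewrite (ref_coordE hm) //; have m0 := slope_gt0 hm iN.
have -> : lobatto p.+1 (slope i * l + shift i) =
    \int[@lebesgue_measure R]_(t in `[-1, slope i * l + shift i]) (legendre p).[t].
  by case: p hp.
rewrite integ_closed; last 2 first.
- exact: bmeas_horner.
- by apply: measurable_funTS; apply: continuous_measurable_fun; exact: continuous_horner.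
rewrite -(slope_left hm iN) (@integ_affine _ _ _ _ _ _ (legendre p)) //.
move/eqP; rewrite mulf_eq0 gt_eqF //= => /eqP e; rewrite -[RHS]e.
by apply: integ_ext => y _; rewrite horner_refine.
Qed.

Lemma refine_legendre_orth i q : (i < N)%N -> (size q <= p)%N ->
  integ (x i) (x i.+1) (fun y => (refine i (legendre p)).[y] * q.[y]) = 0.
Proof.
move=> iN sq; have [r sr rq] := refineP q iN; have m0 := slope_gt0 hm iN.
have := @legendre_orth R p r; rewrite sr => /(_ sq).
have := @integ_affine R (x i) (x i.+1) _ (shift i) (fun y => (legendre p).[y] * r.[y])
  (legendre p * r) m0 (ltW (mesh_lt hm iN)).
rewrite (slope_left hm) // (slope_right hm) // => -> => [|z _]; last by rewrite hornerM.
move/eqP; rewrite mulf_eq0 gt_eqF //= => /eqP e; rewrite -[RHS]e.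
by apply: integ_ext => y _; rewrite horner_refine -rq horner_refine.
Qed.

Lemma weight_legendre_orth i q : (i < N)%N -> i != k0 -> (size q <= p)%N ->
  integ (x i) (x i.+1) (fun y => w y * ((refine i (legendre p)).[y] * q.[y])) = 0.
Proof.
move=> iN ik sq; have [om _ wom] := weight_elem hm hbm hbp k0N hal iN ik.
rewrite (@integ_ext _ _ _ _ (fun y => om * ((refine i (legendre p)).[y] * q.[y]))); last first.
  by move=> y /wom ->.
by rewrite integZ ?refine_legendre_orth ?mulr0 //; bmeas_auto.
Qed.

Lemma weight_lobatto_root i l : (i < N)%N -> i != k0 -> x i <= l <= x i.+1 ->
  lobatto p.+1 (ref_coord x i.+1 l) = 0 ->
  integ (x i) l (fun y => w y * (refine i (legendre p)).[y]) = 0.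
Proof.
move=> iN ik il lr; have [om _ wom] := weight_elem hm hbm hbp k0N hal iN ik.
rewrite (@integ_ext _ _ _ _ (fun y => om * (refine i (legendre p)).[y])); last first.
  move=> y /andP[iy yl]; rewrite wom // iy (lt_le_trans yl) //.
  by have /andP[] := il.
by rewrite integZ ?integ_refine_legendre ?mulr0 //; exact: bmeas_horner.
Qed.

Section Interface.
Context (L : nat -> {poly R}) (phi : nat -> R -> R).
Local Notation ah := (ref_coord x k0.+1 alpha).
Context (hL : gen_legendre ah betam betap L) (hphi : gen_lobatto ah betam betap L phi).

Lemma gen_lobatto_root l : x k0 <= l <= x k0.+1 -> phi p.+1 (ref_coord x k0.+1 l) = 0 ->
  integ (x k0) l (fun y => w y * (refine k0 (L p)).[y]) = 0.
Proof.
move=> /andP[il li]; have m0 := slope_gt0 hm k0N; have [_ _ hn] := hphi.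
rewrite hn ?(leqW hp) //; last first.
  rewrite (ref_coordE hm) //; apply/andP; split.
    by rewrite -(slope_left hm k0N) lerD2r ler_pM2l.
  by rewrite -[leRHS](slope_right hm k0N) lerD2r ler_pM2l.
rewrite integ_closed_weight // !(ref_coordE hm) //.
have := @integ_affine_weight R (x k0) l _ (shift k0) alpha betam betap (L p) m0 il hbm hbp.
rewrite (slope_left hm) // => ->.
move/eqP; rewrite mulf_eq0 gt_eqF //= => /eqP e; rewrite -[RHS]e.
by apply: integ_ext => y _; rewrite horner_refine.
Qed.

Lemma refine_gen_legendre_orth q : (size q <= p)%N ->
  integ (x k0) (x k0.+1) (fun y => w y * ((refine k0 (L p)).[y] * q.[y])) = 0.
Proof.
move=> sq; have [r sr rq] := refineP q k0N; have m0 := slope_gt0 hm k0N.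
have := @gen_legendre_orth _ _ _ _ L p r hbm hbp hL; rewrite sr => /(_ sq).
have := @integ_affine_weight R (x k0) (x k0.+1) _ (shift k0) alpha betam betap (L p * r)
  m0 (ltW (mesh_lt hm k0N)) hbm hbp.
rewrite (ref_coordE hm) // (slope_left hm) // (slope_right hm) // => ->.
move/eqP; rewrite mulf_eq0 gt_eqF //= => /eqP e; rewrite -[RHS]e.
by apply: integ_ext => y _; rewrite horner_refine -rq horner_refine hornerM.
Qed.

End Interface.

Section Estimates.
Context (u uh sigma s S1 : R -> R) (wM K0 K1 : R).
Context (psig : primitive_on a b sigma S1) (pu : primitive_on a b u (fun y => w y * sigma y)).
Context (du : forall y, a < y < b -> y != alpha -> derive1 u y = w y * sigma y).
Context (ps : ppoly N x p s) (puh : primitive_on a b uh (fun y => w y * s y)).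
Context (ua : u a = 0) (uha : uh a = 0) (wB : forall y, a < y < b -> 0 <= w y <= wM).
Context (est : forall i (Lam : {poly R}), (i < N)%N -> size Lam = p.+1 ->
  (forall q : {poly R}, (size q <= p)%N ->
     integ (x i) (x i.+1) (fun y => w y * (Lam.[y] * q.[y])) = 0) ->
  (forall l, x i <= l <= x i.+1 -> integ (x i) l (fun y => w y * Lam.[y]) = 0 ->
     `|V1 a w (fun y => sigma y - s y) l| <= K0) /\
  (forall g : R, x i < g < x i.+1 -> Lam.[g] = 0 -> `|sigma g - s g| <= K1)).

Lemma error_V1 i l : (i < N)%N -> x i <= l <= x i.+1 ->
  u l - uh l = V1 a w (fun y => sigma y - s y) l.
Proof.
move=> iN /andP[il li]; have alb : a <= l <= b.
  by rewrite (le_trans (mesh_ge_a hm (ltnW iN))) //= (le_trans li) // (mesh_le_b hm iN).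
have bw : bmeas a b w by exact: weight_bmeas.
have bs := ppoly_bmeas hm hab ps; have bsig := primitive_bmeas psig.
by rewrite (V1B bw bsig bs alb) (V1_eq pu ua alb) (V1_eq puh uha alb).
Qed.

Lemma noninterface_value i l : (i < N)%N -> i != k0 -> x i <= l <= x i.+1 ->
  lobatto p.+1 (ref_coord x i.+1 l) = 0 -> `|u l - uh l| <= K0.
Proof.
move=> iN ik il lr; rewrite (error_V1 iN il).
have [h _] := est iN (size_refine_legendre iN) (fun q => weight_legendre_orth iN ik).
by apply: h => //; exact: weight_lobatto_root.
Qed.

(** The abstract estimate concerns fluxes; returning to derivatives multiplies by w, at most
    [wM]. *)
Lemma noninterface_derivative i g : (i < N)%N -> i != k0 -> x i < g < x i.+1 ->
  root (legendre p) (ref_coord x i.+1 g) -> `|derive1 u g - derive1 uh g| <= wM * K1.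
Proof.
move=> iN ik ig gr.
have [_ h] := est iN (size_refine_legendre iN) (fun q => weight_legendre_orth iN ik).
have gab := mesh_itv hm iN ig.
have ga : g != alpha.
  have /andP[ig1 ig2] := ig; have /andP[al1 al2] := hal; move: ik; rewrite neq_ltn => /orP[ik|ki].
    by rewrite lt_eqF // (lt_trans ig2) // (le_lt_trans (mesh_le hm ik (ltnW k0N))).
  by rewrite gt_eqF // (lt_trans _ ig1) // (lt_le_trans al2) // (mesh_le hm ki (ltnW iN)).
have [q _ sq] := ps iN.
have puhi : primitive_on (x i) (x i.+1) uh (fun z => w z * s z).
  exact: (primitive_elem hm iN puh).
rewrite (du gab ga) (derive1_weight puhi sq ig ga) -(sq g ig) -mulrBr normrM.
have /andP[w0 w1] := wB gab; rewrite ger0_norm //; apply: ler_pM => //.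
by apply: h => //; rewrite horner_refine -(ref_coordE hm) //; apply/rootP.
Qed.

Section InterfaceElement.
Context (L : nat -> {poly R}) (phi : nat -> R -> R).
Local Notation ah := (ref_coord x k0.+1 alpha).
Context (hL : gen_legendre ah betam betap L) (hphi : gen_lobatto ah betam betap L phi).

Let sizeL : size (refine k0 (L p)) = p.+1.
Proof.
have m0 : slope k0 != 0 by rewrite gt_eqF // (slope_gt0 hm).
by have [/(_ p)[_ sL] _] := hL; rewrite size_comp_affine.
Qed.

Lemma interface_value l : x k0 <= l <= x k0.+1 -> phi p.+1 (ref_coord x k0.+1 l) = 0 ->
  `|u l - uh l| <= K0.
Proof.
move=> il lr; rewrite (error_V1 k0N il).
have [h _] := est k0N sizeL (refine_gen_legendre_orth hL).
by apply: h => //; exact: (gen_lobatto_root hphi).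
Qed.

Lemma interface_flux g : x k0 < g < x k0.+1 -> root (L p) (ref_coord x k0.+1 g) ->
  `|flux alpha betam betap u g - flux alpha betam betap uh g| <= K1.
Proof.
move=> ig gr; have gab := mesh_itv hm k0N ig.
have [_ h] := est k0N sizeL (refine_gen_legendre_orth hL).
have [q _ sq] := ps k0N.
have puhi : primitive_on (x k0) (x k0.+1) uh (fun z => w z * s z).
  exact: (primitive_elem hm k0N puh).
rewrite (flux_eq hbm hbp (primitive_continuous_at psig gab) gab du).
rewrite (@flux_eq _ _ _ _ hbm hbp _ _ uh (horner q) g (@continuous_horner _ q g) ig); last first.
  by move=> y yi ya; rewrite (derive1_weight puhi sq yi ya).
rewrite -(sq g ig); apply: h => //; rewrite horner_refine -(ref_coordE hm) //.
exact/rootP.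
Qed.

End InterfaceElement.

End Estimates.

End ElementEstimates.

Lemma interface_norm_infty_ge0 {R : realType} (a b alpha : R) m (v : R -> R) :
  (0 <= interface_norm_infty a b alpha m v)%E.
Proof.
by rewrite /interface_norm_infty le_max /sobolev_norm_infty bigmax_ge_id.
Qed.

(** An infinite norm makes the bound trivial provided that B > 0, because zero times infinity is
    zero. *)
Lemma le_EFin_mul {R : realType} (A B : R) (v : \bar R) : (0 <= v)%E -> 0 < B ->
  (forall M, 0 <= M -> (v <= M%:E)%E -> A <= B * M) -> (A%:E <= B%:E * v)%E.
Proof.
move=> v0 B0 h; case: v v0 h => [r| |] // r0 h.
  by rewrite -EFinM lee_fin h // -lee_fin.
by rewrite gt0_muley ?lte_fin // leey.
Qed.

(** * Uniform constants and the final estimates *)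

Section WeightBounds.
Context {R : realType} (alpha betam betap rho betamin : R) (betamin0 : 0 < betamin).
Context (hmin : betamin = Num.min betap betam).
Context (hrho : rho = Num.max betap betam / Num.min betap betam).
Local Notation w := (weight alpha betam betap).

Lemma betam_gt0 : 0 < betam.
Proof. by move: betamin0; rewrite hmin lt_min => /andP[]. Qed.

Lemma betap_gt0 : 0 < betap.
Proof. by move: betamin0; rewrite hmin lt_min => /andP[]. Qed.

Lemma betamaxE : Num.max betap betam = rho * betamin.
Proof. by rewrite hrho -hmin mulfVK // gt_eqF. Qed.

Lemma rho_gt0 : 0 < rho.
Proof. by rewrite hrho -hmin divr_gt0 // lt_max betam_gt0 orbT. Qed.

Lemma weight_bounds y : (rho * betamin)^-1 <= w y <= betamin^-1.
Proof.
have bm := betam_gt0; have bp := betap_gt0.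
have r0 : 0 < rho * betamin by rewrite mulr_gt0 // rho_gt0.
rewrite /weight -betamaxE hmin /pwcst; case: ifP => _.
  by rewrite !lef_pV2 ?posrE ?lt_max ?lt_min ?bm ?bp ?orbT // le_max lexx orbT ge_min lexx orbT.
by rewrite !lef_pV2 ?posrE ?lt_max ?lt_min ?bm ?bp ?orbT // le_max lexx ge_min lexx.
Qed.

End WeightBounds.

Lemma flux_stable_le {R : realType} (a b : R) N (x : nat -> R) p w (gamma c Cs Cs' : R) :
  Cs <= Cs' -> flux_stable a b N x p w gamma c Cs -> flux_stable a b N x p w gamma c Cs'.
Proof.
move=> CC st t g eps pt t0 bg e0 ge orth.
exact: le_trans (st t g eps pt t0 bg e0 ge orth) (ler_wpM2r e0 CC).
Qed.

Lemma immersed_superconvergence (R : realType) (p : nat) (a b rho gamma c betamin kappa : R) :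
  (2 <= p)%N -> a < b -> 0 < betamin -> 0 < kappa -> 0 < rho ->
  exists2 C : R, 0 <= C &
  forall (alpha betam betap : R) (N k : nat) (x : nat -> R)
         (L : nat -> {poly R}) (phi : nat -> R -> R) (f u uh : R -> R) (M : R),
    let h := mesh_size N x in
    let ah := ref_coord x k.+1 alpha in
    a < alpha < b -> betamin = Num.min betap betam ->
    rho = Num.max betap betam / Num.min betap betam ->
    is_mesh a b N x -> (k < N)%N -> x k < alpha < x k.+1 ->
    gen_legendre ah betam betap L -> gen_lobatto ah betam betap L phi ->
    0 <= c \/ ife_stable a b alpha betam betap gamma c kappa N k.+1 p x phi ->
    sobolev_interface a b alpha betam betap p.+2 +oo%E u ->
    exact_solution a b alpha betam betap gamma c f u ->
    ife_solution a b alpha betam betap gamma c N k.+1 p x phi f uh ->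
    0 <= M -> (interface_norm_infty a b alpha p.+2 u <= M%:E)%E ->
    (forall i, (i < N)%N -> i != k ->
       (forall l, x i <= l <= x i.+1 -> lobatto p.+1 (ref_coord x i.+1 l) = 0 ->
          `|u l - uh l| <= C * h ^+ p.+2 * M) /\
       (forall g, x i < g < x i.+1 -> root (legendre p) (ref_coord x i.+1 g) ->
          `|derive1 u g - derive1 uh g| <= C * h ^+ p.+1 * M)) /\
    (forall l, x k <= l <= x k.+1 -> phi p.+1 (ref_coord x k.+1 l) = 0 ->
       `|u l - uh l| <= C * h ^+ p.+2 * M) /\
    (forall g, x k < g < x k.+1 -> root (L p) (ref_coord x k.+1 g) ->
       `|flux alpha betam betap u g - flux alpha betam betap uh g| <= C * h ^+ p.+1 * M).
Proof.
move=> hp hab hbmin hkappa hrho0.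
pose wm := (rho * betamin)^-1; pose wM := betamin^-1.
have wm0 : 0 < wm by rewrite invr_gt0 mulr_gt0.
have wM0 : 0 < wM by rewrite invr_gt0.
have ab0 : 0 <= b - a by rewrite subr_ge0 ltW.
(* The sum of the stability constants of the cases c >= 0 and inf-sup, so that a single C covers
   both. *)
pose Cs := wM * (b - a) + (b - a) / kappa.
have Cs1 : 0 <= wM * (b - a) by rewrite mulr_ge0 // ltW.
have Cs2 : 0 <= (b - a) / kappa by rewrite divr_ge0 // ltW.
have [C0 C00 hC0] := superconvergence wM gamma c hp hab wm0 (addr_ge0 Cs1 Cs2).
(* [rho * betamin] is the larger coefficient and turns bounds on derivatives of u into bounds on the
   flux; 1 + wM serves values, fluxes and derivatives alike. *)
pose C := (1 + wM) * (C0 * (rho * betamin)).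
have rb0 : 0 <= rho * betamin by rewrite mulr_ge0 // ltW.
have CC0 : 0 <= C0 * (rho * betamin) by rewrite mulr_ge0.
exists C; first by rewrite mulr_ge0 // addr_ge0 // ltW.
move=> alpha betam betap N k x L phi f u uh M h ah haal hmin hrho hm kN hal hL hphi hst su es uhs M0 uM.
have hbm := betam_gt0 hbmin hmin; have hbp := betap_gt0 hbmin hmin.
have wB y : a < y < b -> wm <= weight alpha betam betap y <= wM.
  by move=> _; exact: weight_bounds.
have /andP[aal alb] := haal.
have [S [pS SM pu du]] := interface_regularity aal alb hbm hbp su uM.
rewrite (betamaxE hbmin hmin hrho) in SM.
have [_ ua _ _ _] := es.
have [s [ps puh uha uhb]] := ife_space_primitive hm hbm hbp kN hal hp hL hphi (proj1 uhs).
have bw : bmeas a b (weight alpha betam betap) by exact: weight_bmeas.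
have b0 : bmeas a b (S 0%N) by exact: primitive_bmeas (pS 0%N isT).
have p1 : (1 <= p)%N by exact: ltnW.
have wcst i : (i < N)%N -> i != k ->
    exists om, forall y, x i < y < x i.+1 -> weight alpha betam betap y = om.
  by move=> iN ik; have [om _ hom] := weight_elem hm hbm hbp kN hal iN ik; exists om.
have mean0 v (r : R -> R) : primitive_on a b v (fun y => weight alpha betam betap y * r y) ->
    v a = 0 -> v b = 0 -> integ a b (fun y => weight alpha betam betap y * r y) = 0.
  by move=> [_ /(_ a b (lexx _) (ltW hab) (lexx _)) <-] -> ->; rewrite subrr.
have ub : u b = 0 by have [] := es.
have stab : flux_stable a b N x p (weight alpha betam betap) gamma c Cs.
  case: hst => [c0|hst].
    have st := coercive_flux_stable (N := N) (p := p) (gamma := gamma) hab hm wm0 wB c0.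
    by refine (flux_stable_le _ st); rewrite /Cs lerDl.
  have st := ife_flux_stable hab hm hbm hbp kN hal hp hL hphi hkappa hst.
  by refine (flux_stable_le _ st); rewrite /Cs lerDr.
have orth := ife_flux_orthogonal hab hm hbm hbp kN hal hp hL hphi (pS 0%N isT) (pS 1%N p1) pu du es ps puh uha uhs.
have MS0 : 0 <= rho * betamin * M by rewrite mulr_ge0.
have tay n i : (n <= p.+1)%N -> (i < N)%N -> exists2 Q : {poly R}, (size Q <= n)%N &
    forall y, x i < y < x i.+1 -> `|S 0%N y - Q.[y]| <= rho * betamin * M * h ^+ n.
  move=> np iN.
  have pSi j : (j < n)%N -> primitive_on (x i) (x i.+1) (S j) (S j.+1).
    by move=> jn; apply: (primitive_elem hm iN); apply: pS; rewrite -ltnS (leq_trans jn).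
  have SMi y : x i < y < x i.+1 -> `|S n y| <= rho * betamin * M.
    by move=> yi; apply: SM => //; exact: (mesh_itv hm iN).
  have [Q sQ hQ] := taylor_approx (mesh_lt hm iN) pSi SMi.
  exists Q => // y yi; apply: le_trans (hQ y yi) _; apply: ler_wpM2l => //.
  apply: lerXn2r; rewrite ?nnegrE ?subr_ge0 ?mesh_size_ge0 //.
    by rewrite ltW // (mesh_lt hm).
  exact: (mesh_size_ge x iN).
have est := hC0 N x (weight alpha betam betap) k (S 0%N) s (rho * betamin * M) hm bw wB wcst b0
  (mean0 u _ pu ua ub) ps (mean0 uh _ puh uha uhb) stab orth MS0
  (fun i iN => tay p i (leqnSn p) iN) (fun i iN => tay p.+1 i (leqnn _) iN).
have wB0 y : a < y < b -> 0 <= weight alpha betam betap y <= wM.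
  by move=> /wB /andP[w1 ->]; rewrite (le_trans (ltW wm0)).
have h0 n : 0 <= h ^+ n by rewrite exprn_ge0 // mesh_size_ge0.
have K0 n : C0 * (rho * betamin * M) * h ^+ n <= C * h ^+ n * M.
  have -> : C * h ^+ n * M = (1 + wM) * (C0 * (rho * betamin * M) * h ^+ n) by rewrite /C; ring.
  rewrite mulrDl mul1r lerDl mulr_ge0 ?(ltW wM0) // mulr_ge0 // mulr_ge0 //.
have K1 n : wM * (C0 * (rho * betamin * M) * h ^+ n) <= C * h ^+ n * M.
  have -> : C * h ^+ n * M = (1 + wM) * (C0 * (rho * betamin * M) * h ^+ n) by rewrite /C; ring.
  by rewrite mulrDl mul1r lerDr mulr_ge0 // mulr_ge0.
have cS1 := pS 0%N isT.
split=> [i iN ik|]; first split=> [l il lr|g ig gr].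
- apply: le_trans (K0 _).
  exact: (noninterface_value hab hm hbm hbp kN hal hp cS1 pu ps puh ua uha est iN ik il lr).
- apply: le_trans (K1 _).
  exact: (noninterface_derivative hm hbm hbp kN hal du ps puh wB0 est iN ik ig gr).
split=> [l il lr|g ig gr].
- apply: le_trans (K0 _).
  exact: (interface_value hab hm hbm hbp kN hp cS1 pu ps puh ua uha est hL hphi il lr).
- apply: le_trans (K0 _).
  exact: (interface_flux hm hbm hbp kN cS1 du ps puh est hL ig gr).
Qed.

Theorem theorem4p2 (R : realType) (p : nat) (a b rho gamma c betamin kappa : R)
    (hp : (2 <= p)%N) (hab : a < b) (hbetamin : 0 < betamin) (hkappa : 0 < kappa) :
  exists C : R,
  forall (alpha betam betap : R) (N k : nat) (x : nat -> R)
         (L : nat -> {poly R}) (phi : nat -> R -> R) (f u uh : R -> R),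
    let h := mesh_size N x in
    let ah := ref_coord x k alpha in
    let normu := interface_norm_infty a b alpha p.+2 u in
    a < alpha < b ->
    betamin = Num.min betap betam ->
    rho = Num.max betap betam / Num.min betap betam ->
    is_mesh a b N x -> (0 < k <= N)%N -> x k.-1 < alpha < x k ->
    gen_legendre ah betam betap L ->
    gen_lobatto ah betam betap L phi ->
    0 <= c \/ ife_stable a b alpha betam betap gamma c kappa N k p x phi ->
    sobolev_interface a b alpha betam betap p.+2 +oo%E u ->
    exact_solution a b alpha betam betap gamma c f u ->
    ife_solution a b alpha betam betap gamma c N k p x phi f uh ->
    (forall i, (0 < i <= N)%N -> i != k ->
       (forall l, x i.-1 <= l <= x i ->
          lobatto p.+1 (ref_coord x i l) = 0 ->
          (`|u l - uh l|%:E <= (C * h ^+ p.+2)%:E * normu)%E) /\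
       (forall g, x i.-1 < g < x i ->
          root (legendre p) (ref_coord x i g) ->
          (`|derive1 u g - derive1 uh g|%:E <= (C * h ^+ p.+1)%:E * normu)%E)) /\
    ((forall l, x k.-1 <= l <= x k ->
        phi p.+1 (ref_coord x k l) = 0 ->
        (`|u l - uh l|%:E <= (C * h ^+ p.+2)%:E * normu)%E) /\
     (forall g, x k.-1 < g < x k ->
        root (L p) (ref_coord x k g) ->
        (`|flux alpha betam betap u g - flux alpha betam betap uh g|%:E
           <= (C * h ^+ p.+1)%:E * normu)%E)).
Proof.
(* A ratio of positive coefficients is positive, so for rho <= 0 the hypotheses are contradictory
   and any constant will do. *)
have [rho0|rho_gt0] := leP rho 0.
  exists 0 => alpha betam betap N k x L phi f u uh h ah normu _ hmin hrho.
  by have := rho_gt0 hbetamin hmin hrho; rewrite ltNge rho0.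
have [C C0 hC] := immersed_superconvergence gamma c hp hab hbetamin hkappa rho_gt0.
(* Adding 1 makes the constant strictly positive, as an infinite norm demands. Elements are numbered
   from 1 here and from 0 before, hence the case split on k. *)
exists (C + 1) => alpha betam betap N [|k] // x L phi f u uh h ah normu haal hmin hrho hm kN hal.
move=> hL hphi hst su es uhs.
have h0 : 0 < h by apply: lt_le_trans (mesh_size_ge x kN); rewrite subr_gt0 (mesh_lt hm).
have key (A : R) n : (forall M, 0 <= M -> (normu <= M%:E)%E -> A <= C * h ^+ n * M) ->
    (A%:E <= ((C + 1) * h ^+ n)%:E * normu)%E.
  move=> H; apply: le_EFin_mul => [||M M0 uM]; first exact: interface_norm_infty_ge0.
    by rewrite mulr_gt0 ?exprn_gt0 // ltr_wpDl.
  apply: le_trans (H M M0 uM) _; rewrite ler_wpM2r // ler_wpM2r ?exprn_ge0 ?(ltW h0) //.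
  by rewrite lerDl.
have est M M0 uM := hC alpha betam betap N k x L phi f u uh M haal hmin hrho hm kN hal hL hphi
  hst su es uhs M0 uM.
split=> [[|i] //= iN ik|]; first split=> [l il lr|g ig gr]; last split=> [l il lr|g ig gr].
- by apply: key => M M0 uM; have [H _] := est M M0 uM; have [H1 _] := H i iN ik; exact: H1.
- by apply: key => M M0 uM; have [H _] := est M M0 uM; have [_ H1] := H i iN ik; exact: H1.
- by apply: key => M M0 uM; have [_ [H _]] := est M M0 uM; exact: H.
- by apply: key => M M0 uM; have [_ [_ H]] := est M M0 uM; exact: H.
Qed.
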